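(* List $3$-Colouring is polynomial-time solvable for $(P_2+P_5)$-free graphs and for $(P_3+P_4)$-free graphs.
   Context: A colouring of a graph $G=(V,E)$ is a map $c:V\to\{1,2,\dots\}$ with $c(u)\neq c(v)$ whenever $uv\in E$. A $3$-list assignment of $G$ is a function $L$ assigning to each vertex $u$ a list $L(u)\subseteq\{1,2,3\}$; a colouring $c$ respects $L$ if $c(u)\in L(u)$ for all $u$. The problem List $3$-Colouring takes as input a graph $G$ and a $3$-list assignment $L$ and asks whether $G$ has a colouring respecting $L$. $P_n$ denotes the path on $n$ vertices, and $G_1+G_2$ denotes the disjoint union of graphs $G_1$ and $G_2$. A graph is $H$-free if it contains no induced subgraph isomorphic to $H$. *)

(* Defs.v *)
From mathcomp Require Import all_boot.
Set Implicit Arguments. Unset Strict Implicit. Unset Printing Implicit Defensive.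

Definition simple_graph (n : nat) (e : rel 'I_n) : Prop :=
  (forall u v, e u v = e v u) /\ (forall u, e u u = false).

Definition path_graph (m : nat) : rel 'I_m :=
  fun i j => (i.+1 == j :> nat) || (j.+1 == i :> nat).

Definition disj_union (a b : nat) (g1 : rel 'I_a) (g2 : rel 'I_b)
  : rel 'I_(a + b) :=
  fun i j => match split i, split j with
             | inl i1, inl j1 => g1 i1 j1
             | inr i2, inr j2 => g2 i2 j2
             | _, _ => false
             end.

Definition induced_sub (m : nat) (h : rel 'I_m) (n : nat) (e : rel 'I_n) : Prop :=
  exists f : 'I_m -> 'I_n, injective f /\ forall x y, h x y = e (f x) (f y).

Definition H_free (m : nat) (h : rel 'I_m) (n : nat) (e : rel 'I_n) : Prop :=
  ~ induced_sub h e.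

Definition list3_colourable (n : nat) (e : rel 'I_n) (L : 'I_n -> {set 'I_3})
  : Prop :=
  exists c : 'I_n -> 'I_3,
    (forall u, c u \in L u) /\ (forall u v, e u v -> c u != c v).

Definition encode (n : nat) (e : rel 'I_n) (L : 'I_n -> {set 'I_3}) : seq bool :=
  nseq n true ++ [:: false]
  ++ [seq e i j | i <- enum 'I_n, j <- enum 'I_n]
  ++ [seq k \in L u | u <- enum 'I_n, k <- enum 'I_3].

Inductive move := MoveL | MoveR | Stay.

(* States 'I_nq.+1 (start state 0); tape symbols 'I_ns.+3 with
   0 = blank, 1 = bit false, 2 = bit true.  The machine halts when delta
   is undefined; it then accepts iff acc holds of the current state. *)
Record TM := {
  tm_nq : nat;
  tm_ns : nat;
  tm_delta : 'I_tm_nq.+1 -> 'I_tm_ns.+3 ->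
             option ('I_tm_nq.+1 * 'I_tm_ns.+3 * move);
  tm_acc : 'I_tm_nq.+1 -> bool
}.

Section TMsem.
Variable M : TM.

Definition state := 'I_(tm_nq M).+1.
Definition symb := 'I_(tm_ns M).+3.
Definition blank : symb := ord0.
Definition bit_sym (b : bool) : symb := inord (if b then 2 else 1).

(* configuration: state, tape left of head (nearest first), head symbol,
   tape right of head; all other cells are blank. *)
Record config := Config {
  cf_state : state; cf_left : seq symb; cf_head : symb; cf_right : seq symb }.

Definition step (c : config) : option config :=
  match tm_delta (cf_state c) (cf_head c) with
  | None => None
  | Some (q', s', mv) =>
      Some match mv with
      | Stay => Config q' (cf_left c) s' (cf_right c)
      | MoveL => match cf_left c with
                 | [::] => Config q' [::] blank (s' :: cf_right c)
                 | x :: l => Config q' l x (s' :: cf_right c)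
                 end
      | MoveR => match cf_right c with
                 | [::] => Config q' (s' :: cf_left c) blank [::]
                 | x :: r => Config q' (s' :: cf_left c) x r
                 end
      end
  end.

Fixpoint exec (t : nat) (c : config) : option config :=
  match step c with
  | None => Some c
  | Some c' => if t is t'.+1 then exec t' c' else None
  end.

Definition init (x : seq bool) : config :=
  match map bit_sym x with
  | [::] => Config ord0 [::] blank [::]
  | s :: r => Config ord0 [::] s r
  end.

End TMsem.

(* A machine M decides, in polynomial time, a predicate P on the
   instances from a graph class C (a promise problem: inputs outside C
   are unconstrained). Running time is bounded by a * (|x| + 1)^d. *)
Definition poly_time_list3col_on
  (C : forall n : nat, rel 'I_n -> Prop) : Prop :=
  exists (M : TM) (a d : nat),
    forall (n : nat) (e : rel 'I_n) (L : 'I_n -> {set 'I_3}),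
      simple_graph e -> C n e ->
      let x := encode e L in
      exists cf : config M,
        @exec M (a * (size x).+1 ^ d) (@init M x) = Some cf /\
        (@tm_acc M (cf_state cf) = true <-> list3_colourable e L).

Definition P2P5 : rel 'I_(2 + 5) := disj_union (@path_graph 2) (@path_graph 5).
Definition P3P4 : rel 'I_(3 + 4) := disj_union (@path_graph 3) (@path_graph 4).

(* Main.v *)
(** Suppose that c is a colouring respecting L, and fix a vertex r. In a P5-free
    graph, minimal covers of the distance layers by one colour class have
    pairwise adjacent private neighbours, hence at most three vertices per
    colour, so 19 vertices dominate the component of r. Otherwise an induced P5
    (for P2+P5), or an induced P4 together with at most 12 vertices separating
    crossing pairs (for P3+P4), leaves undominated vertices that induce disjoint
    cliques and whose dominated neighbourhoods are nested along each clique.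
    After guessing the colours of these vertices, every dominated vertex has at
    most two possible colours. By Hall's theorem and nestedness, an undominated
    clique can be coloured as soon as this holds for each pair of dominated
    vertices and no undominated vertex sees all three colours. The latter is not
    a binary condition in general, but guessing a bounded number of further
    "stars" (an undominated vertex with three dominated neighbours) makes it
    one: a long sequence of stars of the same type, chosen greedily, contains
    one of the forbidden subgraphs. Thus for a correct guess all conditions form
    a binary constraint network with two values per variable, which path
    consistency decides, while a solution for any guess yields a colouring of
    the component of r.

    The test "for all r there is a guess whose network is path consistent" is
    written in a small language with quantifiers over vertices and a bit memory.
    Its terms compile to structured programs over finitely many stacks, whose
    running time is polynomial because all loops are bounded by n, and these are
    simulated on one tape with one track per stack. *)

Require Import Defs.
From mathcomp Require Import all_boot zify.
Set Implicit Arguments. Unset Strict Implicit. Unset Printing Implicit Defensive.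

(** * Induced paths and stars *)

(** The obstacle is that an undominated vertex [u] must not see all three colours: a ternary
    condition on its dominated neighbours, while path consistency settles binary conditions on
    two-valued variables. It becomes binary in two cases. If the lists of three neighbours force a
    colour [k] to occur next to [u], it says that no two neighbours form a rainbow with [k]. If the
    neighbours of [u] have at most two kinds of lists, it suffices that neighbours of the same kind
    agree whenever both kinds occur. For a true colouring without a forced colour, the second case
    can fail in two ways only: two neighbours of one kind differ although another kind occurs, or
    three kinds occur. Each failure yields a star, with [ck = cb] and [ck = cc] respectively.
    Choosing every star relative to the vertices guessed before settles most adjacencies between
    different stars; pigeonhole among seven stars handles the rest.

    The structural facts drawn from a correct guess are tested again inside the network, so a wrong
    guess that passes does no harm. *)

Section Patterns.
Variables (T : finType) (e : rel T).

Definition is_path3 a b c := [&& a != c, e a b, e b c & ~~ e a c].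
Definition is_path4 p q r s :=
  [&& e p q, e q r, e r s, ~~ e p r, ~~ e p s & ~~ e q s].
Definition is_path5 p q r s t :=
  [&& e p q, e q r, e r s, e s t, ~~ e p r, ~~ e p s, ~~ e p t, ~~ e q s,
      ~~ e q t & ~~ e r t].
Definition anti (A B : seq T) := all (fun x => all (fun y => ~~ e x y) B) A.

Definition noP2P5 := forall a b p q r s t,
  e a b -> is_path5 p q r s t -> anti [:: a; b] [:: p; q; r; s; t] -> False.
Definition noP3P4 := forall a b c p q r s,
  is_path3 a b c -> is_path4 p q r s -> anti [:: a; b; c] [:: p; q; r; s] ->
  False.

End Patterns.

Section Stars.
Variables (T : finType) (e : rel T) (col : T -> 'I_3) (I : pred T).
Hypothesis esym : symmetric e.
Hypothesis ecol : forall x y, e x y -> col x != col y.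

Lemma same_colour x y : col x = col y -> ~~ e x y.
Proof. by move=> h; apply/negP => /ecol; rewrite h eqxx. Qed.

Definition star_type := ('I_3 * 'I_3 * 'I_3 * 'I_3 * T * T)%type.
Definition ca (tau : star_type) := tau.1.1.1.1.1.
Definition cb (tau : star_type) := tau.1.1.1.1.2.
Definition cc (tau : star_type) := tau.1.1.1.2.
Definition ck (tau : star_type) := tau.1.1.2.
Definition sp (tau : star_type) := tau.1.2.
Definition sq (tau : star_type) := tau.2.

Definition only_colour (S : seq T) (x : T) (k : 'I_3) :=
  (x \notin S) && all (fun s => e x s ==> (col s == k)) S.

(* y, z and t are neighbours of the list-3 vertex u. In the paper's setting
   they have lists of size two, the missing colour being cb, ca and ck. *)
Definition star (tau : star_type) (S : seq T) (y z t u : T) :=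
  [&& I u, e u y, e u z & e u t] &&
  [&& ~~ I y, ~~ I z & ~~ I t] &&
  [&& col y == cc tau, col z == cc tau, col t == ca tau & col u == cb tau] &&
  [&& only_colour S y (cb tau), only_colour S z (ca tau)
    & only_colour S t (ck tau)] &&
  all (fun s => e u s ==> I s) S &&
  [&& e (sp tau) y, e (sq tau) z & ~~ (e t y && ((ck tau == cb tau) || e t z))].

(** The vertices [sp] and [sq] dominate all the [y] and all the [z] of a chain and remove [cb] and
    [ca] from their lists. Fixing them in the type makes them common neighbours, through which the
    long paths below run. *)
Definition good_type (tau : star_type) (S : seq T) :=
  [&& uniq [:: ca tau; cb tau; cc tau],
      (ck tau == cb tau) || (ck tau == cc tau),
      sp tau \in S, sq tau \in S, ~~ I (sp tau), ~~ I (sq tau),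
      col (sp tau) == cb tau & col (sq tau) == ca tau].

Fixpoint star_chain tau (S : seq T) (l : seq (T * T * T * T)) : bool :=
  if l is (y, z, t, u) :: l' then
    star tau S y z t u && star_chain tau ([:: y; z; t; u] ++ S) l'
  else true.

(** Stars are taken greedily; if the choice stops before [m] stars, the at most [4 * m] vertices
    used so far block every further star. *)
Lemma star_greedy tau m (S : seq T) :
  (exists2 l, size l = m & star_chain tau S l) \/
  (exists S', [/\ size S' <= 4 * m, {subset S <= S' ++ S}
     & forall y z t u, ~~ star tau (S' ++ S) y z t u]).
Proof.
elim: m S => [|m IH] S; first by left; exists [::].
case: (pickP (fun w : T * T * T * T => star tau S w.1.1.1 w.1.1.2 w.1.2 w.2)).
  case=> [[[y z] t] u] /= hs.
  case: (IH ([:: y; z; t; u] ++ S)) => [[l hl hc]|[S' [h1 h2 h3]]].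
    by left; exists ((y, z, t, u) :: l); [rewrite /= hl | rewrite /= hs].
  right; exists (S' ++ [:: y; z; t; u]); split.
  - by rewrite size_cat /=; lia.
  - by move=> x hx; rewrite !mem_cat hx !orbT.
  - by move=> *; rewrite -catA; apply: h3.
move=> h; right; exists [::]; split => // y z t u.
by have /negbT := h (y, z, t, u).
Qed.

Lemma star_chainP tau S l w : star_chain tau S l ->
  forall j, j < size l -> exists S', [/\ {subset S <= S'},
     (let: (y, z, t, u) := nth w l j in star tau S' y z t u) &
     forall i, i < j -> let: (y, z, t, u) := nth w l i in
       {subset [:: y; z; t; u] <= S'}].
Proof.
elim: l S => [|[[[y z] t] u] l IH] S //= /andP[h1 h2] [|j] hj.
  by exists S; split.
case: (IH _ h2 j hj) => S' [k1 k2 k3]; exists S'; split => //.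
  by move=> x hx; apply: k1; rewrite !inE hx !orbT.
case=> [|i] hi /=; last exact: (k3 i).
by move=> x hx; apply: k1; rewrite (mem_cat x [:: y; z; t; u]) hx.
Qed.

(** * Adjacencies inside a long chain of stars *)

Section Sequence.
Variables (tau : star_type) (S : seq T) (m : nat).
Hypothesis gt : good_type tau S.
Variables y z t u : nat -> T.
Hypothesis seqP : forall j, j < m -> exists S', [/\ {subset S <= S'},
   star tau S' (y j) (z j) (t j) (u j) &
   forall i, i < j -> {subset [:: y i; z i; t i; u i] <= S'}].
Let p := sp tau.
Let q := sq tau.

Lemma starP j : j < m ->
  [/\ [/\ I (u j), e (u j) (y j), e (u j) (z j) & e (u j) (t j)],
      [/\ col (y j) = cc tau, col (z j) = cc tau, col (t j) = ca tau
        & col (u j) = cb tau],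
      [/\ ~~ I (y j), ~~ I (z j) & ~~ I (t j)],
      [/\ e p (y j), e q (z j) & ~~ (e (t j) (y j) &&
        ((ck tau == cb tau) || e (t j) (z j)))] &
      exists S', [/\ {subset S <= S'}, 
       [/\ only_colour S' (y j) (cb tau), only_colour S' (z j) (ca tau)
         & only_colour S' (t j) (ck tau)],
       all (fun s => e (u j) s ==> I s) S'
     & forall i, i < j -> {subset [:: y i; z i; t i; u i] <= S'}]].
Proof.
move=> hj; case: (seqP hj) => S' [h1 h2 h3].
move: h2; rewrite /star -!andbA.
case/and5P=> a1 a2 a3 a4 /and5P[b1 b2 b3 /eqP c1] /and5P[/eqP c2 /eqP c3
  /eqP c4 d1] /and5P[d2 d3 f1 g1
  /and5P[g2 g3 g4 g5 g6]].
split; [by split | by split | by split | by split | ].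
by exists S'; split => //; split; apply/andP; split.
Qed.

Lemma colours_uniq : [/\ ca tau != cb tau, ca tau != cc tau & cb tau != cc tau].
Proof. by case/and4P: gt => /=; rewrite !inE negb_or andbT => /andP[/andP[-> ->] ->]. Qed.

(** Among the earlier vertices [u j] has neighbours in [I] only, and [y i] lies outside [I]. The
    next two lemmas hold for the same reason. *)
Lemma s_uy i j : i < j < m -> ~~ e (u j) (y i).
Proof.
case/andP=> hij hj; case: (starP hj) => _ _ _ _ [S' [_ _ h h3]].
case: (starP (ltn_trans hij hj)) => _ _ [hI _ _] _ _.
move/allP: h => h; have hin : y i \in S' by apply: (h3 _ hij); rewrite !inE eqxx.
by apply/negP => hE; have := h _ hin; rewrite hE (negbTE hI).
Qed.
Lemma s_uz i j : i < j < m -> ~~ e (u j) (z i).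
Proof.
case/andP=> hij hj; case: (starP hj) => _ _ _ _ [S' [_ _ h h3]].
case: (starP (ltn_trans hij hj)) => _ _ [_ hI _] _ _.
move/allP: h => h; have hin : z i \in S' by apply: (h3 _ hij); rewrite !inE eqxx !orbT.
by apply/negP => hE; have := h _ hin; rewrite hE (negbTE hI).
Qed.
Lemma s_ut i j : i < j < m -> ~~ e (u j) (t i).
Proof.
case/andP=> hij hj; case: (starP hj) => _ _ _ _ [S' [_ _ h h3]].
case: (starP (ltn_trans hij hj)) => _ _ [_ _ hI] _ _.
move/allP: h => h; have hin : t i \in S' by apply: (h3 _ hij); rewrite !inE eqxx !orbT.
by apply/negP => hE; have := h _ hin; rewrite hE (negbTE hI).
Qed.

Lemma s_yy i j : i < m -> j < m -> ~~ e (y i) (y j).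
Proof. by move=> /starP[_ [h _ _ _] _ _ _] /starP[_ [k _ _ _] _ _ _]; apply: same_colour; rewrite h k. Qed.
Lemma s_yz i j : i < m -> j < m -> ~~ e (y i) (z j).
Proof. by move=> /starP[_ [h _ _ _] _ _ _] /starP[_ [_ k _ _] _ _ _]; apply: same_colour; rewrite h k. Qed.
Lemma s_zz i j : i < m -> j < m -> ~~ e (z i) (z j).
Proof. by move=> /starP[_ [_ h _ _] _ _ _] /starP[_ [_ k _ _] _ _ _]; apply: same_colour; rewrite h k. Qed.
Lemma s_tt i j : i < m -> j < m -> ~~ e (t i) (t j).
Proof. by move=> /starP[_ [_ _ h _] _ _ _] /starP[_ [_ _ k _] _ _ _]; apply: same_colour; rewrite h k. Qed.
Lemma s_uu i j : i < m -> j < m -> ~~ e (u i) (u j).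
Proof. by move=> /starP[_ [_ _ _ h] _ _ _] /starP[_ [_ _ _ k] _ _ _]; apply: same_colour; rewrite h k. Qed.

(** Star [i] is part of the set relative to which star [j] is chosen, so [only_colour] leaves a
    single colour for the earlier neighbours of [y j], [z j] and [t j]. *)
Lemma s_later i j x : i < j < m -> x \in [:: y i; z i; t i; u i] ->
  [/\ col x != cb tau -> ~~ e (y j) x, col x != ca tau -> ~~ e (z j) x
    & col x != ck tau -> ~~ e (t j) x].
Proof.
case/andP=> hij hj hx; case: (starP hj) => _ _ _ _ [S' [_ [h h' h''] _ h3]].
have hS := h3 _ hij _ hx.
by split; move=> hc; apply/negP => he; [case/andP: h|case/andP: h'|case/andP: h'']
  => _ /allP /(_ _ hS); rewrite he /= => /eqP hh; rewrite hh eqxx in hc.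
Qed.

(** The two orders have different reasons: an earlier [z i] is outside [I], and a later [z i]
    accepts earlier neighbours of colour [ca] only. For [y] the second reason fails: a later [y j]
    may see [u i], which has the accepted colour [cb]. *)
Lemma s_zu i j : i != j -> i < m -> j < m -> ~~ e (z i) (u j).
Proof.
move=> hij hi hj; case: (ltngtP i j) hij => // hij _.
  by rewrite esym; apply: s_uz; rewrite hij.
have [||_ h _] := @s_later j i (u j); first by rewrite hij.
  by rewrite !inE eqxx !orbT.
apply: h; case: (starP hj) => _ [_ _ _ ->] _ _ _.
by case: colours_uniq => h _ _; rewrite eq_sym.
Qed.

Lemma s_yu i j : i < j < m -> ~~ e (y i) (u j).
Proof. by rewrite esym; exact: s_uy. Qed.
Lemma s_q i : i < m -> [/\ e q (z i), ~~ e q (y i), ~~ e q (t i) & ~~ e q (u i)].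
Proof.
move=> hi; case: (starP hi) => _ [cy _ ct _] _ [_ hz _] [S' [hS [h _ _] h2 _]].
case/and5P: gt => _ _ _ hq /and4P[_ hI _ /eqP hc].
case: colours_uniq => ab ac bc.
split => //.
- apply/negP; rewrite esym => hE; case/andP: h => _ /allP /(_ _ (hS _ hq)).
  by rewrite hE hc (negbTE ab).
- by apply: same_colour; rewrite hc ct.
- apply/negP; rewrite esym => hE; move/allP: h2 => /(_ _ (hS _ hq)).
  by rewrite hE (negbTE hI).
Qed.

Lemma s_p i : ck tau = cc tau -> i < m ->
  [/\ e p (y i), ~~ e p (z i), ~~ e p (t i) & ~~ e p (u i)].
Proof.
move=> hk hi; case: (starP hi) => _ [cy _ ct _] _ [hy _ _] [S' [hS [_ h h'] h2 _]].
case/and5P: gt => _ _ hp _ /and4P[hI _ /eqP hc _].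
case: colours_uniq => ab ac bc.
split => //.
- apply/negP; rewrite esym => hE; case/andP: h => _ /allP /(_ _ (hS _ hp)).
  by rewrite hE hc eq_sym (negbTE ab).
- apply/negP; rewrite esym => hE; case/andP: h' => _ /allP /(_ _ (hS _ hp)).
  by rewrite hE hc hk (negbTE bc).
- apply/negP; rewrite esym => hE; move/allP: h2 => /(_ _ (hS _ hp)).
  by rewrite hE (negbTE hI).
Qed.

Lemma s_u i : i < m -> [/\ e (u i) (y i), e (u i) (z i) & e (u i) (t i)].
Proof. by case/starP => [[_ ? ? ?] _ _ _ _]. Qed.

Lemma s_tyz i j : ck tau = cb tau -> i < j < m ->
  ~~ e (t j) (y i) /\ ~~ e (t j) (z i).
Proof.
move=> hk hij; case: colours_uniq => ab ac bc.
have hi : i < m by lia.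
case: (starP hi) => _ [cy cz _ _] _ _ _.
split; [have [||_ _ h] := @s_later i j (y i) | have [||_ _ h] := @s_later i j (z i)] => //;
  rewrite ?inE ?eqxx ?orbT //; apply: h; rewrite hk ?cy ?cz eq_sym //.
Qed.

Lemma s_tu i j : ck tau = cc tau -> i < j < m -> ~~ e (t j) (u i).
Proof.
move=> hk hij; case: colours_uniq => ab ac bc.
have hi : i < m by lia.
case: (starP hi) => _ [_ _ _ cu] _ _ _.
have [||_ _ h] := @s_later i j (u i) => //;
  rewrite ?inE ?eqxx ?orbT //; apply: h; rewrite hk cu //.
Qed.
Lemma s_yt i j : i < j < m -> ~~ e (y j) (t i).
Proof.
move=> hij; case: colours_uniq => ab ac bc.
have hi : i < m by lia.
case: (starP hi) => _ [_ _ ct _] _ _ _.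
have [||h _ _] := @s_later i j (t i) => //;
  rewrite ?inE ?eqxx ?orbT //; apply: h; rewrite ct //.
Qed.

Lemma neq_colour x x' k k' : col x = k -> col x' = k' -> k != k' -> x != x'.
Proof. by move=> <- <-; apply: contraNneq => ->. Qed.

Lemma s_mem i j (x : T) : i < j < m -> x \in [:: y i; z i; t i; u i] ->
  [/\ y j != x, z j != x & t j != x].
Proof.
case/andP=> hij hj hx; case: (starP hj) => _ _ _ _ [S' [_ [h h' h''] _ h3]].
have hS := h3 _ hij _ hx.
by split; [move: h|move: h'|move: h'']; rewrite /only_colour;
  apply: contraTneq => ->; rewrite hS.
Qed.

Lemma s_zneq i j : i != j -> i < m -> j < m -> z i != z j.
Proof.
move=> hij hi hj; case: (ltngtP i j) hij => // hij _.
  have [||_ h _] := @s_mem i j (z i); rewrite ?inE ?eqxx ?orbT ?hij //.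
  by rewrite eq_sym.
by have [||_ h _] := @s_mem j i (z j); rewrite ?inE ?eqxx ?orbT ?hij //.
Qed.

Lemma s_uneq i j : i != j -> i < m -> j < m -> u i != u j.
Proof.
move=> hij hi hj; apply: contraTneq (isT) => h.
have : e (z i) (u i) by rewrite esym; case: (s_u hi).
by rewrite h (negbTE (s_zu hij hi hj)).
Qed.

Lemma yt_neq j : j < m -> y j != t j.
Proof.
move=> hj; case: (starP hj) => _ [cy _ ct _] _ _ _; case: colours_uniq => _ ac _.
by apply: (neq_colour cy ct); rewrite eq_sym.
Qed.
Lemma zt_neq j : j < m -> z j != t j.
Proof.
move=> hj; case: (starP hj) => _ [_ cy ct _] _ _ _; case: colours_uniq => _ ac _.
by apply: (neq_colour cy ct); rewrite eq_sym.
Qed.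

Lemma s_qz i : i < m -> e q (z i). Proof. by case/s_q. Qed.
Lemma s_qy i : i < m -> ~~ e q (y i). Proof. by case/s_q. Qed.
Lemma s_qt i : i < m -> ~~ e q (t i). Proof. by case/s_q. Qed.
Lemma s_qu i : i < m -> ~~ e q (u i). Proof. by case/s_q. Qed.
Lemma s_ey i : i < m -> e (u i) (y i). Proof. by case/s_u. Qed.
Lemma s_ez i : i < m -> e (u i) (z i). Proof. by case/s_u. Qed.
Lemma s_et i : i < m -> e (u i) (t i). Proof. by case/s_u. Qed.

Ltac edge1 := solve [ assumption | by apply: s_qz; lia | by apply: s_ey; lia
  | by apply: s_ez; lia | by apply: s_et; lia ].
Ltac ne1 := solve [ assumption
  | by apply: s_uy; lia | by apply: s_uz; lia | by apply: s_ut; lia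
  | by apply: s_yy; lia | by apply: s_yz; lia | by apply: s_zz; lia
  | by apply: s_tt; lia | by apply: s_uu; lia | by apply: s_zu; lia
  | by apply: s_yt; lia | by apply: s_qy; lia | by apply: s_qt; lia
  | by apply: s_qu; lia ].
Ltac solve1 := solve [ edge1 | rewrite esym; edge1 | ne1 | rewrite esym; ne1
  | by apply: s_zneq; lia | by apply: s_uneq; lia | by apply: yt_neq; lia
  | by apply: zt_neq; lia].
Ltac pat := rewrite /is_path5 /is_path4 /is_path3 /anti /= ?andbT;
  repeat (apply/andP; split); try solve1.

(** The common neighbour [q] links stars 1 and 2 to an induced path on five vertices. The edge comes
    from star 0 because [y j] may see earlier [u i] but no later ones. *)
Lemma stars_P2P5 : noP2P5 e -> 3 <= m -> False.
Proof.
move=> H hm; apply: (H (y 0) (u 0) (u 1) (z 1) q (z 2) (u 2)); pat.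
Qed.

Hypothesis H : noP3P4 e.

(** The vertices [u i], [y j], [u i'] form a path on three vertices, and two later stars supply the
    anticomplete path [z k], [q], [z l], [u l]. *)
Lemma two_earlier i i' j k l : i < j -> i' < j -> i != i' -> j < k < m ->
  j < l < m -> k != l -> e (y j) (u i) -> e (y j) (u i') -> False.
Proof.
move=> h1 h2 h3 h4 h5 h6 h7 h8.
by apply: (H (a:=u i) (b:=y j) (c:=u i') (p:=z k) (q:=q) (r:=z l) (s:=u l)); pat.
Qed.

(** For [j] = 3 and 4, each of [u 0], [u 1], [u 2] sees [y j] or [t j] ([star1]), at most one sees
    [y j] ([tw]), hence at least two see [t j]. So [t 3] and [t 4] have a common neighbour among
    them, against [star3]. Stars 5 and 6 only provide the path in [two_earlier], which is why seven
    are needed. *)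
Lemma stars_U1 : ck tau = cb tau -> 7 <= m -> False.
Proof.
move=> hk hm.
have tyz i j : i < j < m -> ~~ e (t j) (y i) by move=> h; case: (s_tyz hk h).
have tz i j : i < j < m -> ~~ e (t j) (z i) by move=> h; case: (s_tyz hk h).
have nty j : j < m -> ~~ e (t j) (y j).
  by move=> /starP[_ _ _ [_ _]]; rewrite hk eqxx andbT.
have star1 i j : i < j < 7 -> 1 < j -> e (y j) (u i) || e (t j) (u i).
  move=> hij hj; case: (boolP (e _ _)) => //= hy; case: (boolP (e _ _)) => //= ht.
  have [i' hi' hii] : exists2 i', i' < j & i' != i.
    by exists (if i == 0 then 1 else 0); case: (i =P 0); lia.
  by case: (H (a:=y j) (b:=u j) (c:=t j) (p:=z i') (q:=q) (r:=z i) (s:=u i)); pat;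
    (try (apply: nty; lia)); (try by rewrite esym; apply: nty; lia);
    (try (apply: tz; lia)); (try (apply: tyz; lia)).
have star3 i j k l h : i < j < k -> k < 7 -> l < j -> h < j -> l != h -> l != i -> h != i ->
    e (t j) (u i) -> e (t k) (u i) -> False.
  move=> h1 h2 h3 h4 h5 h6 h7 h8 h9.
  by apply: (H (a:=z l) (b:=q) (c:=z h) (p:=t j) (q:=u i) (r:=t k) (s:=u k)); pat;
  rewrite esym; apply: tz; lia.
have tw j i i' : 3 <= j < 5 -> i < 3 -> i' < 3 -> i != i' -> e (y j) (u i) -> e (y j) (u i') -> False.
  by move=> *; apply: (@two_earlier i i' j 5 6); rewrite //; lia.
have st j i : 3 <= j < 5 -> i < 3 -> e (y j) (u i) || e (t j) (u i).
  by move=> *; apply: star1; lia.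
move: (tw 3 0 1 isT isT isT isT) (tw 3 0 2 isT isT isT isT) (tw 3 1 2 isT isT isT isT).
move: (tw 4 0 1 isT isT isT isT) (tw 4 0 2 isT isT isT isT) (tw 4 1 2 isT isT isT isT).
move: (@star3 0 3 4 1 2 isT isT isT isT isT isT isT).
move: (@star3 1 3 4 0 2 isT isT isT isT isT isT isT).
move: (@star3 2 3 4 0 1 isT isT isT isT isT isT isT).
move: (st 3 0 isT isT) (st 3 1 isT isT) (st 3 2 isT isT).
move: (st 4 0 isT isT) (st 4 1 isT isT) (st 4 2 isT isT).
case: (e (t 3) (u 0)); case: (e (t 3) (u 1)); case: (e (t 3) (u 2));
case: (e (t 4) (u 0)); case: (e (t 4) (u 1)); case: (e (t 4) (u 2)) => /=;
rewrite ?orbF ?orbT => ? ? ? ? ? ?; intuition.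
Qed.

(** Once [B] has excluded the edge between [z j] and [t j] for [j] = 0, 1, property [A] shows that
    at least two of [y 2], [y 3], [y 4] see [u 0], and at least two see [u 1]. One of them sees
    both, against [two_earlier] with stars 5 and 6. *)
Lemma stars_U3 : ck tau = cc tau -> 7 <= m -> False.
Proof.
move=> hk hm.
have py i : i < m -> e p (y i) by case/(s_p hk).
have pz i : i < m -> ~~ e p (z i) by case/(s_p hk).
have pt i : i < m -> ~~ e p (t i) by case/(s_p hk).
have pu i : i < m -> ~~ e p (u i) by case/(s_p hk).
have tu i j : i != j -> i < m -> j < m -> ~~ e (t i) (u j).
  move=> hij hi hj; case: (ltngtP i j) hij => // hij _.
    by rewrite esym; apply: s_ut; lia.
  by apply: s_tu => //; lia.
have px := (py, pz, pt, pu).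
have A j k l : ~~ e (z j) (t j) -> j < k < l -> l < m -> e (y k) (u j) || e (y l) (u j).
  move=> hz hj hl; case: (boolP (e _ _)) => //= hy; case: (boolP (e _ _)) => //= ht.
  case: (H (a:=z j) (b:=u j) (c:=t j) (p:=y k) (q:=p) (r:=y l) (s:=u l)); pat;
   solve [ apply: py; lia | rewrite esym; apply: py; lia | apply: pu; lia | rewrite esym; apply: pu; lia
  | rewrite esym; apply: pz; lia | rewrite esym; apply: pt; lia | apply: tu; lia].
(* By the last condition on a star, [t j] now misses [y j]. Either [t j] sees a later [z k], and
   [z j], [t j], [z k] is the path on three vertices ([C]), or [y j], [u j], [t j] can be used. *)
have B j : e (z j) (t j) -> j + 5 <= m -> False.
  move=> hz hj.
  have nty : ~~ e (t j) (y j).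
    have /starP[_ _ _ [_ _ h] _] : j < m by lia.
    by move: h; rewrite [e (t j) (z j)]esym hz orbT andbT.
  have C k l h : j < k -> j < l < h -> h < m -> k < m -> k != l -> k != h -> e (t j) (z k) -> False.
    move=> *; apply: (H (a:=z j) (b:=t j) (c:=z k) (p:=y l) (q:=p) (r:=y h) (s:=u h)); pat;
   solve [ apply: py; lia | rewrite esym; apply: py; lia | apply: pu; lia | rewrite esym; apply: pu; lia
  | rewrite esym; apply: pz; lia | rewrite esym; apply: pt; lia | apply: tu; lia].
  case: (boolP (e (t j) (z j.+1))) => h1.
    by apply: (C j.+1 j.+2 j.+3) => //; lia.
  case: (boolP (e (t j) (z j.+2))) => h2.
    by apply: (C j.+2 j.+3 j.+4) => //; lia.
  apply: (H (a:=y j) (b:=u j) (c:=t j) (p:=z j.+1) (q:=q) (r:=z j.+2) (s:=u j.+2)); pat;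
   solve [apply: tu; lia | rewrite esym; apply: tu; lia | apply: s_yu; lia].
have z0 : ~~ e (z 0) (t 0) by apply/negP => h; apply: (B _ h); lia.
have z1 : ~~ e (z 1) (t 1) by apply/negP => h; apply: (B _ h); lia.
have D j : 2 <= j < 5 -> e (y j) (u 0) -> e (y j) (u 1) -> False.
  by move=> *; apply: (@two_earlier 0 1 j 5 6); rewrite //; lia.
have A0 k l : 0 < k < l -> l < 7 -> _ := fun h1 h2 => A 0 k l z0 h1 (leq_trans h2 hm).
have A1 k l : 1 < k < l -> l < 7 -> _ := fun h1 h2 => A 1 k l z1 h1 (leq_trans h2 hm).
move: (A0 2 3 isT isT) (A0 2 4 isT isT) (A0 3 4 isT isT).
move: (A1 2 3 isT isT) (A1 2 4 isT isT) (A1 3 4 isT isT).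
move: (D 2 isT) (D 3 isT) (D 4 isT).
case: (e (y 2) (u 0)); case: (e (y 3) (u 0)); case: (e (y 4) (u 0));
case: (e (y 2) (u 1)); case: (e (y 3) (u 1)); case: (e (y 4) (u 1)) => /= D1 D2 D3 *;
by [ | case: D1 | case: D2 | case: D3].
Qed.

End Sequence.

Lemma no_long_chain tau S l : noP2P5 e \/ noP3P4 e -> good_type tau S ->
  star_chain tau S l -> size l < 7.
Proof.
move=> H gt hc; rewrite ltnNge; apply/negP => hl.
case: l hc hl => // w l hc hl; have hP := star_chainP w hc.
set L := w :: l in hP hc hl.
have hs j : j < size L -> exists S', [/\ {subset S <= S'},
   star tau S' (nth w L j).1.1.1 (nth w L j).1.1.2 (nth w L j).1.2 (nth w L j).2 &
   forall i, i < j -> {subset [:: (nth w L i).1.1.1; (nth w L i).1.1.2;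
     (nth w L i).1.2; (nth w L i).2] <= S'}].
  move=> /hP [S' [h1 h2 h3]]; exists S'; split => //.
    by move: h2; case: (nth w L j) => [[[? ?] ?] ?].
  by move=> i /h3; case: (nth w L i) => [[[? ?] ?] ?].
case: H => H.
  by apply: (stars_P2P5 gt hs H); lia.
case/and5P: (gt) => _ /orP[]/eqP hk _ _ _.
  by apply: (stars_U1 gt hs H hk hl).
by apply: (stars_U3 gt hs H hk hl).
Qed.

(** The conditions on [S] are all universal over it, so vertices added for one type never create a
    star of another type. *)
Lemma star_anti tau S S' y z t u : {subset S <= S'} ->
  star tau S' y z t u -> star tau S y z t u.
Proof.
move=> hS; have oc x k : only_colour S' x k -> only_colour S x k.
  case/andP=> h1 /allP h2; apply/andP; split; first by apply: contra h1 => /hS.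
  by apply/allP => s /hS /h2.
rewrite /star => /andP[/andP[/andP[-> /and3P[/oc -> /oc -> /oc ->]] /allP h] ->].
by rewrite !andbT /=; apply/allP => s /hS /h.
Qed.

Lemma star_cover (taus : seq star_type) (S : seq T) : noP2P5 e \/ noP3P4 e ->
  {in taus, forall tau, good_type tau S} ->
  exists2 S', size S' <= 28 * size taus &
    {in taus, forall tau y z t u, ~~ star tau (S' ++ S) y z t u}.
Proof.
move=> H; elim: taus => [|tau taus IH] hg; first by exists [::].
case: IH => [x hx|S' h1 h2]; first by apply: hg; rewrite inE hx orbT.
case: (star_greedy tau 7 (S' ++ S)) => [[l hl hc]|[S'' [k1 k2 k3]]].
  have /(no_long_chain H) /(_ hc) : good_type tau (S' ++ S).
    have := hg tau (mem_head _ _); rewrite /good_type !mem_cat.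
    by case/and5P=> -> -> -> -> ->; rewrite !orbT.
  by rewrite hl.
exists (S'' ++ S'); first by rewrite size_cat /=; lia.
move=> x; rewrite inE => /orP[/eqP->|hx] y z t u; rewrite -catA //.
apply: contra (h2 x hx y z t u); apply: star_anti.
by move=> w hw; rewrite mem_cat hw orbT.
Qed.

End Stars.

(** * Dominating few vertices *)

Section Dominate.
Variables (T : finType) (e : rel T) (col : T -> 'I_3).
Hypothesis esym : symmetric e.
Hypothesis eirr : irreflexive e.
Hypothesis ecol : forall x y, e x y -> col x != col y.

Let same := same_colour ecol.

Definition dominated (S : seq T) x := has (fun s => (x == s) || e x s) S.

(* In a minimal cover every element has a private vertex, and the private
   vertices are pairwise adjacent. *)
Lemma clique_cover (Y R : pred T) :
  (forall u, R u -> exists2 y, Y y & e y u) ->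
  (forall y y' u u', Y y -> Y y' -> R u -> R u' -> e y u -> ~~ e y u' ->
     e y' u' -> ~~ e y' u -> e u u') ->
  exists S : seq T, [/\ size S <= 3, {subset S <= Y}
    & forall u, R u -> exists2 s, s \in S & e s u].
Proof.
move=> hcov hpriv.
pose P (A : {set T}) := (A \subset Y) && [forall u, R u ==> [exists s in A, e s u]].
have P0 : P [set y | Y y].
  apply/andP; split; first by apply/subsetP => y; rewrite inE.
  apply/forallP => u; apply/implyP => /hcov [y hy hyu].
  by apply/existsP; exists y; rewrite inE hy.
have [A /minsetP[/andP[/subsetP AY /forallP Acov] Amin] _] := minset_exists P0.
have priv a : a \in A -> exists u, [&& R u, e a u & [forall b in A, (b != a) ==> ~~ e b u]].
  move=> ha; case: (boolP [exists u, [&& R u, e a u & [forall b in A, (b != a) ==> ~~ e b u]]]).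
    by move/existsP.
  rewrite negb_exists => /forallP hn.
  have : A :\ a = A.
    apply: Amin; last exact: subD1set.
    apply/andP; split; first by apply/subsetP => x /setD1P[_ /AY].
    apply/forallP => u; apply/implyP => hu.
    have /existsP[s /andP[hs hsu]] := implyP (Acov u) hu.
    case: (altP (s =P a)) => [E|ns]; last by apply/existsP; exists s; rewrite !inE ns hs.
    have := hn u; rewrite hu -E hsu /= negb_forall => /existsP[b].
    by rewrite !negb_imply => /and4P[h1 h2 h3 _]; apply/existsP; exists b; rewrite !inE h2 h1 h3.
  by move/setP/(_ a); rewrite !inE eqxx ha.
pose f a := odflt a [pick u | [&& R u, e a u & [forall b in A, (b != a) ==> ~~ e b u]]].
have fP a : a \in A -> [&& R (f a), e a (f a) & [forall b in A, (b != a) ==> ~~ e b (f a)]].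
  by move=> /priv [u hu]; rewrite /f; case: pickP => [//|/(_ u)]; rewrite hu.
have inj : {in A &, injective (fun a => col (f a))}.
  move=> a b ha hb E; apply/eqP; apply: contraTT isT => nab.
  have /and3P[ra ea /forall_inP na] := fP _ ha.
  have /and3P[rb eb /forall_inP nb] := fP _ hb.
  have : e (f a) (f b).
    apply: (hpriv a b) => //; try exact: AY.
      by have := nb a ha; rewrite nab.
    by have := na b hb; rewrite eq_sym nab.
  by move/ecol; rewrite E eqxx.
exists (enum A); split.
- by rewrite -cardE -(card_in_imset inj); apply: leq_trans (max_card _) _; rewrite card_ord.
- by move=> x; rewrite mem_enum => /AY.
- move=> u hu; have /existsP[s /andP[hs hsu]] := implyP (Acov u) hu.
  by exists s; rewrite ?mem_enum.
Qed.

(** Splitting [Y] by colour makes [y] and [y'] non-adjacent, which the induced paths in the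
    application require; three classes with three vertices each give nine. *)
Lemma colour_cover (Y R : pred T) :
  (forall y y' u u', Y y -> Y y' -> R u -> R u' -> col y = col y' ->
     e y u -> ~~ e y u' -> e y' u' -> ~~ e y' u -> e u u') ->
  exists S : seq T, [/\ size S <= 9, {subset S <= Y}
    & forall u y, R u -> Y y -> e y u -> exists2 s, s \in S & e s u].
Proof.
move=> h.
have H (l : seq 'I_3) : exists S : seq T, [/\ size S <= 3 * size l, {subset S <= Y}
    & forall u y, R u -> Y y -> col y \in l -> e y u -> exists2 s, s \in S & e s u].
  elim: l => [|d l [S [h1 h2 h3]]]; first by exists [::].
  have [||S' [k1 k2 k3]] := @clique_cover [pred y | Y y && (col y == d)]
     [pred u | R u && [exists y, [&& Y y, col y == d & e y u]]].
  - by move=> u /= /andP[_ /existsP[y /and3P[a b c]]]; exists y; rewrite ?a.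
  - move=> y y' u u' /= /andP[a /eqP b] /andP[a' /eqP b'] /andP[ru _] /andP[ru' _].
    by apply: h => //; rewrite b b'.
  exists (S' ++ S); split.
  - by rewrite size_cat /=; lia.
  - by move=> x; rewrite mem_cat => /orP[/k2/andP[]|/h2].
  - move=> u y ru yy; rewrite inE => /orP[hd|hl] eyu.
      case: (k3 u) => [|s hs esu]; last by exists s; rewrite // mem_cat hs.
      by rewrite /= ru; apply/existsP; exists y; rewrite yy hd.
    by case: (h3 u y) => // s hs esu; exists s; rewrite // mem_cat hs orbT.
have [S [h1 h2 h3]] := H (enum 'I_3); exists S; split => //.
  by rewrite size_enum_ord in h1.
by move=> u y ru yy eyu; apply: (h3 u y) => //; rewrite mem_enum.
Qed.

Ltac path := rewrite /is_path5 /is_path4 /is_path3 /anti /= ?andbT;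
  repeat (apply/andP; split); try solve [assumption | rewrite esym; assumption].

Definition noP5 := forall p q r s t, ~~ is_path5 e p q r s t.

Lemma P5_free_dominated r : noP5 ->
  exists S, [/\ size S <= 19, dominated S r &
    forall x y, dominated S x -> e x y -> dominated S y].
Proof.
move=> H.
pose N1 := [pred x | e r x].
pose N2 := [pred x | [&& x != r, ~~ e r x & [exists y, N1 y && e y x]]].
pose N3 := [pred x | [&& x != r, ~~ e r x, ~~ N2 x & [exists y, N2 y && e y x]]].
have pth p q s t w : is_path5 e p q s t w -> False by move=> h; have := H p q s t w; rewrite h.
have [|C1 [a1 a2 a3]] := @colour_cover N1 N2.
  move=> y y' u u' /= hy hy' /and3P[n1 n2 _] /and3P[n1' n2' _] /same nyy' e1 e2 e3 e4.
  apply: contraT => ne; case: (pth u y r y' u'); path.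
have [|C2 [b1 b2 b3]] := @colour_cover N2 N3.
  move=> v v' u u' hv hv'.
  have /and3P[n1 n2 /existsP[y /andP[ry yv]]] := hv.
  have /and3P[n1' n2' /existsP[y' /andP[ry' yv']]] := hv'.
  case/and4P=> /= m1 m2 m3 _ /and4P[/= m1' m2' m3' _] /same nvv' e1 e2 e3 e4.
  have far w x : w != r -> ~~ e r w -> ~~ N2 w -> e r x -> ~~ e x w.
    move=> h1 h2 h3 h4; apply: contra h3 => h5; rewrite /= h1 h2.
    by apply/existsP; exists x; rewrite /= h4.
  have [nyu nyu' nyu1 nyu1'] : [/\ ~~ e y u, ~~ e y u', ~~ e y' u & ~~ e y' u'].
    by split; apply: far.
  apply: contraT => ne.
  (* A path from [v] to [v'] runs through a common parent in [N1] if there is one, otherwise through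
     adjacent parents or through the root; in each case five consecutive vertices are induced. *)
  case: (boolP (e y v')) => yv'1.
    by case: (pth u v y v' u'); path.
  case: (boolP (e y' v)) => yv1.
    by case: (pth u v y' v' u'); path.
  case: (boolP (e y y')) => yy'.
    by case: (pth u v y y' v'); path.
  by case: (pth v y r y' v'); path.
pose S := r :: C1 ++ C2.
have dom0 : dominated S r by rewrite /dominated /= eqxx.
have dom1 x : N1 x -> dominated S x by rewrite /dominated /= esym => ->; rewrite orbT.
have domC s x : s \in C1 ++ C2 -> e s x -> dominated S x.
  by move=> hs hsx; apply/hasP; exists s; rewrite ?inE ?hs ?orbT // esym hsx orbT.
have dom2 x : N2 x -> dominated S x.
  move=> hx; have /and3P[_ _ /existsP[y /andP[hy hyx]]] := hx.
  by have [s hs] := a3 x y hx hy hyx; apply: domC; rewrite mem_cat hs.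
have dom3 x : N3 x -> dominated S x.
  move=> hx; have /and4P[_ _ _ /existsP[y /andP[hy hyx]]] := hx.
  by have [s hs] := b3 x y hx hy hyx; apply: domC; rewrite mem_cat hs orbT.
pose B := [pred x | [|| x == r, N1 x, N2 x | N3 x]].
have Bdom x : B x -> dominated S x.
  by case/or4P=> [/eqP->|||]; [|exact: dom1|exact: dom2|exact: dom3].
have N1B x y : N1 x -> e x y -> B y.
  move=> hx hxy; apply: contraT; rewrite inE => /norP[nr /norP[n1 /norP[n2 _]]].
  case/negP: n2; rewrite /= nr; move: n1 => /= ->; apply/existsP; exists x.
  by rewrite hxy andbT; exact: hx.
have N2B x y : N2 x -> e x y -> B y.
  move=> hx hxy; apply: contraT; rewrite inE => /norP[nr /norP[n1 /norP[n2 n3]]].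
  case/negP: n3; rewrite /=; apply/and4P.
  split; [exact: nr | exact: n1 | exact: n2 |]; apply/existsP; exists x.
  by rewrite hxy andbT; exact: hx.
have BB x y : B x -> e x y -> B y.
  case/or4P=> [/eqP->|h|h|h] hxy.
  - by rewrite inE /= hxy orbT.
  - exact: N1B h hxy.
  - exact: N2B h hxy.
  apply: contraT; rewrite inE => /norP[nr /norP[n1 /norP[n2 n3]]].
  have /and4P[/= h1 h2 h3 /existsP[v /andP[hv hvx]]] := h.
  have /and3P[/= k1 k2 /existsP[w /andP[/= hw hwv]]] := hv.
  have nwx : ~~ e w x.
    by apply: contra h3 => E; rewrite /= h1 h2; apply/existsP; exists w; rewrite /= hw.
  have nwy : ~~ e w y.
    apply: contra n2 => E; rewrite /= nr; move: n1 => /= ->; apply/existsP; exists w.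
    by rewrite /= hw.
  have nvy : ~~ e v y.
    apply: contra n3 => E; rewrite /=; apply/and4P.
    split; [exact: nr | exact: n1 | exact: n2 |]; apply/existsP; exists v.
    by rewrite E andbT; exact: hv.
  (* A vertex in a fourth layer would end an induced path on five vertices starting at [r]. *)
  by move: n1 => /= n1; case: (pth y x v w r); path.
exists S; split => //.
  by rewrite /= size_cat; lia.
have domB x : dominated S x -> B x.
  have SB s : s \in S -> B s.
    rewrite inE mem_cat => /or3P[/eqP->|/a2 h|/b2 h].
    - by rewrite inE eqxx.
    - by rewrite inE; apply/or4P; constructor 2.
    - by rewrite inE; apply/or4P; constructor 3.
  case/hasP=> s hs /orP[/eqP->|h]; first exact: SB.
  by apply: BB (SB s hs) _; rewrite esym.
by move=> x y /domB hx /(BB _ _ hx) /Bdom.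
Qed.

(** * Separating crossing pairs on undominated cliques *)

Section Crossing.
Hypothesis H : noP3P4 e.
Variables p1 p2 p3 p4 : T.
Hypothesis hP : is_path4 e p1 p2 p3 p4.

Definition outside (S : seq T) x := ~~ dominated S x.
Definition bad_pair (d : 'I_3) (S : seq T) u v :=
  [&& outside S u, outside S v, e u v &
   [exists x, [exists y, [&& col x == d, col y == d, e x u, ~~ e x v, e y v
     & ~~ e y u]]]].

Lemma outsideP S x s : outside S x -> s \in S -> [/\ x != s, ~~ e x s & ~~ e s x].
Proof.
move=> h hs; have : ~~ ((x == s) || e x s) by apply: contra h => h; apply/hasP; exists s.
by rewrite negb_or [e s x]esym => /andP[-> ->].
Qed.

Lemma outside_sub S S' x : {subset S <= S'} -> outside S' x -> outside S x.
Proof. by move=> h; apply: contra => /hasP[s /h hs hx]; apply/hasP; exists s. Qed.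

Lemma outside_cliques S u v w : {subset [:: p1; p2; p3; p4] <= S} ->
  outside S u -> outside S v -> outside S w -> e u v -> e v w -> u != w -> e u w.
Proof.
move=> hS hu hv hw uv vw nuw; apply: contraT => ne.
case: (H (a:=u) (b:=v) (c:=w) _ hP); first by rewrite /is_path3 nuw uv vw.
apply/allP => x hx; apply/allP => y /hS hy.
have : outside S x by move: hx; rewrite !inE => /or3P[]/eqP->.
by move=> /outsideP /(_ hy) [].
Qed.

Section Step.
Variables (d : 'I_3) (S : seq T).
Hypothesis hS : {subset [:: p1; p2; p3; p4] <= S}.

(** For an outside vertex [u], [K u] is the clique containing it; [tch x] is the set of the cliques
    in which [x] has a neighbour. *)
Let K u := [set w | outside S w && ((w == u) || e u w)].
Let tch x := [set K w | w in [pred w | outside S w && e x w]].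

Lemma K_self u : outside S u -> u \in K u.
Proof. by move=> h; rewrite inE h eqxx. Qed.
Lemma K_adj u v : outside S u -> outside S v -> e u v -> K u = K v.
Proof.
move=> hu hv huv; apply/setP => w; rewrite !inE; case: (boolP (outside S w)) => //= hw.
apply/orP/orP => [[/eqP->|huw]|[/eqP->|hvw]].
- by right; rewrite esym.
- case: (w =P v) => [|/eqP n]; first by left.
  by right; apply: (outside_cliques hS hv hu hw) => //; [rewrite esym | rewrite eq_sym].
- by right.
- case: (w =P u) => [|/eqP n]; first by left.
  by right; apply: (outside_cliques hS hu hv hw) => //; rewrite eq_sym.
Qed.
Lemma K_eq u w : outside S u -> w \in K u -> K w = K u.
Proof.
move=> hu; rewrite inE => /andP[hw /orP[/eqP->//|h]]; apply: K_adj => //; by rewrite esym.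
Qed.
Lemma tchP x w : outside S w -> K w \notin tch x -> ~~ e x w.
Proof. by move=> hw; apply: contra => h; apply/imsetP; exists w; rewrite // inE hw. Qed.

(** The added vertices are [x1], which has colour [d] and touches as many cliques as possible, and
    [u0], an end of a bad pair in a clique missed by [x1]. If the clique of a surviving pair is
    touched by [x1], it has lost a neighbour of [x1]. Otherwise the surviving pair and the pair at
    [u0] lie in different untouched cliques, and by the claim their witnesses do not see each
    other's clique, so that both forbidden paths appear. *)
Lemma bad_pair_reduce : exists2 A : seq T, size A <= 2 &
  forall u v, bad_pair d (A ++ S) u v -> bad_pair d S u v /\
    exists w, [/\ outside S w, ~~ outside (A ++ S) w & e u w].
Proof.
case: (pickP [pred uv | bad_pair d S uv.1 uv.2]) => [uv huv|hn]; last first.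
  by exists [::] => // u v h; have := hn (u, v); rewrite /= h.
have mono A u v : bad_pair d (A ++ S) u v -> bad_pair d S u v.
  have sub : {subset S <= A ++ S} by move=> x hx; rewrite mem_cat hx orbT.
  by case/and4P=> /(outside_sub sub) h1 /(outside_sub sub) h2 h3 h4; apply/and4P; split.
have /existsP[x00 /existsP[y00 /and3P[c00 _ _]]] : [exists x, [exists y, [&& col x == d, col y == d, e x uv.1, ~~ e x uv.2, e y uv.2
     & ~~ e y uv.1]]] by case/and4P: huv.
case: (@arg_maxnP _ x00 (fun x => col x == d) (fun x => #|tch x|) c00) => x1 /eqP c1 xmax.
(* A vertex of colour d which is partial on an untouched clique touches no
   other untouched clique, by maximality of x1. *)
have claim z w w' w'' : col z = d -> outside S w -> outside S w' -> outside S w'' -> e w w' ->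
    e z w -> ~~ e z w' -> e z w'' -> K w \notin tch x1 -> K w'' \notin tch x1 -> w'' \in K w.
  move=> cz ow ow' ow'' eww ezw ezw' ezw'' nw nw''; apply: contraT => hw''.
  have nK : K w != K w''.
    by apply: contraNneq hw'' => ->; apply: K_self.
  (* As [z] touches two cliques missed by [x1], maximality gives two cliques touched by [x1] and
     missed by [z]. Their vertices [a], [b] form a path with [x1] in the middle, anticomplete to the
     path [w'], [w], [z], [w'']. *)
  have two : 1 < #|tch x1 :\: tch z|.
    have h1 : #|tch z :\: tch x1| <= #|tch x1 :\: tch z|.
      have := xmax z; rewrite /geq /= cz eqxx => /(_ isT).
      by rewrite -(cardsID (tch z) (tch x1)) -(cardsID (tch x1) (tch z)) setIC leq_add2l.
    apply: leq_trans h1; rewrite (cardsD1 (K w)) (cardsD1 (K w'')) !inE nw nw'' eq_sym nK.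
    rewrite !(imset_f K) ?addn1 //; by rewrite inE ?ow ?ow''.
  have [Ka [Kb [hKa hKb nab]]] := card_gt1P two.
  case/setDP: hKa => /imsetP[a]; rewrite inE => /andP[oa ea] Ea na.
  case/setDP: hKb => /imsetP[b]; rewrite inE => /andP[ob eb] Eb nb.
  rewrite Ea in na nab; rewrite Eb in nb nab.
  have [nza nzb] : ~~ e z a /\ ~~ e z b by split; apply: tchP.
  have sep s t : outside S s -> outside S t -> K s != K t -> s != t /\ ~~ e s t.
    move=> os ot n; split; first by apply: contraNneq n => ->.
    by apply: contra n => h; apply/eqP; apply: K_adj.
  have Kww' : K w' = K w by apply: K_adj => //; rewrite esym.
  have [x1w x1w' x1w''] : [/\ ~~ e x1 w, ~~ e x1 w' & ~~ e x1 w''].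
    by split; apply: tchP => //; rewrite Kww'.
  have Kz t : K t \notin tch z -> (K t != K w) && (K t != K w'').
    move=> h; apply/andP; split; apply: contraNneq h => ->; apply/imsetP;
      [exists w|exists w''] => //; by rewrite inE ?ow ?ow''.
  have /andP[naw naw''] := Kz _ na; have /andP[nbw nbw''] := Kz _ nb.
  have naw' := naw; have nbw' := nbw; rewrite -Kww' in naw' nbw'.
  have nK' : K w' != K w'' by rewrite Kww'.
  have x1z : ~~ e x1 z by apply: same; rewrite c1 cz.
  have [? ?] := sep _ _ oa ob nab. have [_ ?] := sep _ _ oa ow naw.
  have [_ ?] := sep _ _ oa ow' naw'. have [_ ?] := sep _ _ oa ow'' naw''.
  have [_ ?] := sep _ _ ob ow nbw. have [_ ?] := sep _ _ ob ow' nbw'.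
  have [_ ?] := sep _ _ ob ow'' nbw''. have [_ ?] := sep _ _ ow ow'' nK.
  have [_ ?] := sep _ _ ow' ow'' nK'.
  by case: (H (a:=a) (b:=x1) (c:=b) (p:=w') (q:=w) (r:=z) (s:=w'')); path.
pose u0 := odflt x1 (omap fst [pick w | bad_pair d S w.1 w.2 && (K w.1 \notin tch x1)]).
exists [:: x1; u0] => // u v huv'; have hb := mono _ _ _ huv'; split => //.
case/and4P: (huv') => ou' ov' euv _.
case/and4P: (hb) => ou ov _ /existsP[x /existsP[y]].
case/and5P=> /eqP cx /eqP cy exu exv /andP[eyv eyu].
have x1A : x1 \in [:: x1; u0] ++ S by rewrite mem_head.
have u0A : u0 \in [:: x1; u0] ++ S by rewrite !inE eqxx orbT.
case: (boolP (K u \in tch x1)) => [/imsetP[w]|nK].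
  rewrite inE => /andP[ow x1w] EK; exists w.
  have ow' : ~~ outside ([:: x1; u0] ++ S) w.
    by apply/negP => /outsideP /(_ x1A) [_ _]; rewrite x1w.
  split => //; have : w \in K u by rewrite EK K_self.
  by rewrite inE ow /= => /orP[/eqP E|//]; rewrite E ou' in ow'.
have [a [b [hab nKa Ea]]] : exists a b, [/\ bad_pair d S a b, K a \notin tch x1 & a = u0].
  rewrite /u0; case: pickP => [[a b] /= /andP[hab nKa]|/(_ (u, v))]; last by rewrite /= hb nK.
  by exists a, b.
have aA : a \in [:: x1; u0] ++ S by rewrite Ea.
case/and4P: (hab) => oa ob eab /existsP[x0 /existsP[y0]].
case/and5P=> /eqP cx0 /eqP cy0 ex0a ex0b /andP[ey0b ey0a].
have [nua nua' _] := outsideP ou' aA.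
have Kb : K b = K a by apply: K_adj => //; rewrite esym.
have Kv : K v = K u by apply: K_adj => //; rewrite esym.
have nauK : a \notin K u by rewrite inE negb_and negb_or eq_sym nua nua' orbT.
have nK2 : K u != K a by apply: contraNneq nauK => ->; apply: K_self.
have sep s t : outside S s -> outside S t -> K s != K t -> ~~ e s t.
  by move=> os ot n; apply: contra n => h; apply/eqP; apply: K_adj.
have part z s s' t : col z = d -> outside S s -> outside S s' -> e s s' -> e z s -> ~~ e z s' -> outside S t ->
   K s \notin tch x1 -> K t \notin tch x1 -> K s != K t -> ~~ e z t.
  move=> cz os os' ess ezs nezs ot n1 n2 n3; apply/negP => ezt.
  have ht := claim z s s' t cz os os' ot ess ezs nezs ezt n1 n2.
  by rewrite (K_eq os ht) eqxx in n3.
have nKb : K b \notin tch x1 by rewrite Kb.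
have nKv : K v \notin tch x1 by rewrite Kv.
have nK3 : K u != K b by rewrite Kb.
have nK4 : K v != K a by rewrite Kv.
have nK5 : K v != K b by rewrite Kv Kb.
have evu : e v u by rewrite esym.
have eba : e b a by rewrite esym.
have xa : ~~ e x a by apply: (part x u v a).
have xb : ~~ e x b by apply: (part x u v b).
have x0u : ~~ e x0 u by apply: (part x0 a b u); rewrite // eq_sym.
have x0v : ~~ e x0 v by apply: (part x0 a b v); rewrite // eq_sym.
have y0u : ~~ e y0 u by apply: (part y0 b a u); rewrite // eq_sym.
have y0v : ~~ e y0 v by apply: (part y0 b a v); rewrite // eq_sym.
have nub := sep _ _ ou ob nK3; have nva := sep _ _ ov oa nK4.
have nvb := sep _ _ ov ob nK5; have nua2 := sep _ _ ou oa nK2.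
have xx0 : ~~ e x x0 by apply: same; rewrite cx cx0.
have xy0 : ~~ e x y0 by apply: same; rewrite cx cy0.
have x0y0 : ~~ e x0 y0 by apply: same; rewrite cx0 cy0.
have nxv : x != v.
  apply/eqP => E; have /negP : ~~ e y x by apply: same; rewrite cx cy.
  by rewrite E eyv.
by case: (H (a:=x) (b:=u) (c:=v) (p:=x0) (q:=a) (r:=b) (s:=y0)); path.
Qed.
End Step.
End Crossing.
End Dominate.

(** * Path consistency and Hall's condition *)

Section PathConsistency.
Variables (T : finType) (R : T -> 'I_3 -> T -> 'I_3 -> bool).
Hypothesis Rdiag : forall x i j, R x i x j -> i = j.
Hypothesis Rsym : forall x i y j, R x i y j -> R y j x i.
Hypothesis Rpc : forall x i y j z, R x i y j ->
  exists k, R x i z k && R y j z k.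
Hypothesis Rtwo : forall z, exists k, ~~ R z k z k.

Lemma Rself x i y j : R x i y j -> R x i x i.
Proof. by move=> /(Rpc x) [k /andP[h _]]; rewrite {2}(Rdiag h). Qed.

(* Nonempty pairwise intersecting subsets of a two-element domain have a
   common element, so a partial solution extends to any further variable. *)
Lemma path_consistent_solution r i0 : R r i0 r i0 ->
  exists g : T -> 'I_3, forall x y, R x (g x) y (g y).
Proof.
move=> h0.
suff [g hg] : exists g : T -> 'I_3,
    forall x y, x \in enum T -> y \in enum T -> R x (g x) y (g y).
  by exists g => x y; apply: hg; rewrite mem_enum.
elim: (enum T) => [|z s [g hg]]; first by exists (fun _ => i0).
case: (boolP (z \in s)) => hz.
  exists g => x y; rewrite !inE => /orP[/eqP->|hx] /orP[/eqP->|hy]; exact: hg.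
suff [k hk] : exists k, R z k z k /\ forall x, x \in s -> R x (g x) z k.
  exists (fun x => if x == z then k else g x) => x y; rewrite !inE.
  case: (x =P z) => [->|_] /= hx; case: (y =P z) => [->|_] /= hy.
  - by case: hk.
  - by apply: Rsym; apply: (proj2 hk).
  - exact: (proj2 hk).
  - exact: hg.
have [k0 hk0] := Rtwo z.
have nk0 x i : R x i z k0 -> False by move/Rsym/Rself => h; rewrite h in hk0.
have [->|[x0 hx0]] : s = [::] \/ exists x0, x0 \in s.
- by case: (s) => [|x0 s']; [left | right; exists x0; rewrite inE eqxx].
- by have [k /andP[/Rsym/Rself hk _]] := Rpc z h0; exists k.
suff [k hk] : exists k, forall x, x \in s -> R x (g x) z k.
  by exists k; split => //; have /Rsym/Rself := hk _ hx0.
case: (boolP [exists k, all (fun x => R x (g x) z k) s]) => [/existsP[k /allP h]|].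
  by exists k.
rewrite negb_exists => /forallP h.
(* If every value fails at some earlier variable, the two variables at which the values other than
   [k0] fail have no common value at [z]. *)
have [x1 hx1 n1] := allPn (h (inord 0)); have [x2 hx2 n2] := allPn (h (inord 1)).
have [x3 hx3 n3] := allPn (h (inord 2)).
have key x y : x \in s -> y \in s -> exists2 k, k != k0 & R x (g x) z k && R y (g y) z k.
  move=> hx hy; have [k /andP[ha hb]] := Rpc z (hg x y hx hy).
  by exists k; [apply: contraTneq ha => ->; apply/negP => /nk0 | rewrite ha].
have I3 (k : 'I_3) : [|| k == inord 0, k == inord 1 | k == inord 2].
  by case: k => -[|[|[|//]]] ?; rewrite -!val_eqE /= !inordK.
have [k1 e1 /andP[a1 b1]] := key _ _ hx1 hx2.
have [k2 e2 /andP[a2 b2]] := key _ _ hx1 hx3.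
have [k3 e3 /andP[a3 b3]] := key _ _ hx2 hx3.
case/or3P: (I3 k0) => /eqP E0; rewrite {k0}E0 in hk0 nk0 key e1 e2 e3 *.
- by case/or3P: (I3 k3) => /eqP E; rewrite E ?eqxx // ?(negbTE n2) ?(negbTE n3) in e3 a3 b3.
- by case/or3P: (I3 k2) => /eqP E; rewrite E ?eqxx // ?(negbTE n1) ?(negbTE n3) in e2 a2 b2.
- by case/or3P: (I3 k1) => /eqP E; rewrite E ?eqxx // ?(negbTE n1) ?(negbTE n2) in e1 a1 b1.
Qed.
End PathConsistency.

(* Hall's condition for a clique of at most three vertices: it suffices to be
   able to colour when any two of the three colours are taken into account. *)
Section Hall.
Definition three := [:: 0; 1; 2].
(** The booleans say which vertices coincide, and colours must coincide accordingly. In this way one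
    definition serves cliques of one, two and three vertices, listed with repetition. *)
Definition ex3 (Pu Pv Pw : nat -> bool) (uv uw vw : bool) :=
  has (fun a => Pu a && has (fun b => [&& Pv b, (a == b) == uv &
    has (fun c => [&& Pw c, (a == c) == uw & (b == c) == vw]) three]) three) three.
Definition relax (f : nat -> bool) (i j a : nat) := f a || ((a != i) && (a != j)).
(** Two vertices violating Hall's condition have two excluded colours in common, three vertices one.
    Such a violation is visible when only the colours [i] and [j] count, all others being free by
    [relax]. A single vertex violates it only by losing all three colours, so nonemptiness is asked
    separately; here the ternary condition enters. *)
Definition hall_check (uv uw vw : bool) (fu fv fw : nat -> bool) :=
  [&& has fu three, has fv three, has fw three &
      all (fun i => all (fun j =>
         ex3 (relax fu i j) (relax fv i j) (relax fw i j) uv uw vw) three) three]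
  ==> ex3 fu fv fw uv uw vw.
Definition fun3 (a b c : bool) (i : nat) :=
  match i with 0 => a | 1 => b | _ => c end.
Definition all_fun3 (P : (nat -> bool) -> bool) :=
  let bs := [:: true; false] in
  all (fun a => all (fun b => all (fun c => P (fun3 a b c)) bs) bs) bs.

Lemma all_fun3P P a b c : all_fun3 P -> P (fun3 a b c).
Proof.
rewrite /all_fun3 /= !andbT.
case/andP=> /andP[/andP[h1 h2] /andP[h3 h4]] /andP[/andP[h5 h6] /andP[h7 h8]].
by case: a; case: b; case: c.
Qed.
Lemma hall3 : all_fun3 (fun fu => all_fun3 (fun fv => all_fun3 (fun fw =>
  hall_check false false false fu fv fw))).
Proof. by vm_compute. Qed.
Lemma hall2 : all_fun3 (fun fu => all_fun3 (fun fv =>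
  hall_check false false true fu fv fv)).
Proof. by vm_compute. Qed.
Lemma hall1 : all_fun3 (fun fu => hall_check true true true fu fu fu).
Proof. by vm_compute. Qed.
End Hall.

(** * The constraint network of a guess *)

Lemma sum3_eq a b c a' b' c' : a <= a' -> b <= b' -> c <= c' ->
  a' + b' + c' <= a + b + c -> [/\ a = a', b = b' & c = c'].
Proof. by move=> *; split; lia. Qed.

Section Instance.
Variables (T : finType) (e : rel T) (L : T -> {set 'I_3}).
Variables (flag : bool) (r : T) (G1 G2 : seq (T * 'I_3)).

(* A guess gives colours to the vertices of G1 and G2. The network has the
   vertices dominated by G1 as variables; the others (I) are coloured at the
   end, and flag tells that none of them lies in the component of r. *)
Definition dom x := has (fun s => (x == s.1) || e x s.1) G1.
Definition inI x := ~~ flag && ~~ dom x.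
(** The colours of [G2] only shrink the lists of the variables: [G2] dominates nothing, and an
    undominated vertex in it may finally receive another colour. *)
Definition allowed x i := (i \in L x) &&
  all (fun s => ((x == s.1) ==> (i == s.2)) && (e x s.1 ==> (i != s.2)))
    (G1 ++ G2).
Definition adjX u x := dom x && e x u.
Definition rainbow (i j k : 'I_3) := [&& i != j, i != k & j != k].
(* Some three dominated neighbours of u force the colour k to occur among them,
   unless they exclude all colours for u. *)
Definition certain u k :=
  [exists y, [exists z, [exists t, [&& adjX u y, adjX u z, adjX u t &
    [forall a, [forall b, [forall c,
      [&& allowed y a, allowed z b, allowed t c, e y z ==> (a != b),
          e y t ==> (a != c), e z t ==> (b != c) & ~~ rainbow a b c] ==>
      [|| k == a, k == b | k == c]]]]]]]].
Definition uncertain u := [forall k, ~~ certain u k].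
Definition same_allowed x y := [forall k, allowed x k == allowed y k].
Definition three_kinds u :=
  [exists x, [exists y, [exists z, [&& adjX u x, adjX u y, adjX u z,
    ~~ same_allowed x y, ~~ same_allowed x z & ~~ same_allowed y z]]]].
Definition I_cliques :=
  [forall u, [forall v, [forall w,
    [&& inI u, inI v, inI w, e u v, e v w & u != w] ==> e u w]]].
Definition I_K4free :=
  [forall u, [forall v, [forall w, [forall x,
    ~~ [&& inI u, inI v, inI w, inI x, e u v, e u w, e u x, e v w, e v x
         & e w x]]]]].
Definition I_kinds := [forall u, (inI u && uncertain u) ==> ~~ three_kinds u].
Definition crossing x y :=
  [exists u, [exists v,
    [&& inI u, inI v, e u v, e x u, ~~ e x v, e y v & ~~ e y u]]].
Definition free_colour u x i y j a :=
  [&& a \in L u, e x u ==> (a != i) & e y u ==> (a != j)].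
Definition adj_or_eq u v := (u == v) || e u v.
Definition triples_ok x i y j :=
  [forall u, [forall v, [forall w,
    [&& inI u, inI v, inI w, adj_or_eq u v, adj_or_eq u w & adj_or_eq v w] ==>
    [exists a, [exists b, [exists c,
      [&& free_colour u x i y j a, free_colour v x i y j b,
          free_colour w x i y j c, (u == v) == (a == b),
          (u == w) == (a == c) & (v == w) == (b == c)]]]]]]].
Definition nae x i y j :=
  [forall u, [&& inI u, e x u & e y u] ==>
    [forall k, certain u k ==> ~~ rainbow i j k] &&
    ([&& uncertain u, same_allowed x y &
       [exists z, adjX u z && ~~ same_allowed x z]] ==> (i == j))].
Definition closed_ok :=
  flag ==> dom r && [forall x, [forall y, (dom x && e x y) ==> dom y]].
(** Undominated vertices get a dummy value, so that all vertices can be variables and each has at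
    most two values. *)
Definition values x i := if dom x then allowed x i else i == inord 0.
(** The global conditions are repeated for every pair: if one of them fails, the whole table is
    empty and the guess is rejected. The diagonal [x = y] represents the domain of [x]. *)
Definition constraint x i y j :=
  [&& values x i, values y j, (x == y) ==> (i == j),
      closed_ok, I_cliques, I_K4free, I_kinds &
      (dom x && dom y) ==>
      [&& e x y ==> (i != j), crossing x y ==> (i != j), triples_ok x i y j
        & nae x i y j]].

(** * From a solution of the network to a colouring *)

Section Soundness.
Hypothesis esym : symmetric e.
Hypothesis eirr : irreflexive e.
Hypothesis G1ne : G1 != [::].
Variable g : T -> 'I_3.
Hypothesis hg : forall x y, constraint x (g x) y (g y).

Lemma dom_two x : dom x -> exists k, ~~ allowed x k.
Proof.
case/hasP=> s hs; have h k : allowed x k -> ((x == s.1) ==> (k == s.2)) && (e x s.1 ==> (k != s.2)).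
  by case/andP=> _ /allP /(_ s); apply; rewrite mem_cat hs.
case: eqP h => [E|_] h /=; last first.
  by move=> he; exists s.2; apply/negP => /h; rewrite he eqxx.
move=> _; case: (s.2 =P inord 0) h => [->|n] h; [exists (inord 1)|exists (inord 0)];
  apply/negP => /h /andP[/eqP] //=; last by move=> E'; rewrite E' in n.
by move=> /(congr1 val); rewrite /= !inordK.
Qed.

Lemma g_allowed x : dom x -> allowed x (g x).
Proof. by move=> h; have := hg x x; rewrite /constraint /values h => /and5P[]. Qed.

Lemma colour_cases (k : 'I_3) : [\/ k = inord 0, k = inord 1 | k = inord 2].
Proof.
case: k => -[|[|[|//]]] hk; [constructor 1|constructor 2|constructor 3];
  by apply/val_inj; rewrite /= inordK.
Qed.

Lemma pair_constraint x y : dom x -> dom y ->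
  [/\ e x y -> g x != g y, crossing x y -> g x != g y,
      triples_ok x (g x) y (g y) & nae x (g x) y (g y)].
Proof.
move=> hx hy; have := hg x y; rewrite /constraint hx hy /=.
by do 7![case/andP=> _]; case/and4P => /implyP h1 /implyP h2 h3 h4; split.
Qed.

Lemma globals : [/\ closed_ok, I_cliques, I_K4free & I_kinds].
Proof.
have := hg r r; rewrite /constraint.
by case/andP=> _ /andP[_ /andP[_ /and5P[-> -> -> -> _]]].
Qed.

(** If a colour [k] is certain, the witnesses of the two other colours form a rainbow with [k].
    Otherwise the three witnesses have at most two kinds of lists: with one kind, three colours
    would lie in a list of at most two, and with two kinds, two witnesses have to agree. *)
Lemma not_all_blocked u : inI u ->
  (forall k, exists x, [&& dom x, e x u & g x == k]) -> False.
Proof.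
move=> hu h.
have [x0 /and3P[d0 e0 /eqP g0]] := h (inord 0).
have [x1 /and3P[d1 e1 /eqP g1]] := h (inord 1).
have [x2 /and3P[d2 e2 /eqP g2]] := h (inord 2).
have N (m p : nat) : m < 3 -> p < 3 -> m != p -> (inord m : 'I_3) != inord p.
  by move=> *; rewrite -val_eqE /= !inordK.
have nae_at x y : dom x -> e x u -> dom y -> e y u -> 
   (forall k, certain u k -> ~~ rainbow (g x) (g y) k) /\
   (uncertain u -> same_allowed x y -> forall z, adjX u z -> ~~ same_allowed x z -> g x = g y).
  move=> hx ex hy ey; have [_ _ _ /forallP /(_ u)] := pair_constraint hx hy.
  rewrite hu ex ey /= => /andP[/forallP k1 /implyP k2]; split.
    by move=> k; apply/implyP.
  by move=> p1 p2 z p3 p4; apply/eqP/k2; rewrite p1 p2; apply/existsP; exists z; rewrite p3.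
case: (boolP (uncertain u)) => hc; last first.
  move: hc; rewrite negb_forall => /existsP[k /negPn hc].
  have [c01 _] := nae_at _ _ d0 e0 d1 e1; have [c02 _] := nae_at _ _ d0 e0 d2 e2.
  have [c12 _] := nae_at _ _ d1 e1 d2 e2.
  move: (c01 _ hc) (c02 _ hc) (c12 _ hc); rewrite /rainbow g0 g1 g2.
  by case: (colour_cases k) => ->; rewrite ?eqxx !N.
have adj x : dom x -> e x u -> adjX u x by rewrite /adjX => -> ->.
have a0 := g_allowed d0; have a1 := g_allowed d1; have a2 := g_allowed d2.
have [k hk] := dom_two d0.
have sa x y : same_allowed x y -> forall k, allowed x k = allowed y k.
  by move=> /forallP h' k'; apply/eqP.
have ssym x y : same_allowed x y = same_allowed y x.
  by apply/forallP/forallP => h' k'; rewrite eq_sym.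
have [_ _ _ /forallP /(_ u)] := globals; rewrite hu hc /= => /negP k3.
case: (boolP (same_allowed x0 x1)) => s01.
  case: (boolP (same_allowed x0 x2)) => s02.
    move: hk; rewrite g0 in a0; rewrite g1 -(sa _ _ s01) in a1; rewrite g2 -(sa _ _ s02) in a2.
    by case: (colour_cases k) => ->; rewrite ?a0 ?a1 ?a2.
  have [_ /(_ hc s01 x2 (adj _ d2 e2) s02)] := nae_at _ _ d0 e0 d1 e1.
  by rewrite g0 g1 => /eqP; rewrite (negbTE (N _ _ _ _ _)).
case: (boolP (same_allowed x0 x2)) => s02.
  have [_ /(_ hc s02 x1 (adj _ d1 e1) s01)] := nae_at _ _ d0 e0 d2 e2.
  by rewrite g0 g2 => /eqP; rewrite (negbTE (N _ _ _ _ _)).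
case: (boolP (same_allowed x1 x2)) => s12.
  have [_ /(_ hc s12 x0 (adj _ d0 e0))] := nae_at _ _ d1 e1 d2 e2.
  by rewrite ssym s01 g1 g2 => /(_ isT) /eqP; rewrite (negbTE (N _ _ _ _ _)).
apply: k3; apply/existsP; exists x0; apply/existsP; exists x1; apply/existsP; exists x2.
by rewrite !adj // s01 s02 s12.
Qed.

Section Triple.
Variables (u v w : T).
Hypotheses (hu : inI u) (hv : inI v) (hw : inI w).
Hypotheses (uv : adj_or_eq u v) (uw : adj_or_eq u w) (vw : adj_or_eq v w).

Definition blocked (x : T) (i : 'I_3) := [exists y, [&& dom y, e y x & g y == i]].
Definition touch y := e y u + e y v + e y w.

(* The colour-i vertices touching a clique touch nested subsets of it. *)
Lemma witness i : (forall x, x \in [:: u; v; w] -> ~~ blocked x i) \/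
  (exists y, [/\ dom y, g y = i & forall x, x \in [:: u; v; w] -> blocked x i = e y x]).
Proof.
have aoe x y : x \in [:: u; v; w] -> y \in [:: u; v; w] -> adj_or_eq x y.
  have S a b : adj_or_eq a b = adj_or_eq b a by rewrite /adj_or_eq eq_sym esym.
  have Rf a : adj_or_eq a a by rewrite /adj_or_eq eqxx.
  by rewrite !inE => /or3P[]/eqP-> /or3P[]/eqP->; rewrite // ?Rf // S.
case: (pickP (fun y => dom y && (g y == i))) => [y0 hy0|h]; last first.
  by left => x _; apply/negP => /existsP[y /and3P[a b c]]; have := h y; rewrite a c.
right; case: (@arg_maxnP _ y0 (fun y => dom y && (g y == i)) touch hy0) => y /andP[dy /eqP gy] ymax.
exists y; split => // x hx; apply/idP/idP => [|h]; last first.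
  by apply/existsP; exists y; rewrite dy h gy eqxx.
case/existsP=> y' /and3P[dy' ey' gy'].
have hle : touch y' <= touch y by apply: ymax; rewrite dy' gy'.
case: (boolP (e y x)) => // ney.
have [x' hx' ab] : exists2 x', x' \in [:: u; v; w] & ~~ (e y x' ==> e y' x').
  apply/allPn; apply/negP => /and4P[/implyP i1 /implyP i2 /implyP i3 _].
  have le_b (p q : bool) : (p -> q) -> p <= q by case: p => // ->.
  have [h1 h2 h3] := sum3_eq (le_b _ _ i1) (le_b _ _ i2) (le_b _ _ i3) hle.
  by move: hx ey' ney; rewrite !inE => /or3P[]/eqP-> a1 /negbTE a2;
    move: h1 h2 h3; rewrite a1 a2.
move: ab; rewrite negb_imply => /andP[a b].
have [_ cr _ _] := pair_constraint dy dy'.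
suff : crossing y y' by move/cr; rewrite gy (eqP gy') eqxx.
have hI z : z \in [:: u; v; w] -> inI z by rewrite !inE => /or3P[]/eqP->.
apply/existsP; exists x'; apply/existsP; exists x; rewrite !hI // a ney ey' b /=.
have := aoe _ _ hx' hx; rewrite /adj_or_eq => /orP[/eqP E|->] //.
by rewrite E (negbTE ney) in a.
Qed.

(** By nestedness one vertex accounts for all blocking by the colour [i], so the effect of two
    colours is visible to a single binary constraint. If nothing is blocked, a vertex of [G1] serves
    as placeholder. *)
Lemma pair_witness i : exists y, dom y /\
  forall x, x \in [:: u; v; w] -> blocked x i -> e y x && (g y == i).
Proof.
case: (witness i) => [h|[y [h1 h2 h3]]]; last first.
  by exists y; split => // x hx; rewrite (h3 x hx) h2 => ->; rewrite eqxx.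
case E : G1 G1ne => [//|s G] _; exists s.1; split; first by rewrite /dom E /= eqxx.
by move=> x /h /negbTE ->.
Qed.

Definition free x (m : nat) := (inord m \in L x) && ~~ blocked x (inord m).

Lemma mem_three (k : 'I_3) : val k \in three.
Proof. by case: k => -[|[|[|]]]. Qed.
Lemma three_lt m : m \in three -> m < 3.
Proof. by rewrite !inE => /or3P[]/eqP->. Qed.

Lemma relaxed (i j : 'I_3) : ex3 (relax (free u) i j) (relax (free v) i j)
  (relax (free w) i j) (u == v) (u == w) (v == w) /\
  forall x, x \in [:: u; v; w] -> exists a, [/\ a \in L x, 
     blocked x i -> a != i & blocked x j -> a != j].
Proof.
have [y [dy hy]] := pair_witness i; have [y' [dy' hy']] := pair_witness j.
have [_ _ /forallP /(_ u) /forallP /(_ v) /forallP /(_ w)] := pair_constraint dy dy'.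
rewrite hu hv hw uv uw vw /= => /existsP[a /existsP[b /existsP[c]]].
case/and5P=> ha hb hc h1 /andP[h2 h3] _.
have k x d : x \in [:: u; v; w] -> free_colour x y (g y) y' (g y') d ->
    [/\ d \in L x, blocked x i -> d != i & blocked x j -> d != j].
  move=> hx /and3P[-> /implyP h4 /implyP h5]; split => // hb'.
    by case/andP: (hy _ hx hb') => /h4 h6 /eqP <-.
  by case/andP: (hy' _ hx hb') => /h5 h6 /eqP <-.
have rl x d : x \in [:: u; v; w] -> free_colour x y (g y) y' (g y') d ->
    relax (free x) i j d.
  move=> hx /(k _ _ hx) [h4 h5 h6]; rewrite /relax /free inord_val h4 /=.
  case: (d =P i) => [E|/eqP n] /=.
    by rewrite !val_eqE -E in h5 *; case: (blocked x d) h5 => //= /(_ isT); rewrite eqxx.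
  rewrite !val_eqE n; case: (d =P j) => [E|//] /=; last by rewrite orbT.
  by rewrite -E in h6 *; case: (blocked x d) h6 => //= /(_ isT); rewrite eqxx.
have mu : u \in [:: u; v; w] by rewrite !inE eqxx.
have mv : v \in [:: u; v; w] by rewrite !inE eqxx ?orbT.
have mw : w \in [:: u; v; w] by rewrite !inE eqxx ?orbT.
split; last first.
  by move=> x; rewrite !inE => /or3P[]/eqP->; [exists a|exists b|exists c]; apply: k.
rewrite /ex3; apply/hasP; exists (val a); rewrite ?mem_three // rl // andTb.
apply/hasP; exists (val b); rewrite ?mem_three // rl // !val_eqE eq_sym h1 !andTb.
by apply/hasP; exists (val c); rewrite ?mem_three // rl // !val_eqE eq_sym h2 eq_sym h3.
Qed.

Lemma colour_triple :
  hall_check (u == v) (u == w) (v == w) (free u) (free v) (free w) ->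
  exists a b c,
  [&& [&& a \in L u, b \in L v & c \in L w],
      [&& ~~ blocked u a, ~~ blocked v b & ~~ blocked w c],
      (u == v) == (a == b), (u == w) == (a == c) & (v == w) == (b == c)].
Proof.
(* If no colour is free, not all three are blocked, so some [k] is neither blocked nor in the list.
   The two remaining colours then already contradict [relaxed]. *)
have ne x : x \in [:: u; v; w] -> inI x -> has (free x) three.
  move=> hx hI; case: (boolP (has _ _)) => // h.
  have nf k : k \in L x -> blocked x k.
    move=> hk; apply: contraR h => hb; apply/hasP; exists (val k); rewrite ?mem_three //.
    by rewrite /free inord_val hk.
  case: (@not_all_blocked x hI) => k.
  suff /existsP : blocked x k by [].
  apply: contraR h => hb; have hk : k \notin L x by apply: contra hb => /nf.
  have [i [j hij]] : exists i j : 'I_3, forall d, [|| d == k, d == i | d == j].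
    have /existsP[i /existsP[j /forallP hij]] :
       [exists i : 'I_3, [exists j : 'I_3, [forall d, [|| d == k, d == i | d == j]]]].
      case: (colour_cases k) => ->; apply/existsP; 
       [exists (inord 1)|exists (inord 0)|exists (inord 0)]; apply/existsP;
       [exists (inord 2)|exists (inord 2)|exists (inord 1)];
       apply/forallP => d; case: (colour_cases d) => ->; by rewrite eqxx ?orbT.
    by exists i, j.
  have [_ /(_ x hx) [a [ha hai haj]]] := relaxed i j.
  have ha' := nf _ ha.
  case/or3P: (hij a) => /eqP E.
  - by rewrite E (negbTE hk) in ha.
  - by rewrite E in ha'; rewrite E eqxx in hai; have := hai ha'.
  - by rewrite E in ha'; rewrite E eqxx in haj; have := haj ha'.
have mu : u \in [:: u; v; w] by rewrite !inE eqxx.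
have mv : v \in [:: u; v; w] by rewrite !inE eqxx ?orbT.
have mw : w \in [:: u; v; w] by rewrite !inE eqxx ?orbT.
rewrite /hall_check !ne // => /implyP h.
have {h} : ex3 (free u) (free v) (free w) (u == v) (u == w) (v == w).
  apply: h; rewrite !andTb; apply/allP => i hi; apply/allP => j hj.
  have [+ _] := relaxed (inord i) (inord j).
  by rewrite !inordK ?three_lt.
have E m p : m \in three -> p \in three -> ((inord m : 'I_3) == inord p) = (m == p).
  by move=> *; rewrite -val_eqE /= !inordK ?three_lt.
case/hasP=> a ma /andP[/andP[fa na] /hasP[b mb /and3P[/andP[fb nb] hab]]].
case/hasP=> c mc /and3P[/andP[fc nc] hac hbc].
exists (inord a), (inord b), (inord c).
by rewrite fa fb fc na nb nc !E // ![(_ == _) == (_ == _ :> nat)]eq_sym hab hac hbc.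
Qed.
End Triple.

Definition clique u := [set w | inI w && adj_or_eq u w].
Definition good (K : {set T}) (f : {ffun T -> 'I_3}) :=
  [forall u in K, [&& f u \in L u, ~~ blocked u (f u) &
     [forall v in K, e u v ==> (f u != f v)]]].

Lemma clique_adj u x y : inI u -> x \in clique u -> y \in clique u -> adj_or_eq x y.
Proof.
rewrite !inE => hu /andP[hx ax] /andP[hy ay].
have [_ /forallP /(_ x) /forallP /(_ u) /forallP /(_ y)] := globals.
rewrite hx hu hy /=; move: ax ay; rewrite /adj_or_eq.
case/orP=> [/eqP<- ? //|ax]; case/orP=> [/eqP<-|ay]; first by rewrite esym ax orbT.
by rewrite [e x u]esym ax ay /=; case: (x =P y).
Qed.

(** Condition [I_K4free] bounds the clique by three vertices; smaller ones are listed with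
    repetition, in the equality patterns for which Hall's condition was checked. *)
Lemma clique_enum u : inI u -> exists v w, [/\ v \in clique u, w \in clique u,
  clique u =i [:: u; v; w] &
  [\/ [/\ u != v, u != w & v != w], u != v /\ v = w | u = v /\ v = w]].
Proof.
move=> hu; have uK : u \in clique u by rewrite inE hu /adj_or_eq eqxx.
case: (pickP [pred v in clique u | v != u]) => [v /andP[/= vK vu]|h]; last first.
  exists u, u; split => //; last by constructor 3.
  move=> x; rewrite ![in RHS]inE !orbb; apply/idP/eqP => [hx|-> //].
  by have /= := h x; rewrite hx /= => /negbFE/eqP.
case: (pickP [pred w in clique u | (w != u) && (w != v)]) => [w /and3P[/= wK wu wv]|h].
  exists v, w; split => //; last by constructor 1; split; rewrite eq_sym.
  move=> x; rewrite ![in RHS]inE; apply/idP/or3P => [hx|[]/eqP-> //].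
  case: (x =P u) => [|/eqP xu]; first by constructor 1.
  case: (x =P v) => [|/eqP xv]; first by constructor 2.
  case: (x =P w) => [|/eqP xw]; first by constructor 3.
  have A y z : y \in clique u -> z \in clique u -> y != z -> e y z.
    by move=> hy hz hyz; have := clique_adj hu hy hz; rewrite /adj_or_eq (negbTE hyz).
  have B y : y \in clique u -> inI y by rewrite inE => /andP[].
  have [_ _ /forallP /(_ u) /forallP /(_ v) /forallP /(_ w) /forallP /(_ x)] := globals.
  by rewrite !B // !A // eq_sym.
exists v, v; split => //; last by constructor 2; rewrite eq_sym vu.
move=> x; rewrite ![in RHS]inE orbb; apply/idP/orP => [hx|[]/eqP-> //].
have /= := h x; rewrite hx /= => /negbT; rewrite negb_and !negbK => /orP[]->; [by left|by right].
Qed.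

Lemma clique_good u : inI u -> exists f, good (clique u) f.
Proof.
move=> hu; have [v [w [vK wK hK hcase]]] := clique_enum hu.
have uK : u \in clique u by rewrite inE hu /adj_or_eq eqxx.
have [hv hw] : inI v /\ inI w by move: vK wK; rewrite !inE => /andP[-> _] /andP[-> _].
have := colour_triple hu hv hw (clique_adj hu uK vK) (clique_adj hu uK wK) (clique_adj hu vK wK).
case => [|a [b [c]]].
  case: hcase => [[/negbTE-> /negbTE-> /negbTE->]|[/negbTE n <-]|[<- <-]].
  - exact: all_fun3P (free w 0) (free w 1) (free w 2) (all_fun3P (free v 0) (free v 1) (free v 2)
      (all_fun3P (free u 0) (free u 1) (free u 2) hall3)).
  - rewrite n eqxx; exact: all_fun3P (free v 0) (free v 1) (free v 2)
      (all_fun3P (free u 0) (free u 1) (free u 2) hall2).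
  - rewrite eqxx; exact: (all_fun3P (free u 0) (free u 1) (free u 2) hall1).
case/and5P=> /and3P[la lb lc] /and3P[na nb nc] /eqP euv /eqP euw /eqP evw.
exists [ffun x => if x == u then a else if x == v then b else c].
have fu : [ffun x => if x == u then a else if x == v then b else c] u = a by rewrite ffunE eqxx.
have fv : [ffun x => if x == u then a else if x == v then b else c] v = b.
  by rewrite ffunE eqxx; case: eqP => // E; apply/eqP; rewrite -euv E.
have fw : [ffun x => if x == u then a else if x == v then b else c] w = c.
  rewrite ffunE; case: eqP => [E|_]; first by apply/eqP; rewrite -euw E.
  by case: eqP => // E; apply/eqP; rewrite -evw E.
apply/forall_inP => x; rewrite hK => hx; apply/and3P; split.
- by move: hx; rewrite !inE => /or3P[]/eqP->; rewrite ?fu ?fv ?fw.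
- by move: hx; rewrite !inE => /or3P[]/eqP->; rewrite ?fu ?fv ?fw.
apply/forall_inP => y; rewrite hK => hy; apply/implyP => exy.
have nxy : x != y by apply: contraTneq exy => ->; rewrite eirr.
move: hx hy nxy; rewrite !inE => /or3P[]/eqP-> /or3P[]/eqP->; rewrite ?eqxx // ?fu ?fv ?fw => n;
first [by rewrite -euv | by rewrite -euw | by rewrite -evw
  | by rewrite eq_sym -euv eq_sym | by rewrite eq_sym -euw eq_sym
  | by rewrite eq_sym -evw eq_sym].
Qed.

Lemma good_sound : exists c : T -> 'I_3,
  (forall u, dom u || inI u -> c u \in L u) /\
  (forall u v, dom u || inI u -> dom v || inI v -> e u v -> c u != c v).
Proof.
(* The choice depends on the clique as a set only, so all its vertices are coloured by the same
   function. *)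
pose c x := if dom x then g x else odflt [ffun => inord 0] [pick f | good (clique x) f] x.
have cI x : inI x -> exists f, [/\ good (clique x) f, 
    [pick f | good (clique x) f] = Some f & c x = f x].
  move=> hx; have hd : ~~ dom x by case/andP: hx.
  rewrite /c (negbTE hd); case: pickP => [f hf|h]; first by exists f.
  by have [f hf] := clique_good hx; have := h f; rewrite hf.
have self x : inI x -> x \in clique x by move=> h; rewrite inE h /adj_or_eq eqxx.
have cD x : dom x -> c x = g x by rewrite /c => ->.
exists c; split => [u /orP[hu|hu]|u v].
- by rewrite cD //; case/andP: (g_allowed hu).
- have [f [hf _ ->]] := cI u hu.
  by have /forall_inP /(_ u (self u hu)) /andP[] := hf.
have key x y : dom x -> inI y -> e x y -> c x != c y.
  move=> hx hy exy; have [f [hf _ ->]] := cI y hy; rewrite cD //.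
  have /forall_inP /(_ y (self y hy)) /and3P[_ nb _] := hf.
  by apply: contra nb => E; apply/existsP; exists x; rewrite hx exy E.
case/orP=> hu /orP[]hv euv.
- by rewrite !cD //; have [h _ _ _] := pair_constraint hu hv; apply: h.
- exact: key.
- by rewrite eq_sym; apply: key; rewrite // esym.
have vK : v \in clique u by rewrite inE hv /adj_or_eq euv orbT.
have Ecl : clique u = clique v.
  have tr x y z : inI x -> inI y -> inI z -> adj_or_eq x y -> adj_or_eq x z -> adj_or_eq y z.
    by move=> hx hy hz h1 h2; apply: (clique_adj hx); rewrite inE ?hy ?hz ?h1 ?h2.
  apply/setP => x; rewrite !inE; case: (boolP (inI x)) => //= hx.
  apply/idP/idP => h; [apply: (tr u) | apply: (tr v)] => //;
    by rewrite /adj_or_eq ?euv ?orbT // esym euv orbT.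
have [f [hf pf ->]] := cI u hu; have [f' [_ pf' ->]] := cI v hv.
move: pf pf'; rewrite Ecl => -> [<-].
have /forall_inP /(_ u (self u hu)) /and3P[_ _ /forall_inP /(_ v vK)] := hf.
by rewrite euv.
Qed.

End Soundness.
End Instance.

(** * A good guess exists *)

Lemma uniq_I3 (s : seq 'I_3) : uniq s -> size s <= 3.
Proof.
move=> u; have := uniq_leq_size u (s2 := enum 'I_3) (fun x _ => mem_enum _ x).
by rewrite size_enum_ord.
Qed.

Section NoCrossing.
Variables (T : finType) (e : rel T) (col : T -> 'I_3).
Hypothesis esym : symmetric e.
Hypothesis ecol : forall x y, e x y -> col x != col y.

Lemma K4_free a b c d : e a b -> e a c -> e a d -> e b c -> e b d -> e c d -> False.
Proof.
move=> /ecol h1 /ecol h2 /ecol h3 /ecol h4 /ecol h5 /ecol h6.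
have : uniq [:: col a; col b; col c; col d].
  by rewrite /= !inE !negb_or h1 h2 h3 h4 h5 h6.
by move/uniq_I3.
Qed.

(** Each round takes a vertex from the clique of every surviving pair. A pair surviving two rounds
    would form, with its two lost neighbours, a clique on four vertices. Thus four vertices per
    colour suffice; with the path this makes 16. *)
Lemma no_crossing p1 p2 p3 p4 : noP3P4 e -> is_path4 e p1 p2 p3 p4 ->
  exists S, [/\ size S <= 16, {subset [:: p1; p2; p3; p4] <= S} &
    forall d u v, ~~ bad_pair e col d S u v].
Proof.
move=> H hP; set Q := [:: p1; p2; p3; p4].
have sub A (S : seq T) : {subset Q <= S} -> {subset Q <= A ++ S}.
  by move=> h x /h hx; rewrite mem_cat hx orbT.
have two d S : {subset Q <= S} -> exists2 A : seq T, size A <= 4 &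
    forall u v, ~~ bad_pair e col d (A ++ S) u v.
  move=> hS; have [A sA hA] := bad_pair_reduce esym ecol H hP d hS.
  have [B sB hB] := bad_pair_reduce esym ecol H hP d (sub A S hS).
  exists (B ++ A); first by rewrite size_cat; lia.
  move=> u v; rewrite -catA; apply/negP => hb.
  have [hb1 [w2 [o2 n2 e2]]] := hB _ _ hb; have [hb2 [w1 [o1 n1 e1]]] := hA _ _ hb1.
  have [ou2 ov2 euv _] := and4P hb. 
  have [ou1 ov1 _ _] := and4P hb1. have [ou0 ov0 _ _] := and4P hb2.
  have o2' : outside e S w2 by apply: outside_sub o2 => x hx; rewrite mem_cat hx orbT.
  have neq S' x y : outside e S' x -> ~~ outside e S' y -> x != y.
    by move=> h; apply: contraNneq => <-.
  have cl := outside_cliques esym H hP.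
  have evu : e v u by rewrite esym.
  have ev1 : e v w1 by apply: (cl S v u w1 hS) => //; apply: neq ov1 n1.
  have ev2 : e v w2 by apply: (cl S v u w2 hS) => //; apply: neq ov2 n2.
  have e12 : e w2 w1.
    by apply: (cl S w2 u w1 hS) => //; [rewrite esym | apply: neq o2 n1].
  exact: K4_free euv e2 e1 ev2 ev1 e12.
have all (l : seq 'I_3) : exists S, [/\ size S <= 4 + 4 * size l, {subset Q <= S} &
    forall d u v, d \in l -> ~~ bad_pair e col d S u v].
  elim: l => [|d l [S [h1 h2 h3]]]; first by exists Q; split.
  have [A sA hA] := two d S h2; exists (A ++ S); split.
  - by rewrite size_cat /= mulnS; apply: leq_add.
  - exact: sub.
  move=> d' u v; rewrite inE => /orP[/eqP->//|hl].
  apply: contra (h3 d' u v hl) => /and4P[a b c h].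
  have s : {subset S <= A ++ S} by move=> x hx; rewrite mem_cat hx orbT.
  by apply/and4P; split => //; apply: outside_sub s _.
have [S [h1 h2 h3]] := all (enum 'I_3); exists S; split => //.
  by rewrite size_enum_ord in h1.
by move=> d u v; apply: h3; rewrite mem_enum.
Qed.
End NoCrossing.

Section Complete.
Variables (T : finType) (e : rel T) (L : T -> {set 'I_3}) (col : T -> 'I_3).
Hypothesis esym : symmetric e.
Hypothesis eirr : irreflexive e.
Hypothesis ecol : forall x y, e x y -> col x != col y.
Hypothesis colL : forall x, col x \in L x.

Definition coloured (S : seq T) := [seq (x, col x) | x <- S].

Lemma dom_coloured S x : dom e (coloured S) x = dominated e S x.
Proof. by rewrite /dom /coloured has_map; apply: eq_has. Qed.

Lemma third_colour (a b c d : 'I_3) : a != b -> a != c -> b != c ->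
  [\/ d = a, d = b | d = c].
Proof.
move=> ab ac bc; have : d \in [:: a; b; c].
  apply: contraT => hd; have : uniq [:: d; a; b; c].
    by rewrite cons_uniq hd /= !inE negb_or ab ac bc.
  by move/uniq_I3.
by rewrite !inE => /or3P[]/eqP; [constructor 1|constructor 2|constructor 3].
Qed.

Lemma adjacent_not_rainbow u x y z : e u x -> e u y -> e u z ->
  ~~ rainbow (col x) (col y) (col z).
Proof.
move=> /ecol hx /ecol hy /ecol hz; apply/negP => /and3P[h1 h2 h3].
by case: (third_colour (col u) h1 h2 h3) => E; rewrite E eqxx in hx hy hz.
Qed.

(** * What holds for the guess of a true colouring *)

Section Given.
Variables (S1 S2 : seq T) (flag : bool).
Let G1 := coloured S1.
Let G2 := coloured S2.
Let S := S2 ++ S1.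
Notation alw := (allowed e L G1 G2).
Notation unc := (uncertain e L G1 G2).
Notation crt := (certain e L G1 G2).
Notation adj := (adjX e G1).
Notation inI' := (inI e flag G1).

Lemma allowedP x i : reflect (i \in L x /\ forall s, s \in S ->
   (x = s -> i = col s) /\ (e x s -> i != col s)) (alw x i).
Proof.
rewrite /allowed -map_cat all_map; apply: (iffP andP) => [[h1 /allP h2]|[h1 h2]]; split => //.
- move=> s; rewrite mem_cat orbC -mem_cat => /h2 /= /andP[/implyP h3 /implyP h4]; split => //.
  by move=> /eqP /h3 /eqP.
- apply/allP => s; rewrite mem_cat orbC -mem_cat => /h2 /= [h3 h4].
  by apply/andP; split; apply/implyP => // /eqP/h3->.
Qed.

Lemma allowed_col x : alw x (col x).
Proof. by apply/allowedP; split => // s _; split => [->//|/ecol]. Qed.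

(** Since [u] itself has a colour, the true colours of the three witnesses do not form a rainbow,
    and the implication in [certain] applies to them. *)
Lemma certain_colour u k : crt u k -> exists x, [/\ adj u x & col x = k].
Proof.
case/existsP=> y /existsP[z /existsP[t /and4P[ay az at_ /forallP /(_ (col y)) /forallP /(_ (col z))
  /forallP /(_ (col t))]]].
have [[dy ey] [dz ez] [dt et]] : [/\ dom e G1 y /\ e y u, dom e G1 z /\ e z u & dom e G1 t /\ e t u].
  by move: ay az at_; rewrite /adjX => /andP[] ? ? /andP[] ? ? /andP[].
rewrite !allowed_col /= (@adjacent_not_rainbow u) ?andbT ?[e u _]esym //.
have -> : e y z ==> (col y != col z) by apply/implyP; apply: ecol.
have -> : e y t ==> (col y != col t) by apply/implyP; apply: ecol.
have -> : e z t ==> (col z != col t) by apply/implyP; apply: ecol.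
by move=> /or3P[]/eqP->; [exists y|exists z|exists t].
Qed.

Lemma certainI u k y z t : adj u y -> adj u z -> adj u t ->
  (forall a b c, alw y a -> alw z b -> alw t c -> (e y z -> a != b) -> (e y t -> a != c) ->
     (e z t -> b != c) -> ~~ rainbow a b c -> k \in [:: a; b; c]) -> crt u k.
Proof.
move=> ay az at_ h; apply/existsP; exists y; apply/existsP; exists z; apply/existsP; exists t.
rewrite ay az at_ /=; apply/forallP => a; apply/forallP => b; apply/forallP => c.
apply/implyP => /and5P[h1 h2 h3 /implyP h4 /and3P[/implyP h5 /implyP h6 h7]].
by have := h a b c h1 h2 h3 h4 h5 h6 h7; rewrite !inE.
Qed.

(** A neighbour with a single allowed colour would make this colour certain, taking it for all three
    witnesses. Hence [x] is not guessed, and its only excluded colour is that of a vertex of [S1]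
    dominating it. *)
Lemma kind_of u x : inI' u -> unc u -> adj u x -> exists k,
  [/\ forall i, alw x i = (i != k), only_colour e col S x k, ~~ outside e S1 x &
    exists p, [/\ p \in S1, e p x & col p = k]].
Proof.
move=> hI /forallP hu hx.
have notsingle i : (forall j, alw x j -> j = i) -> False.
  move=> h; have /negP := hu i; apply; apply: (certainI hx hx hx) => a b c /h -> *.
  by rewrite inE eqxx.
have nS : x \notin S.
  apply/negP => hS; apply: (notsingle (col x)) => j /allowedP[_ /(_ x hS)[h _]]; exact: h.
have nS1 : x \notin S1 by apply: contra nS; rewrite mem_cat orbC => ->.
have [p hp epx] : exists2 p, p \in S1 & e p x.
  have /andP[+ _] := hx; rewrite dom_coloured => /hasP[p hp /orP[/eqP E|h]].
    by rewrite -E (negbTE nS1) in hp.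
  by exists p; rewrite // esym.
have pS : p \in S by rewrite mem_cat hp orbT.
have alwP i : alw x i = (i != col p).
  apply/idP/idP => [/allowedP[_ /(_ p pS)[_ h]]|hi]; first by apply: h; rewrite esym.
  apply: contraT => ni; exfalso.
  have nxp : col x != col p by apply: ecol; rewrite esym.
  have nxi : col x != i by apply: contraNneq ni => <-; apply: allowed_col.
  have npi : col p != i by rewrite eq_sym.
  apply: (notsingle (col x)) => j hj; case: (third_colour j nxp nxi npi) => // E.
  - by move: hj => /allowedP[_ /(_ p pS)[_ /(_ _)]]; rewrite esym E eqxx => /(_ epx).
  - by rewrite E (negbTE ni) in hj.
exists (col p); split => //.
- rewrite /only_colour nS /=; apply/allP => s hs; apply/implyP => exs.
  apply: contraT; rewrite -alwP => /allowedP[_ /(_ s hs)[_ /(_ exs)]].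
  by rewrite eqxx.
- by rewrite /outside negbK; have /andP[+ _] := hx; rewrite dom_coloured.
- by exists p.
Qed.

Hypothesis nostar : forall tau, good_type col (outside e S1) tau S1 ->
  forall y z t u, ~~ star e col (outside e S1) tau S y z t u.

Lemma inI_outside u : inI' u -> outside e S1 u.
Proof. by case/andP=> _; rewrite dom_coloured. Qed.

(** A dominated guessed neighbour has only one allowed colour, which would be certain. This supplies
    the condition of a star that [u] sees guessed vertices in [I] only. *)
Lemma uncertain_sep u s : inI' u -> unc u -> s \in S -> e u s -> outside e S1 s.
Proof.
move=> hI hu hs eus; apply: contraT; rewrite /outside negbK => hd.
have hx : adj u s by rewrite /adjX dom_coloured hd esym.
by have [k [_ /andP[+ _] _ _]] := kind_of hI hu hx; rewrite hs.
Qed.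

Lemma star_absurd u y z t a b c k p q :
  inI' u -> unc u -> adj u y -> adj u z -> adj u t ->
  uniq [:: a; b; c] -> (k == b) || (k == c) ->
  col y = c -> col z = c -> col t = a -> col u = b ->
  only_colour e col S y b -> only_colour e col S z a -> only_colour e col S t k ->
  p \in S1 -> q \in S1 -> e p y -> e q z -> col p = b -> col q = a ->
  ~~ (e t y && ((k == b) || e t z)) -> False.
Proof.
move=> hI hu ay az at_ hun hk cy cz ct cu oy oz ot pS qS epy eqz cp cq hn.
have nout s : s \in S1 -> ~~ outside e S1 s.
  by move=> hs; rewrite /outside negbK; apply/hasP; exists s; rewrite ?eqxx.
have dout x : adj u x -> ~~ outside e S1 x.
  by move=> /andP[+ _]; rewrite dom_coloured /outside negbK.
have exu x : adj u x -> e u x by case/andP => _; rewrite esym.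
have gt : good_type col (outside e S1) (a, b, c, k, p, q) S1.
  apply/and5P; split; [exact: hun | exact: hk | exact: pS | exact: qS |].
  by apply/and4P; split; [exact: nout | exact: nout | apply/eqP | apply/eqP].
have := nostar gt y z t u; move=> /negP; apply; rewrite /star /= (inI_outside hI).
rewrite !exu // !dout // cy cz ct cu !eqxx oy oz ot epy eqz /=.
move: hn; rewrite /ca /cb /cc /ck /sp /sq /= => ->; rewrite andbT.
by apply/allP => s hs; apply/implyP; apply: uncertain_sep hI hu hs.
Qed.

(** If two neighbours of a kind differ, one of them, [t], has the colour missing from [z], and [z]
    is forced to the colour of the other one, [y]. This is a star with [ck = cb], unless [t] and [y]
    are adjacent; then they use up both colours of their common list, and the colour of [y] is
    certain. *)
Lemma mono_kind u x x' z : inI' u -> unc u -> adj u x -> adj u x' -> adj u z ->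
  same_allowed e L G1 G2 x x' -> ~~ same_allowed e L G1 G2 x z -> col x = col x'.
Proof.
suff core w y t b k : inI' w -> unc w -> adj w y -> adj w t -> adj w z ->
   (forall i, alw y i = (i != b)) -> (forall i, alw t i = (i != b)) ->
   (forall i, alw z i = (i != k)) -> b != k -> col y != col t -> k = col t -> False.
  move=> hI hu ax ax' az sa nsa; apply/eqP; apply: contraT => ncol; exfalso.
  have [b [h1 _ _ _]] := kind_of hI hu ax; have [k [h3 _ _ _]] := kind_of hI hu az.
  have h2 i : alw x' i = (i != b) by rewrite -h1; have /forallP /(_ i) /eqP := sa.
  have nbk : b != k.
    by apply: contraNneq nsa => E; apply/forallP => i; rewrite h1 h3 E.
  have nb y i : (forall j, alw y j = (j != i)) -> i != col y.
    by move=> h; have := allowed_col y; rewrite h eq_sym.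
  case: (third_colour k (nb _ _ h1) (nb _ _ h2) ncol) => E.
  - by rewrite E eqxx in nbk.
  - by apply: (core u x' x b k) => //; rewrite eq_sym.
  - exact: (core u x x' b k).
move=> hI hu ay at_ az h1 h2 h3 nbk ncol Ek.
have [b' [h1' oy _ [p [pS epy cp]]]] := kind_of hI hu ay.
have [k' [h3' oz _ [q [qS eqz cq]]]] := kind_of hI hu az.
have [b'' [h2' ot _ _]] := kind_of hI hu at_.
have Eb : b' = b by apply/eqP; rewrite -[_ == _]negbK -h1 h1' eqxx.
have Eb2 : b'' = b by apply/eqP; rewrite -[_ == _]negbK -h2 h2' eqxx.
have Ek' : k' = k by apply/eqP; rewrite -[_ == _]negbK -h3 h3' eqxx.
rewrite Eb in oy cp; rewrite Eb2 in ot; rewrite Ek' in oz cq.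
have nb i : (forall j, alw i j = (j != b)) -> b != col i.
  by move=> h; have := allowed_col i; rewrite h eq_sym.
have exu i : adj w i -> e w i by case/andP => _; rewrite esym.
have cw : col w = b.
  case: (third_colour (col w) (nb _ h1) (nb _ h2) ncol) => // E.
    by have := ecol (exu _ ay); rewrite E eqxx.
  by have := ecol (exu _ at_); rewrite E eqxx.
have cz : col z = col y.
  case: (third_colour (col z) (nb _ h1) (nb _ h2) ncol) => // E.
    by have := ecol (exu _ az); rewrite E cw eqxx.
  by have := allowed_col z; rewrite h3 Ek E eqxx.
rewrite Ek in oz cq.
apply: (@star_absurd w y z t (col t) b (col y) b p q) => //.
- by rewrite /= !inE negb_or ![col t == _]eq_sym (nb _ h2) ncol (nb _ h1).
- by rewrite eqxx.
rewrite eqxx andbT; apply/negP => ety.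
have /forallP /(_ (col y)) /negP := hu; apply.
apply: (certainI at_ ay ay) => a c c'; rewrite h2 h1 => na nc _ /(_ ety) nac _ _ _.
have nba : b != a by rewrite eq_sym.
have nbc : b != c by rewrite eq_sym.
case: (third_colour (col y) nba nbc nac) => E; rewrite E ?inE ?eqxx ?orbT //.
by have := nb _ h1; rewrite E eqxx.
Qed.

(** Three kinds miss the three colours. Let [y'] miss the colour of [u]. Its own colour [c] is
    missing from one of the other two, which becomes [t], and is forced on the remaining one, [z'].
    This is a star with [ck = cc], unless [t] sees both; then either colour of [t] leaves only [c]
    to one of them, so [c] is certain. *)
Lemma two_kinds u : inI' u -> unc u -> ~~ three_kinds e L G1 G2 u.
Proof.
move=> hI hu; apply/negP => /existsP[x /existsP[y /existsP[z]]].
case/and5P=> ax ay az sxy /andP[sxz syz].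
have [k1 [x1 _ _ _]] := kind_of hI hu ax. have [k2 [y1 _ _ _]] := kind_of hI hu ay.
have [k3 [z1 _ _ _]] := kind_of hI hu az.
have exu i : adj u i -> e u i by case/andP => _; rewrite esym.
have dif v w i j : (forall k, alw v k = (k != i)) -> (forall k, alw w k = (k != j)) ->
   ~~ same_allowed e L G1 G2 v w -> i != j.
  by move=> h1 h2; apply: contraNneq => E; apply/forallP => k; rewrite h1 h2 E.
have core y' z' t a b c : adj u y' -> adj u z' -> adj u t ->
    (forall k, alw y' k = (k != b)) -> (forall k, alw z' k = (k != a)) ->
    (forall k, alw t k = (k != c)) -> a != b -> a != c -> b != c -> col u = b ->
    col y' = c -> False.
  move=> by' bz' bt h1 h2 h3 ab ac bc cu cy'.
  have [b' [h1' oy _ [p [pS epy cp]]]] := kind_of hI hu by'.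
  have [k' [h2' oz _ [q [qS eqz cq]]]] := kind_of hI hu bz'.
  have [b'' [h3' ot _ _]] := kind_of hI hu bt.
  have Eb : b' = b by apply/eqP; rewrite -[_ == _]negbK -h1 h1' eqxx.
  have Eb2 : b'' = c by apply/eqP; rewrite -[_ == _]negbK -h3 h3' eqxx.
  have Ek' : k' = a by apply/eqP; rewrite -[_ == _]negbK -h2 h2' eqxx.
  rewrite Eb in oy cp; rewrite Eb2 in ot; rewrite Ek' in oz cq.
  have cz' : col z' = c.
    case: (third_colour (col z') ab ac bc) => // E.
      by have := allowed_col z'; rewrite h2 E eqxx.
    by have := ecol (exu _ bz'); rewrite E cu eqxx.
  have ct : col t = a.
    case: (third_colour (col t) ab ac bc) => // E.
      by have := ecol (exu _ bt); rewrite E cu eqxx.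
    by have := allowed_col t; rewrite h3 E eqxx.
  apply: (@star_absurd u y' z' t a b c c p q) => //.
  - by rewrite /= !inE negb_or ab ac bc.
  - by rewrite eqxx orbT.
  rewrite [c == b]eq_sym (negbTE bc) /=; apply/negP => /andP[ety etz].
  have /forallP /(_ c) /negP := hu; apply.
  apply: (certainI by' bz' bt) => i j k; rewrite h1 h2 h3 => ni nj nk _ h4 h5 nr.
  have {}h4 : i != k by apply: h4; rewrite esym.
  have {}h5 : j != k by apply: h5; rewrite esym.
  rewrite !inE; apply: contraT => /norP[ci /norP[cj ck]].
  case: (third_colour k ab ac bc) => E; subst k; rewrite ?eqxx // in nk ck h4 h5 *.
    by case: (third_colour i ab ac bc) => E; subst i; rewrite ?eqxx in ni ci h4.
  by case: (third_colour j ab ac bc) => E; subst j; rewrite ?eqxx in nj cj h5.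
have core2 v w b i j : adj u v -> adj u w -> adj u b -> 
    (forall k, alw v k = (k != col u)) -> (forall k, alw w k = (k != i)) ->
    (forall k, alw b k = (k != j)) -> i != col u -> i != j -> col u != j -> False.
  move=> av aw ab h1 h2 h3 n1 n2 n3.
  case: (third_colour (col v) n1 n2 n3) => E.
  - by apply: (core v b w j (col u) i) => //; rewrite eq_sym.
  - by have := ecol (exu _ av); rewrite E eqxx.
  - by apply: (core v w b i (col u) j).
have [n12 n13 n23] : [/\ k1 != k2, k1 != k3 & k2 != k3].
  by split; [apply: dif sxy | apply: dif sxz | apply: dif syz].
case: (third_colour (col u) n12 n13 n23) => E; subst.
- by apply: (core2 x y z k2 k3) => //; rewrite ?E // eq_sym.
- by apply: (core2 y x z k1 k3) => //; rewrite ?E.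
- by apply: (core2 z x y k1 k2) => //; rewrite ?E // eq_sym.
Qed.

Lemma complete_nae x y : dom e G1 x -> dom e G1 y ->
  nae e L flag G1 G2 x (col x) y (col y).
Proof.
move=> dx dy; apply/forallP => u; apply/implyP => /and3P[hI ex ey].
have ax : adj u x by rewrite /adjX dx. have ay : adj u y by rewrite /adjX dy.
apply/andP; split.
  apply/forallP => k; apply/implyP => /certain_colour [z [/andP[dz ez] <-]].
  by apply: (@adjacent_not_rainbow u); rewrite esym.
apply/implyP => /and3P[hu sa /existsP[z /andP[az nsa]]].
by apply/eqP; apply: mono_kind hI hu ax ay az sa nsa.
Qed.

End Given.

Definition partial (S1 : seq T) x : 'I_3 := if dominated e S1 x then col x else inord 0.

Lemma complete_constraint (flag : bool) r (S1 S2 : seq T) :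
  (flag -> dominated e S1 r /\
     forall x y, dominated e S1 x -> e x y -> dominated e S1 y) ->
  (~~ flag -> [/\ forall u v w, outside e S1 u -> outside e S1 v -> outside e S1 w ->
        e u v -> e v w -> u != w -> e u w,
      forall d u v, ~~ bad_pair e col d S1 u v &
      forall tau, good_type col (outside e S1) tau S1 ->
        forall y z t u, ~~ star e col (outside e S1) tau (S2 ++ S1) y z t u]) ->
  forall x y, constraint e L flag r (coloured S1) (coloured S2)
    x (partial S1 x) y (partial S1 y).
Proof.
move=> hB hA x y.
have val x' : values e L (coloured S1) (coloured S2) x' (partial S1 x').
  by rewrite /values /partial dom_coloured; case: (dominated e S1 x'); [exact: allowed_col | exact: eqxx].
have inA u : inI e flag (coloured S1) u -> ~~ flag /\ outside e S1 u.
  by rewrite /inI dom_coloured => /andP[].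
rewrite /constraint; apply/and5P; split; rewrite ?val //.
- by apply/implyP => /eqP->.
- apply/implyP => hf; have [h1 h2] := hB hf; rewrite dom_coloured h1 /=.
  apply/forallP => a; apply/forallP => b; apply/implyP; rewrite !dom_coloured => /andP[].
  exact: h2.
apply/and4P; split.
- apply/forallP => u; apply/forallP => v; apply/forallP => w; apply/implyP.
  case/and5P=> hu hv hw euv /andP[evw nuw].
  have [nf ou] := inA _ hu; have [_ ov] := inA _ hv; have [_ ow] := inA _ hw.
  have [h _ _] := hA nf; exact: (h u v w).
- apply/forallP => a; apply/forallP => b; apply/forallP => c; apply/forallP => d.
  apply/negP => /and5P[_ _ _ _ /and5P[h1 h2 h3 h4 /andP[h5 h6]]].
  exact: (K4_free ecol h1 h2 h3 h4 h5 h6).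
- apply/forallP => u; apply/implyP => /andP[hI hu].
  have [nf ou] := inA _ hI; have [_ _ ns] := hA nf; exact (two_kinds ns hI hu).
apply/implyP => /andP[dx dy].
have Ex : partial S1 x = col x by rewrite /partial -dom_coloured dx.
have Ey : partial S1 y = col y by rewrite /partial -dom_coloured dy.
rewrite Ex Ey; apply/and4P; split.
- by apply/implyP; apply: ecol.
- apply/implyP => /existsP[u /existsP[v /and5P[hu hv euv exu /and3P[exv eyv eyu]]]].
  have [nf ou] := inA _ hu; have [_ ov] := inA _ hv; have [_ hb _] := hA nf.
  apply: contra (hb (col x) u v) => E; apply/and4P; split => //.
  by apply/existsP; exists x; apply/existsP; exists y; rewrite eqxx eq_sym E exu exv eyv.
- apply/forallP => u; apply/forallP => v; apply/forallP => w; apply/implyP.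
  case/and5P=> _ _ _ uv /andP[uw vw].
  apply/existsP; exists (col u); apply/existsP; exists (col v); apply/existsP; exists (col w).
  have fc u' : free_colour e L u' x (col x) y (col y) (col u').
    by rewrite /free_colour colL /=; apply/andP; split; apply/implyP => /ecol; rewrite eq_sym.
  have aoe a b : adj_or_eq e a b -> (a == b) == (col a == col b).
    case/orP=> [/eqP->|hab]; first by rewrite !eqxx.
    by rewrite (negbTE (ecol hab)); apply/eqP/negbTE; apply: contraTneq hab => ->; rewrite eirr.
  by rewrite !fc !aoe.
case: (boolP flag) hA hB inA => hf hA hB inA.
  by apply/forallP => u; rewrite /inI.
have [_ _ ns] := hA isT; exact: (complete_nae false ns dx dy).
Qed.

(** The algorithm quantifies over a fixed number of vertices, so smaller sets are filled up by
    repeating one vertex. *)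
Definition pad k (s : seq T) (x0 : T) := s ++ nseq (k - size s) x0.
Lemma size_pad k s x0 : size s <= k -> size (pad k s x0) = k.
Proof. by move=> h; rewrite size_cat size_nseq subnKC. Qed.
Lemma mem_pad k s x0 : {subset pad k s x0 <= x0 :: s}.
Proof.
by move=> x; rewrite mem_cat inE => /orP[->|/nseqP[-> _]]; rewrite ?eqxx ?orbT.
Qed.
Lemma sub_pad k s x0 : {subset s <= pad k s x0}.
Proof. by move=> x; rewrite mem_cat => ->. Qed.

Lemma dominated_pad k S s : s \in S -> dominated e (pad k S s) =1 dominated e S.
Proof.
move=> hs x; apply: eq_has_r => y; apply/idP/idP; last exact: sub_pad.
by move=> /mem_pad; rewrite inE => /orP[/eqP->|].
Qed.

(* 19 = 1 + 9 + 9 vertices dominate a component of a P5-free graph. For each of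
   the 81 * size1 ^ 2 star types at most seven stars of four vertices are guessed. *)
Definition size1 := 19.
Definition size2 := 28 * (81 * size1 * size1).

Definition good_guess r := exists flag S1 S2, [/\ size S1 = size1, size S2 = size2 &
    forall x y, constraint e L flag r (coloured S1) (coloured S2)
      x (partial S1 x) y (partial S1 y)].

Lemma complete_guess r : noP2P5 e \/ noP3P4 e ->
  good_guess r.
Proof.
move=> H.
have caseB : noP5 e -> good_guess r.
  move=> h; have [S [h1 h2 h3]] := P5_free_dominated esym ecol r h.
  have /hasP[s hs _] := h2.
  have E := dominated_pad size1 hs.
  exists true, (pad size1 S s), (pad size2 [::] s); split; rewrite ?size_pad //.
  apply: complete_constraint => // _; rewrite E; split => // x y; rewrite !E; exact: h3.
have caseA S : size S <= size1 -> S != [::] ->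
    (forall u v w, outside e S u -> outside e S v -> outside e S w ->
        e u v -> e v w -> u != w -> e u w) ->
    (forall d u v, ~~ bad_pair e col d S u v) -> good_guess r.
  case: S => [//|s S0]; set S := s :: S0 => hS _ hcl hcr.
  have sS : s \in S by rewrite mem_head.
  pose S1 := pad size1 S s.
  have E : _ =1 dominated e S := dominated_pad size1 sS.
  pose taus := [seq tau <- [seq (wp, q) | wp <- [seq (w, p) | w <- enum {: 'I_3 * 'I_3 * 'I_3 * 'I_3}, p <- S1], q <- S1]
     | good_type col (outside e S1) tau S1].
  have sz1 : size S1 = size1 by apply: size_pad.
  have sz : size taus <= 81 * size1 * size1.
    rewrite size_filter; apply: leq_trans (count_size _ _) _.
    by rewrite !size_allpairs sz1 -cardT !card_prod card_ord.
  have gt : {in taus, forall tau, good_type col (outside e S1) tau S1}.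
    by move=> tau; rewrite mem_filter => /andP[].
  have [S2 h2 hns] := star_cover esym ecol H gt.
  have sz2 : size S2 <= size2 by apply: leq_trans h2 _; rewrite leq_mul2l sz.
  exists false, S1, (pad size2 S2 s); split => //; first exact: size_pad.
  apply: complete_constraint => // _; split.
  - by move=> u v w; rewrite /outside !E; apply: hcl.
  - by move=> d u v; have := hcr d u v; rewrite /bad_pair /outside !E.
  move=> tau ht y z t u; have htau : tau \in taus.
    rewrite mem_filter ht andTb; case: tau ht => [[[[[a b] c] k] p] q] /and5P[_ _ hp hq _].
    apply: (allpairs_f (fun wp q => (wp, q))) => //.
    by apply: (allpairs_f (fun w p => (w, p))) => //; rewrite mem_enum.
  apply: contra (hns tau htau y z t u); apply: star_anti.
  move=> x; rewrite !(mem_cat x _ S1) => /orP[h|->]; last by rewrite orbT.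
  by rewrite sub_pad.
case: (H) => H'.
- case: (pickP [pred w : T * T * T * T * T | is_path5 e w.1.1.1.1 w.1.1.1.2 w.1.1.2 w.1.2 w.2]).
    case=> [[[[p q] v] s] t] /= hP; pose S := [:: p; q; v; s; t].
    have ind a b : outside e S a -> outside e S b -> e a b -> False.
      move=> oa ob eab; apply: (H' _ _ _ _ _ _ _ eab hP).
      apply/allP => x hx; apply/allP => y hy.
      have : outside e S x by move: hx; rewrite !inE => /orP[]/eqP->.
      by move/(outsideP esym) => /(_ y hy) [].
    apply: (caseA S) => //; first by move=> u v' w ou ov _ euv; case: (ind u v').
    by move=> d a b; apply/negP => /and4P[oa ob eab _]; apply: (ind a b).
  by move=> h; apply: caseB => p q v s t; have /= -> := h (p, q, v, s, t).
- case: (pickP [pred w : T * T * T * T | is_path4 e w.1.1.1 w.1.1.2 w.1.2 w.2]).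
    case=> [[[p q] v] s] /= hP; have [S [h1 h2 h3]] := no_crossing esym ecol H' hP.
    apply: (caseA S) => //.
    - by apply: leq_trans h1 _.
    - by apply: contraTneq (h2 p (mem_head _ _)) => ->.
    by move=> u v' w; exact: (outside_cliques esym H' hP h2).
  move=> h; apply: caseB => p q v s t; apply/negP => hP; have := h (p, q, v, s) => /=.
  by move: hP; rewrite /is_path5 /is_path4 => /and5P[-> -> -> _ /and5P[-> -> _ -> _]].
Qed.

End Complete.

(** * Forbidden induced subgraphs *)

Definition two_paths a i j := ((i < a) == (j < a)) && ((i.+1 == j) || (j.+1 == i)).

Lemma two_pathsE a b (i j : 'I_(a + b)) :
  disj_union (@path_graph a) (@path_graph b) i j = two_paths a i j.
Proof.
rewrite /disj_union /two_paths.
case: (splitP i) => i' ->; case: (splitP j) => j' -> //=; rewrite /path_graph ?ltn_ord ?ltnNge ?leq_addr //=.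
by rewrite -!addnS !eqn_add2l.
Qed.

(* Two places of the list are distinct when their rows in the adjacency table
   differ; h covers the remaining pairs (the ends of a path on three vertices). *)
Lemma induced_two_paths n (e : rel 'I_n) a b x0 (s : seq 'I_n) :
  (forall i j, i < a + b -> j < a + b -> e (nth x0 s i) (nth x0 s j) = two_paths a i j) ->
  (forall i j, i < j -> j < a + b -> all (fun k => two_paths a i k == two_paths a j k)
     (iota 0 (a + b)) -> nth x0 s i != nth x0 s j) ->
  induced_sub (disj_union (@path_graph a) (@path_graph b)) e.
Proof.
move=> he h; exists (fun i => nth x0 s i); split; last by move=> i j; rewrite two_pathsE he.
have H i j : i < j -> j < a + b -> nth x0 s i = nth x0 s j -> False.
  move=> ij jb E; suff /(h i j ij jb) : all (fun k => two_paths a i k == two_paths a j k) (iota 0 (a + b)).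
    by rewrite E eqxx.
  apply/allP => k; rewrite mem_iota add0n => /= hk.
  by rewrite -!he ?E //; apply: ltn_trans jb.
move=> i j E; apply: val_inj; case: (ltngtP i j) => //= ij; first by case: (H _ _ ij (ltn_ord j) E).
by case: (H _ _ ij (ltn_ord i)).
Qed.

Section Patterns.
Variables (n : nat) (e : rel 'I_n).
Hypotheses (esym : symmetric e) (eirr : irreflexive e).

Lemma anti_false (A B : seq 'I_n) x y : anti e A B -> x \in A -> y \in B -> e x y = false.
Proof. by move=> /allP h /h/allP h' /h'/negbTE. Qed.

Lemma noP2P5_free : H_free P2P5 e -> noP2P5 e.
Proof.
move=> hfree a b p q r s t eab; rewrite /is_path5.
case/and5P=> e1 e2 e3 e4 /and5P[/negbTE n1 /negbTE n2 /negbTE n3 /negbTE n4 /andP[/negbTE n5 /negbTE n6]] /anti_false hA.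
apply: hfree; apply: (@induced_two_paths _ e 2 5 a [:: a; b; p; q; r; s; t]).
  have sy x y c : e x y = c -> e y x = c by rewrite esym.
  move=> [|[|[|[|[|[|[|//]]]]]]] [|[|[|[|[|[|[|//]]]]]]] _ _;
   rewrite [RHS]/= [nth _ _ _]/= [X in e _ X]/=; first [exact: eirr | assumption | by apply: sy | by apply: hA; rewrite !inE eqxx ?orbT
   | by apply: sy; apply: hA; rewrite !inE eqxx ?orbT].
move=> i j ij jb; have := ltn_trans ij jb; move: i j jb ij.
by move=> [|[|[|[|[|[|[|//]]]]]]] [|[|[|[|[|[|[|//]]]]]]] //= _ _ _; rewrite /two_paths.
Qed.

Lemma noP3P4_free : H_free P3P4 e -> noP3P4 e.
Proof.
move=> hfree a b c p q r s; rewrite /is_path3 /is_path4.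
case/and4P=> nac eab ebc /negbTE eac /and5P[epq eqr ers /negbTE epr /andP[/negbTE eps /negbTE eqs]] /anti_false hA.
apply: hfree; apply: (@induced_two_paths _ e 3 4 a [:: a; b; c; p; q; r; s]).
  have sy x y d : e x y = d -> e y x = d by rewrite esym.
  move=> [|[|[|[|[|[|[|//]]]]]]] [|[|[|[|[|[|[|//]]]]]]] _ _;
   rewrite [RHS]/= [nth _ _ _]/= [X in e _ X]/=; first [exact: eirr | assumption | by apply: sy | by apply: hA; rewrite !inE eqxx ?orbT
   | by apply: sy; apply: hA; rewrite !inE eqxx ?orbT].
move=> i j ij jb; have := ltn_trans ij jb; move: i j jb ij.
by move=> [|[|[|[|[|[|[|//]]]]]]] [|[|[|[|[|[|[|//]]]]]]] //= _ _ _; rewrite /two_paths.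
Qed.
End Patterns.

(** * Stack programs on a Turing machine *)

Definition store := nat -> seq bool.
Definition upd (A : Type) (st : nat -> A) s l : nat -> A :=
  fun s' => if s' == s then l else st s'.

(* Loop s b cf ct pops s until it is empty; with b = false it also stops after
   the first popped false. *)
Inductive cmd :=
  | Skip | Push of nat & bool | Seq of cmd & cmd
  | Pop of nat & cmd & cmd & cmd
  | Loop of nat & bool & cmd & cmd.

(** Time counts the executed instructions of the compiled code, jumps included: a branch that ends
    in a jump adds 2, while the last branch of [Pop] falls through and adds 1. *)
Inductive run : cmd -> store -> nat -> store -> Prop :=
  | run_skip st : run Skip st 0 st
  | run_push s b st : run (Push s b) st 1 (upd st s (b :: st s))
  | run_seq c1 c2 st st1 st2 t1 t2 :
      run c1 st t1 st1 -> run c2 st1 t2 st2 -> run (Seq c1 c2) st (t1 + t2) st2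
  | run_popN s cn cf ct st t st' : st s = [::] ->
      run cn st t st' -> run (Pop s cn cf ct) st (t + 2) st'
  | run_popF s cn cf ct st l t st' : st s = false :: l ->
      run cf (upd st s l) t st' -> run (Pop s cn cf ct) st (t + 2) st'
  | run_popT s cn cf ct st l t st' : st s = true :: l ->
      run ct (upd st s l) t st' -> run (Pop s cn cf ct) st (t + 1) st'
  | run_loopN s b cf ct st : st s = [::] -> run (Loop s b cf ct) st 1 st
  | run_loopT s b cf ct st l t1 st1 t2 st2 : st s = true :: l ->
      run ct (upd st s l) t1 st1 -> run (Loop s b cf ct) st1 t2 st2 ->
      run (Loop s b cf ct) st (t1 + t2 + 2) st2
  | run_loopF s cf ct st l t1 st1 t2 st2 : st s = false :: l ->
      run cf (upd st s l) t1 st1 -> run (Loop s true cf ct) st1 t2 st2 ->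
      run (Loop s true cf ct) st (t1 + t2 + 2) st2
  | run_loopX s cf ct st l t1 st1 : st s = false :: l ->
      run cf (upd st s l) t1 st1 -> run (Loop s false cf ct) st (t1 + 2) st1.

(** * Compilation to code with jumps *)

Inductive instr :=
  | IPush of nat & bool | IPop of nat & nat & nat & nat | IJmp of nat.

Fixpoint csize c := match c with
  | Skip => 0 | Push _ _ => 1 | Seq c1 c2 => csize c1 + csize c2
  | Pop _ cn cf ct => (csize cn + 1) + (csize cf + 1) + csize ct + 1
  | Loop _ _ cf ct => (csize cf + 1) + (csize ct + 1) + 1
  end.

Fixpoint comp c (a : nat) : seq instr := match c with
  | Skip => [::]
  | Push s b => [:: IPush s b]
  | Seq c1 c2 => comp c1 a ++ comp c2 (a + csize c1)
  | Pop s cn cf ct =>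
      let fin := a + csize c in
      let af := a.+1 + csize cn + 1 in
      let at_ := af + csize cf + 1 in
      IPop s a.+1 af at_ ::
      comp cn a.+1 ++ IJmp fin :: comp cf af ++ IJmp fin :: comp ct at_
  | Loop s b cf ct =>
      let fin := a + csize c in
      let at_ := a.+1 + csize cf + 1 in
      IPop s fin a.+1 at_ ::
      comp cf a.+1 ++ IJmp (if b then a else fin) :: comp ct at_ ++ [:: IJmp a]
  end.

Lemma size_comp c a : size (comp c a) = csize c.
Proof.
elim: c a => [|s b|c1 h1 c2 h2|s cn hn cf hf ct ht|s b cf hf ct ht] a //=;
  rewrite ?size_cat /= ?size_cat /= ?h1 ?h2 ?hn ?hf ?ht //; lia.
Qed.

Definition istep (p : seq instr) (c : nat * store) : option (nat * store) :=
  match onth p c.1 with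
  | None => None
  | Some (IPush s b) => Some (c.1.+1, upd c.2 s (b :: c.2 s))
  | Some (IPop s ln lf lt) =>
      Some match c.2 s with
           | [::] => (ln, c.2)
           | false :: l => (lf, upd c.2 s l)
           | true :: l => (lt, upd c.2 s l)
           end
  | Some (IJmp l) => Some (l, c.2)
  end.

Inductive ireach p : nat -> nat * store -> nat * store -> Prop :=
  | ir0 c : ireach p 0 c c
  | irS k c c1 c2 : istep p c = Some c1 -> ireach p k c1 c2 -> ireach p k.+1 c c2.

Lemma ireach_trans p k1 k2 a b c :
  ireach p k1 a b -> ireach p k2 b c -> ireach p (k1 + k2) a c.
Proof.
elim=> [//|k a' a1 a2 h1 _ IH] /IH h.
by rewrite addSn; apply: irS h1 h.
Qed.

Lemma ireach1 p a b : istep p a = Some b -> ireach p 1 a b.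
Proof. by move=> h; apply: irS h (ir0 _ _). Qed.

Lemma onth_mid (T : Type) (p1 p2 : seq T) x : onth (p1 ++ x :: p2) (size p1) = Some x.
Proof. by elim: p1. Qed.

Definition code_at (p : seq instr) a q := exists p1 p2, size p1 = a /\ p = p1 ++ q ++ p2.

Lemma code_cat p a q1 q2 : code_at p a (q1 ++ q2) ->
  code_at p a q1 /\ code_at p (a + size q1) q2.
Proof.
case=> p1 [p2 [<- ->]]; split; first by exists p1, (q2 ++ p2); rewrite -catA.
by exists (p1 ++ q1), p2; rewrite size_cat -!catA.
Qed.

Lemma code_cons p a i q : code_at p a (i :: q) -> onth p a = Some i /\ code_at p a.+1 q.
Proof.
case=> p1 [p2 [<- ->]]; split; first exact: onth_mid.
by exists (rcons p1 i), p2; rewrite size_rcons cat_rcons.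
Qed.

Lemma run_comp p c st t st' : run c st t st' ->
  forall a, code_at p a (comp c a) -> ireach p t (a, st) (a + csize c, st').
Proof.
elim => {c st t st'}.
- by move=> st a _; rewrite addn0; apply: ir0.
- move=> s b st a /code_cons[h _]; apply: ireach1.
  by rewrite /istep /= h addn1.
- move=> c1 c2 st st1 st2 t1 t2 _ h1 _ h2 a /= /code_cat[/h1 k1].
  by rewrite size_comp addnA => /h2 k2; apply: ireach_trans k1 k2.
- move=> s cn cf ct st t st' es _ h a /= /code_cons[h0 /code_cat[/h k1]].
  rewrite size_comp => /code_cons[h2 _]; rewrite addn2.
  apply: (irS (c1 := (a.+1, st))); first by rewrite /istep h0 /= es.
  by rewrite -addn1; apply: ireach_trans k1 (ireach1 _); rewrite /istep h2.
- move=> s cn cf ct st l t st' es _ h a /= /code_cons[h0 /code_cat[_]].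
  rewrite size_comp => /code_cons[_].
  have -> : (a.+1 + csize cn).+1 = a.+1 + csize cn + 1 by lia.
  move=> /code_cat[/h k1]; rewrite size_comp => /code_cons[h2 _]; rewrite addn2.
  apply: (irS (c1 := (a.+1 + csize cn + 1, upd st s l))); first by rewrite /istep h0 /= es.
  by rewrite -addn1; apply: ireach_trans k1 (ireach1 _); rewrite /istep h2.
- move=> s cn cf ct st l t st' es _ h a /= /code_cons[h0 /code_cat[_]].
  rewrite size_comp => /code_cons[_].
  have -> : (a.+1 + csize cn).+1 = a.+1 + csize cn + 1 by lia.
  move=> /code_cat[_]; rewrite size_comp => /code_cons[_].
  have -> : (a.+1 + csize cn + 1 + csize cf).+1 = a.+1 + csize cn + 1 + csize cf + 1 by lia.
  move=> /h k1; rewrite addn1.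
  apply: (irS (c1 := (a.+1 + csize cn + 1 + csize cf + 1, upd st s l))).
    by rewrite /istep h0 /= es.
  by congr (ireach _ _ _ (_, _)) : k1; lia.
- move=> s b cf ct st es a /= /code_cons[h0 _].
  by apply: ireach1; rewrite /istep h0 /= es.
- move=> s b cf ct st l t1 st1 t2 st2 es _ h1 _ h2 a ha.
  have k2 := h2 a ha; move: ha => /= /code_cons[h0 /code_cat[_]].
  rewrite size_comp => /code_cons[_].
  have -> : (a.+1 + csize cf).+1 = a.+1 + csize cf + 1 by lia.
  move=> /code_cat[/h1 k1]; rewrite size_comp => /code_cons[h3 _].
  have -> : t1 + t2 + 2 = (t1 + (1 + t2)).+1 by lia.
  apply: (irS (c1 := (a.+1 + csize cf + 1, upd st s l))); first by rewrite /istep h0 /= es.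
  apply: ireach_trans k1 (ireach_trans (ireach1 _) k2).
  by rewrite /istep h3.
- move=> s cf ct st l t1 st1 t2 st2 es _ h1 _ h2 a ha.
  have k2 := h2 a ha; move: ha => /= /code_cons[h0 /code_cat[/h1 k1]].
  rewrite size_comp => /code_cons[h3 _].
  have -> : t1 + t2 + 2 = (t1 + (1 + t2)).+1 by lia.
  apply: (irS (c1 := (a.+1, upd st s l))); first by rewrite /istep h0 /= es.
  apply: ireach_trans k1 (ireach_trans (ireach1 _) k2).
  by rewrite /istep h3.
- move=> s cf ct st l t1 st1 es _ h1 a /= /code_cons[h0 /code_cat[/h1 k1]].
  rewrite size_comp => /code_cons[h3 _].
  rewrite addn2; apply: (irS (c1 := (a.+1, upd st s l))); first by rewrite /istep h0 /= es.
  by rewrite -addn1; apply: ireach_trans k1 (ireach1 _); rewrite /istep h3.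
Qed.

(** * Tape tracks as base 3 digits *)

Definition digit i v := v %/ 3 ^ i %% 3.
Definition number (d : nat -> nat) K := \sum_(i < K) d i * 3 ^ i.
Definition set_digit i x v := v - digit i v * 3 ^ i + x * 3 ^ i.

Section Digits.
Variable d : nat -> nat.
Hypothesis d3 : forall i, d i < 3.

Lemma number_lt K : number d K < 3 ^ K.
Proof.
elim: K => [|K IH]; first by rewrite /number big_ord0.
by rewrite /number big_ord_recr /= -/(number d K) expnS; have := d3 K; nia.
Qed.

Lemma digit_number K i : i < K -> digit i (number d K) = d i.
Proof.
elim: K => // K IH; rewrite ltnS /number big_ord_recr /= -/(number d K) /digit.
case: ltngtP => // [hi|->] _.
  rewrite -[in X in _ * X](subnK (ltnW hi)) expnD mulnA addnC divnMDl ?expn_gt0 //.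
  rewrite -[in RHS](IH hi) /digit -modnDml -(subnSK hi) expnS mulnCA modnMr add0n.
  by [].
by rewrite addnC divnMDl ?expn_gt0 // (divn_small (number_lt K)) addn0 modn_small.
Qed.

Lemma set_digit_number K i x : i < K ->
  set_digit i x (number d K) = number (upd d i x) K.
Proof.
move=> hi; rewrite /set_digit digit_number // /number.
rewrite (bigD1 (Ordinal hi)) //= [RHS](bigD1 (Ordinal hi)) //= addKn /upd eqxx addnC; congr (_ + _).
apply: eq_bigr => j /eqP hj; case: eqP => // E; case: hj; exact: val_inj.
Qed.

Lemma number_eq0 K : (number d K == 0) = [forall i : 'I_K, d i == 0].
Proof.
rewrite /number sum_nat_eq0; apply: eq_forallb => i /=.
by rewrite muln_eq0 expn_eq0 orbF.
Qed.
End Digits.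

Lemma eq_number d d' K : (forall i, i < K -> d i = d' i) -> number d K = number d' K.
Proof. by move=> h; apply: eq_bigr => i _; rewrite h. Qed.

(* The simulating machine keeps stack i on track i, i.e. in the base 3 digit i
   of the tape symbols, bottom first, starting one cell to the right of a blank
   home cell. A state is 8 * pc + phase. *)
Section Machine.
Variables (p : seq instr) (K : nat).
Hypothesis K0 : 0 < K.
Hypothesis pK : forall pc, match onth p pc with
  | Some (IPush s _) => s < K
  | Some (IPop s ln lf lt) =>
      [&& s < K, ln <= (size p).+1, lf <= (size p).+1 & lt <= (size p).+1]
  | Some (IJmp l) => l <= (size p).+1
  | None => true
  end.

(** The program counters run up to [(size p).+1], with eight phases each. The last two carry no
    instruction: the machine halts there, accepting at [size p]. *)
Definition nq := 8 * size p + 15.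
Definition ns := 3 ^ K - 3.
Definition mkq pc ph : 'I_nq.+1 := inord (pc * 8 + ph).
Definition mks v : 'I_ns.+3 := inord v.

(** Phase 0 moves from the input to the home cell on its left, 1 fetches the instruction, 2 runs
    right to the first free cell of the track, 3 returns after a push, 4 looks at the top entry to
    be popped, 5 and 6 return after popping false and true. The return stops at the first blank,
    which is home because no cell below the top of the stack is blank. *)
Definition table pc ph ins (s : 'I_ns.+3) :
    option ('I_nq.+1 * 'I_ns.+3 * move) :=
  match ph, ins with
  | 0, _ => Some (mkq pc 1, s, MoveL)
  | 1, Some (IJmp l) => Some (mkq l 1, s, Stay)
  | 1, Some _ => Some (mkq pc 2, s, MoveR)
  | 2, Some (IPush i b) =>
      if digit i s == 0
      then Some (mkq pc 3, mks (set_digit i (if b then 2 else 1) s), MoveL)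
      else Some (mkq pc 2, s, MoveR)
  | 2, Some (IPop i _ _ _) =>
      if digit i s == 0 then Some (mkq pc 4, s, MoveL)
      else Some (mkq pc 2, s, MoveR)
  | 3, Some _ =>
      if s == 0 :> nat then Some (mkq pc.+1 1, s, Stay)
      else Some (mkq pc 3, s, MoveL)
  | 4, Some (IPop i ln _ _) =>
      if s == 0 :> nat then Some (mkq ln 1, s, Stay)
      else Some (mkq pc (if digit i s == 2 then 6 else 5),
                 mks (set_digit i 0 s), MoveL)
  | 5, Some (IPop _ _ lf _) =>
      if s == 0 :> nat then Some (mkq lf 1, s, Stay)
      else Some (mkq pc 5, s, MoveL)
  | 6, Some (IPop _ _ _ lt) =>
      if s == 0 :> nat then Some (mkq lt 1, s, Stay)
      else Some (mkq pc 6, s, MoveL)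
  | _, _ => None
  end.

Definition delta (q : 'I_nq.+1) s := table (q %/ 8) (q %% 8) (onth p (q %/ 8)) s.

Definition machine : TM :=
  @Build_TM nq ns delta (fun q => q %/ 8 == size p).

Notation cfg := (config machine).

Lemma mkqE pc ph : pc <= (size p).+1 -> ph < 8 ->
  (mkq pc ph %/ 8 = pc) * (mkq pc ph %% 8 = ph).
Proof.
move=> h1 h2; have -> : mkq pc ph = pc * 8 + ph :> nat.
  by rewrite inordK // /nq; lia.
by rewrite divnMDl // (divn_small h2) addn0 modnMDl modn_small.
Qed.

Lemma ns3 : ns.+3 = 3 ^ K.
Proof. by rewrite /ns -addn3 subnK // -{1}(expn1 3) leq_exp2l. Qed.

(* Head at cell i of the tape g; cell 0 is home. *)
Definition at_cell (q : 'I_nq.+1) (i : nat) (g : nat -> 'I_ns.+3) (c : cfg) :=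
  [/\ cf_state c = q, cf_left c = rev (mkseq g i), cf_head c = g i
    & forall m, nth ord0 (cf_right c) m = g (i.+1 + m)].

Fixpoint msteps k (c c' : cfg) : Prop :=
  if k is k'.+1 then exists2 c1, step c = Some c1 & msteps k' c1 c' else c = c'.

Lemma msteps_trans k1 k2 a b c : msteps k1 a b -> msteps k2 b c -> msteps (k1 + k2) a c.
Proof.
elim: k1 a => [|k IH] a /=; first by move=> ->.
by case=> c1 h1 h2 h3; exists c1 => //; apply: IH h2 h3.
Qed.

Lemma msteps_step k a b c : step a = Some b -> msteps k b c -> msteps (1 + k) a c.
Proof. by exists b. Qed.

Lemma at_ext q i g g' c : g =1 g' -> at_cell q i g c -> at_cell q i g' c.
Proof.
move=> h [h1 h2 h3 h4]; split => //; first by rewrite h2 (eq_mkseq h).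
- by rewrite h3 h.
- by move=> m; rewrite h4 h.
Qed.

Lemma upd_id (A : Type) (g : nat -> A) i : upd g i (g i) =1 g.
Proof. by move=> j; rewrite /upd; case: eqP => [->|]. Qed.

Lemma mkseq_upd g i (x : 'I_ns.+3) : mkseq (upd g i x) i = mkseq g i.
Proof.
apply/eq_in_map => j; rewrite mem_iota add0n => /= h.
by rewrite /upd ifN // neq_ltn h.
Qed.

Lemma move_right q i g c q' x : at_cell q i g c ->
  delta q (g i) = Some (q', x, MoveR) ->
  exists2 c', step c = Some c' & at_cell q' i.+1 (upd g i x) c'.
Proof.
case=> h1 h2 h3 h4 hd; rewrite /step /= h1 h3 hd.
have E : x :: rev (mkseq g i) = rev (mkseq (upd g i x) i.+1).
  rewrite mkseqS rev_rcons mkseq_upd /upd eqxx //.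
have U m : upd g i x (i.+1 + m) = g (i.+1 + m) by rewrite /upd ifN // neq_ltn addSn ltnS leq_addr orbT.
case er: (cf_right c) h4 => [|y r] h4; eexists; first by [].
- split => //=; first by rewrite h2 E.
    by rewrite -[i.+1]addn0 U -h4.
  by move=> m; rewrite nth_nil addSnnS U -h4 nth_nil.
- by [].
split => //=; first by rewrite h2 E.
  by rewrite -[i.+1]addn0 U -h4.
by move=> m; rewrite addSnnS U -h4.
Qed.

Lemma move_left q i g c q' x : at_cell q i.+1 g c ->
  delta q (g i.+1) = Some (q', x, MoveL) ->
  exists2 c', step c = Some c' & at_cell q' i (upd g i.+1 x) c'.
Proof.
case=> h1 h2 h3 h4 hd; rewrite /step /= h1 h3 hd h2 mkseqS rev_rcons.
have U m : m != i.+1 -> upd g i.+1 x m = g m by rewrite /upd => /negbTE->.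
eexists; first by []; split => //=.
- congr rev; apply/eq_in_map => j; rewrite mem_iota add0n => /= h.
  by rewrite U // neq_ltn leqW.
- by rewrite U // neq_ltn ltnSn.
case=> [|m] /=; first by rewrite addn0 /upd eqxx.
by rewrite h4 addSnnS U // neq_ltn addnS !addSn ltnS ltnS leq_addr orbT.
Qed.

Lemma stay q i g c q' : at_cell q i g c ->
  delta q (g i) = Some (q', g i, Stay) ->
  exists2 c', step c = Some c' & at_cell q' i g c'.
Proof.
by case=> h1 h2 h3 h4 hd; rewrite /step /= h1 h3 hd; eexists; first by [].
Qed.

Lemma deltaE pc ph v : pc <= (size p).+1 -> ph < 8 ->
  delta (mkq pc ph) v = table pc ph (onth p pc) v.
Proof. by move=> h1 h2; rewrite /delta !(mkqE h1 h2). Qed.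

Definition dig (l : seq bool) j :=
  if j < size l then (if nth false (rev l) j then 2 else 1) else 0.

Lemma dig3 l j : dig l j < 3.
Proof. by rewrite /dig; case: (j < size l) => //=; case: (nth _ _ _). Qed.

Lemma dig_gt0 l j : (dig l j == 0) = (size l <= j).
Proof. by rewrite /dig [RHS]leqNgt; case: (j < size l) => //=; case: (nth _ _ _). Qed.

Lemma dig_push b l : dig (b :: l) =1 upd (dig l) (size l) (if b then 2 else 1).
Proof.
move=> j; rewrite /upd /dig /= rev_cons nth_rcons size_rev ltnS leq_eqVlt.
by case: (ltngtP j (size l)) => //= ->; rewrite ltnn eqxx.
Qed.

Lemma dig_pop b l : dig l =1 upd (dig (b :: l)) (size l) 0.
Proof.
move=> j; rewrite /upd; case: eqP => [->|n]; first by rewrite /dig ltnn.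
by rewrite dig_push /upd; case: eqP.
Qed.

Definition repr (g : nat -> 'I_ns.+3) (st : store) :=
  g 0 = 0 :> nat /\ forall j, g j.+1 = number (fun i => dig (st i) j) K :> nat.

Lemma repr_digit g st i j : repr g st -> i < K -> digit i (g j.+1) = dig (st i) j.
Proof. by case=> _ h hi; rewrite h (digit_number (fun k => dig3 _ _) hi). Qed.

Lemma repr_eq0 g st i j : repr g st -> i < K -> j < size (st i) -> (g j.+1 == 0 :> nat) = false.
Proof.
case=> _ h hi hj; rewrite h number_eq0; apply/negbTE/negP => /forallP /(_ (Ordinal hi)).
by rewrite /= dig_gt0 leqNgt hj.
Qed.

Lemma repr_write g st i j l x : repr g st -> i < K -> x < 3 ->
  dig l =1 upd (dig (st i)) j x ->
  repr (upd g j.+1 (mks (set_digit i x (g j.+1)))) (upd st i l).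
Proof.
move=> [h0 h] hi hx hl; split => // j'; rewrite /upd eqSS.
case: eqP => [->|n].
  rewrite h (set_digit_number (fun k => dig3 _ _) x hi).
  rewrite inordK; last first.
    by rewrite ns3; apply: number_lt => k; rewrite /upd; case: eqP => // _; exact: dig3.
  apply: eq_number => k _; rewrite /upd; case: eqP => // _.
  by rewrite hl /upd eqxx.
rewrite h; apply: eq_number => k _; case: eqP => // ->.
by rewrite hl /upd; case: eqP.
Qed.

Lemma scan q s st g c k : repr g st -> s < K ->
  (forall v : 'I_ns.+3, digit s v != 0 -> delta q v = Some (q, v, MoveR)) ->
  k <= size (st s) -> at_cell q k.+1 g c ->
  exists2 c', msteps (size (st s) - k) c c' & at_cell q (size (st s)).+1 g c'.
Proof.
move=> hr hs hq; move Em : (size (st s) - k) => m.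
elim: m k c Em => [|m IH] k c Em hk hc.
  by exists c => //; have -> : size (st s) = k by lia.
have hd : digit s (g k.+1) != 0 by rewrite (repr_digit _ hr hs) dig_gt0; lia.
have [c1 h1 h2] := move_right hc (hq _ hd).
have [|||c2 h3 h4] := IH k.+1 c1; [lia|lia|exact: at_ext (@upd_id _ g k.+1) h2|].
by exists c2 => //; exists c1.
Qed.

Lemma return_home q (g : nat -> 'I_ns.+3) c k :
  (forall v : 'I_ns.+3, v != 0 :> nat -> delta q v = Some (q, v, MoveL)) ->
  (forall j, j < k -> (g j.+1 == 0 :> nat) = false) -> at_cell q k g c ->
  exists2 c', msteps k c c' & at_cell q 0 g c'.
Proof.
move=> hq; elim: k c => [|k IH] c hg hc; first by exists c.
have [c1 h1 h2] := move_left hc (hq _ (negbT (hg k (ltnSn k)))).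
have [||c2 h3 h4] := IH c1; [by move=> j hj; apply: hg; lia|exact: at_ext (@upd_id _ g k.+1) h2|].
by exists c2 => //; exists c1.
Qed.

Lemma onth_lt (i : nat) x : onth p i = Some x -> i < size p.
Proof. by elim: (p) i => [|y l IH] [|i] //= /IH. Qed.

Lemma simulate_instr pc st pc' st' (g : nat -> 'I_ns.+3) c :
  istep p (pc, st) = Some (pc', st') -> repr g st -> at_cell (mkq pc 1) 0 g c ->
  exists k c' g' i, [/\ msteps k c c', i < K, k <= (2 * size (st i)) + 4,
    at_cell (mkq pc' 1) 0 g' c' & repr g' st'].
Proof.
rewrite /istep /=; case E : (onth p pc) => [ins|//] hi hr hc.
have hpc : pc <= (size p).+1 by have := onth_lt E; lia.
have := pK pc; rewrite E.
case: ins E hi => [s b|s ln lf lt|l] E hi.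
- move=> hs; case: hi => <- <-.
  have [|c1 h1 h2] := @move_right _ _ _ _ (mkq pc 2) (g 0) hc; first by rewrite deltaE // /table E.
  have {}h2 := at_ext (@upd_id _ g 0) h2.
  have [||c2 h3 h4] := scan hr hs _ _ h2 => //.
    by move=> v hv; rewrite deltaE // /table E (negbTE hv).
  have dz : digit s (g (size (st s)).+1) == 0 by rewrite (repr_digit _ hr hs) dig_gt0.
  have [|c3 h5 h6] := @move_left _ _ _ _ (mkq pc 3) (mks (set_digit s (if b then 2 else 1) (g (size (st s)).+1))) h4.
    by rewrite deltaE // /table E dz.
  have hr' := repr_write (x := if b then 2 else 1) hr hs _ (@dig_push b (st s)).
  have {}hr' := hr' (ltac:(by case: (b))).
  set g' := upd g _ _ in h6 hr'.
  have [||c4 h7 h8] := return_home _ _ h6.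
  - by move=> v hv; rewrite deltaE // /table E (negbTE hv).
  - move=> j hj; apply: (repr_eq0 hr' hs); rewrite /upd eqxx /=; exact: ltnW.
  have [|c5 h9 h10] := stay (q' := mkq pc.+1 1) h8.
    by case: hr' => h0 _; rewrite deltaE // /table E h0.
  exists (1 + (size (st s) - 0 + (1 + (size (st s) + 1)))), c5, g', s; split => //.
  - apply: (msteps_step h1); apply: (msteps_trans h3).
    apply: (msteps_step h5); apply: (msteps_trans h7).
    exact: (@msteps_step 0 _ _ _ h9).
  - lia.
- case/and4P=> hs hln hlf hlt.
  have [|c1 h1 h2] := @move_right _ _ _ _ (mkq pc 2) (g 0) hc; first by rewrite deltaE // /table E.
  have {}h2 := at_ext (@upd_id _ g 0) h2.
  have [||c2 h3 h4] := scan hr hs _ _ h2 => //.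
    by move=> v hv; rewrite deltaE // /table E (negbTE hv).
  have dz : digit s (g (size (st s)).+1) == 0 by rewrite (repr_digit _ hr hs) dig_gt0.
  have [|c3 h5 h6] := @move_left _ _ _ _ (mkq pc 4) (g (size (st s)).+1) h4.
    by rewrite deltaE // /table E dz.
  have {}h6 := at_ext (@upd_id _ g _) h6.
  case es : (st s) hi h3 h4 h5 h6 dz => [|b l] hi h3 h4 h5 h6 dz.
    case: hi => <- <-.
    have [|c4 h7 h8] := stay (q' := mkq ln 1) h6.
      by case: hr => h0 _; rewrite deltaE // /table E h0.
    exists (1 + (0 + (1 + 1))), c4, g, s; split => //; last by lia.
    apply: (msteps_step h1); apply: (@msteps_trans 0 _ _ _ _ h3).
    apply: (msteps_step h5).
    exact: (@msteps_step 0 _ _ _ h7).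
  have hn : (g (size l).+1 == 0 :> nat) = false by apply: (repr_eq0 hr hs); rewrite es /=.
  have hdg : (digit s (g (size l).+1) == 2) = b.
    by rewrite (repr_digit _ hr hs) es dig_push /upd eqxx; case: (b).
  have [|c4 h7 h8] := @move_left _ _ _ _ (mkq pc (if b then 6 else 5)) (mks (set_digit s 0 (g (size l).+1))) h6.
    by rewrite deltaE // /table E hn hdg.
  have hr' : repr (upd g (size l).+1 (mks (set_digit s 0 (g (size l).+1)))) (upd st s l).
    by apply: (repr_write hr hs) => // j; rewrite es; exact: dig_pop.
  set g' := upd g _ _ in h8 hr'.
  have [||c5 h9 h10] := return_home _ _ h8.
  - by move=> v hv; case: (b); rewrite deltaE // /table E (negbTE hv).
  - by move=> j hj; apply: (repr_eq0 hr' hs); rewrite /upd eqxx.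
  have [|c6 h11 h12] := stay (q' := mkq (if b then lt else lf) 1) h10.
    by case: hr' => h0 _; case: (b); rewrite deltaE // /table E h0.
  exists (1 + ((size l).+1 - 0 + (1 + (1 + (size l + 1))))), c6, g', s.
  have -> : st' = upd st s l by case: (b) hi => [[_ <-]|[_ <-]].
  have -> : pc' = if b then lt else lf by case: (b) hi => [[<- _]|[<- _]].
  split => //.
  - apply: (msteps_step h1); apply: (msteps_trans h3).
    apply: (msteps_step h5).
    apply: (msteps_step h7); apply: (msteps_trans h9).
    exact: (@msteps_step 0 _ _ _ h11).
  - rewrite es /=; lia.
- move=> hl; case: hi => <- <-.
  have [|c1 h1 h2] := stay (q' := mkq l 1) hc; first by rewrite deltaE // /table E.
  exists 1, c1, g, 0; split => //; [by exists c1 | by rewrite addnS].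
Qed.

Lemma istep_size pc st pc' st' i : istep p (pc, st) = Some (pc', st') ->
  size (st' i) <= (size (st i)).+1.
Proof.
rewrite /istep /=; case: (onth p pc) => [[s b|s ln lf lt|l]|//].
- by case=> _ <-; rewrite /upd; case: eqP => [->|_] //=; exact: leqnSn.
- case E : (st s) => [|[] l] [_ <-]; rewrite ?leqnSn // /upd; case: eqP => [->|_];
   by rewrite ?E ?leqnSn //=; lia.
- by case=> _ <-; exact: leqnSn.
Qed.

(** Stacks grow by at most one per instruction, so the distance travelled for each of the [t]
    instructions is bounded through [H + t]. *)
Lemma simulate t pc st pc' st' : ireach p t (pc, st) (pc', st') ->
  forall g c H, repr g st -> at_cell (mkq pc 1) 0 g c ->
  (forall i, size (st i) <= H) ->
  exists k c' g', [/\ msteps k c c', k <= t * (2 * (H + t) + 4),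
    at_cell (mkq pc' 1) 0 g' c' & repr g' st'].
Proof.
move E1 : (pc, st) => a; move E2 : (pc', st') => b h.
elim: h pc st E1 E2 => {t a b} [a|t a [pc1 st1] b hs _ IH] pc st E1 E2 g c H hr hc hH.
  move: E2; rewrite -E1 => -[-> ->]; by exists 0, c, g.
rewrite -{}E1 in hs.
have [k [c1 [g1 [i [h1 h2 h3 h4 h5]]]]] := simulate_instr hs hr hc.
have [|k2 [c2 [g2 [h6 h7 h8 h9]]]] := IH _ _ erefl E2 g1 c1 H.+1 h5 h4.
  by move=> j; apply: leq_trans (istep_size j hs) _; rewrite ltnS.
exists (k + k2), c2, g2; split => //; first exact: msteps_trans h1 h6.
have := hH i; nia.
Qed.

Lemma exec_msteps k (c c' : cfg) t : msteps k c c' -> step c' = None ->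
  k <= t -> exec t c = Some c'.
Proof.
elim: k c t => [|k IH] c t /=.
  by move=> -> h _; case: t => [|t] /=; rewrite h.
case=> c1 h1 h2 h3; case: t => // t; rewrite ltnS => ht /=.
by rewrite h1; apply: IH.
Qed.

Definition input_store (x : seq bool) : store := fun i => if i == 0 then rev x else [::].

(** The input symbols 1 and 2 are digits on track 0 with all other tracks empty. The input is
    therefore already stack 0, with its last bit on top. *)
Lemma init_home x : exists2 c, step (init machine x) = Some c &
  exists2 g, at_cell (mkq 0 1) 0 g c & repr g (input_store x).
Proof.
pose f j : 'I_ns.+3 := nth ord0 (map (bit_sym machine) x) j.
pose g j := if j is j'.+1 then f j' else ord0 : 'I_ns.+3.
have hr : repr g (input_store x).
  split => // j; have K1 : K = K.-1.+1 by rewrite prednK.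
  rewrite K1 /number big_ord_recl big1 ?addn0 ?muln1 /=; last first.
    by move=> i _; rewrite /input_store /= /dig /= mul0n.
  rewrite /f /input_store /= /dig size_rev revK.
  case: ltnP => hj; last by rewrite nth_default ?size_map.
  rewrite (nth_map false) // /bit_sym inordK; first by case: ifP.
  by case: ifP.
have d0 v : delta ord0 v = Some (mkq 0 1, v, MoveL) by rewrite /delta /= ?mod0n ?div0n.
have hs h r : @step machine (@Config machine ord0 [::] h r) =
    Some (@Config machine (mkq 0 1) [::] (blank machine) (h :: r)).
  by rewrite /step -[tm_delta _ _]/(delta ord0 h) d0.
rewrite /init; case E : (map (bit_sym machine) x) => [|s r]; rewrite hs; eexists;
 [by [] | | by [] |]; exists g => //; split => //=.
- by case=> [|m] //=; rewrite /f E /= ?nth_nil.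
- by case=> [|m] //=; rewrite /f E.
Qed.

End Machine.

(** * One machine for one program *)

Fixpoint stacks_below K c := match c with
  | Skip => true | Push s _ => s < K
  | Seq c1 c2 => stacks_below K c1 && stacks_below K c2
  | Pop s cn cf ct => [&& s < K, stacks_below K cn, stacks_below K cf & stacks_below K ct]
  | Loop s _ cf ct => [&& s < K, stacks_below K cf & stacks_below K ct]
  end.

Definition good_instr K m ins := match ins with
  | IPush s _ => s < K
  | IPop s ln lf lt => [&& s < K, ln <= m, lf <= m & lt <= m]
  | IJmp l => l <= m
  end.

Lemma good_comp K c a m : stacks_below K c -> a + csize c <= m ->
  all (good_instr K m) (comp c a).
Proof.
elim: c a => [|s b|c1 h1 c2 h2|s cn hn cf hf ct ht|s b cf hf ct ht] a //=.
- by move=> ->.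
- by case/andP=> k1 k2 h; rewrite all_cat h1 ?h2 //; lia.
- case/and4P=> -> k1 k2 k3 h; rewrite !all_cat /= !all_cat /= hn ?hf ?ht //=; lia.
- case/and3P=> -> k1 k2 h; rewrite !all_cat /= !all_cat /= hf ?ht //=; case: b => /=; lia.
Qed.

Lemma all_onth (T : Type) (P : pred T) s : all P s -> forall i x, onth s i = Some x -> P x.
Proof. by elim: s => [|y s IH] /=; [move=> _ [] | case/andP=> h /IH k [|i] x /=; [case=> <-|apply: k]]. Qed.

Lemma machine_correct K B c : B < K -> stacks_below K c ->
  exists M : TM, forall x t st b l, run c (input_store x) t st -> st B = b :: l ->
  exists2 cf, exec (1 + t.+1 * (2 * (size x + t.+1) + 4)) (@init M x) = Some cf &
    @tm_acc M (cf_state cf) = b.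
Proof.
move=> hB hc; have K0 : 0 < K by apply: leq_ltn_trans hB.
(* The added pop sends a true bit to [n.+1], which is [size p], and everything else to [n.+2]; the
   machine halts at either. *)
pose n := csize c; pose p := comp c 0 ++ [:: IPop B n.+2 n.+2 n.+1].
have sp : size p = n.+1 by rewrite size_cat size_comp addn1.
have pK pc : is_true (match onth p pc with
  | Some (IPush s _) => s < K
  | Some (IPop s ln lf lt) =>
      [&& s < K, ln <= (size p).+1, lf <= (size p).+1 & lt <= (size p).+1]
  | Some (IJmp l) => l <= (size p).+1
  | None => true
  end).
  have : all (good_instr K n.+2) p.
    by rewrite all_cat good_comp //= ?hB ?leqnn //= ?leqnSn // add0n; lia.
  rewrite sp; case E : (onth p pc) => [ins|//].
  by move/all_onth => /(_ _ _ E); case: ins {E}.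
exists (machine p K) => x t st b l hrun hb.
have [c0 h0 [g hg hr]] := init_home p K0 x.
have r1 : ireach p t (0, input_store x) (n, st).
  have := run_comp (p := p) hrun (a := 0); rewrite add0n; apply.
  by exists [::], [:: IPop B n.+2 n.+2 n.+1].
have hn : onth p n = Some (IPop B n.+2 n.+2 n.+1).
  by have := onth_mid (comp c 0) [::] (IPop B n.+2 n.+2 n.+1); rewrite size_comp.
have r2 : ireach p t.+1 (0, input_store x) (if b then n.+1 else n.+2, upd st B l).
  rewrite -addn1; apply: ireach_trans r1 (ireach1 _).
  by rewrite /istep /= hn hb; case: (b).
have hsz i : size (input_store x i) <= size x.
  by rewrite /input_store; case: eqP => //; rewrite size_rev.
have [k [c1 [g1 [h1 h2 [h3 h4 h5 h6] _]]]] := @simulate p K K0 pK _ _ _ _ _ r2 _ _ _ hr hg hsz.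
have hpc : (if b then n.+1 else n.+2) <= (size p).+1 by rewrite sp; case: (b).
exists c1; last by rewrite /= h3 (mkqE K0 hpc) // sp; case: (b); rewrite ?eqxx // gtn_eqF.
apply: (@exec_msteps _ _ (1 + k) _ c1); last by rewrite leq_add2l.
  exact: msteps_step h0 h1.
have hd : delta (mkq p (if b then n.+1 else n.+2) 1) (g1 0) = None.
  rewrite (deltaE K0 _ hpc) //; have -> // : onth p (if b then n.+1 else n.+2) = None.
  by apply: onth_default; rewrite sp; case: (b).
by rewrite /step /= h3 h5 hd.
Qed.

(** * A language with bounded quantifiers *)

(* An address is a sum of atoms: n * n, x * n, n, x and 1, where x is a
   variable given by its binding level. *)
Inductive atom := AN2 | AVN of nat | AN | AV of nat | A1.

(** Evaluation has side effects. [Nand] evaluates both arguments and [Ex] runs through all [n]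
    values without stopping early, so they also act as sequencing and as a loop around [Put]. *)
Inductive term :=
  | Get of seq atom | Cst of bool | Nand of term & term | Ex of term
  | Put of seq atom & term.

Definition memory := nat -> bool.

Definition atom_value n (env : seq nat) a := match a with
  | AN2 => n * n | AVN x => nth 0 env x * n | AN => n | AV x => nth 0 env x
  | A1 => 1 end.
Definition address n env l := sumn (map (atom_value n env) l).

Fixpoint sem n (env : seq nat) (m : memory) (t : term) : memory * bool :=
  match t with
  | Get a => (m, m (address n env a))
  | Cst b => (m, b)
  | Nand t1 t2 =>
      let r1 := sem n env m t1 in let r2 := sem n env r1.1 t2 in
      (r2.1, ~~ (r1.2 && r2.2))
  | Ex t1 =>
      foldl (fun r v => let r1 := sem n (rcons env v) r.1 t1 in
               (r1.1, r.2 || r1.2)) (m, false) (iota 0 n)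
  | Put a t1 =>
      let r1 := sem n env m t1 in (upd r1.1 (address n env a) r1.2, r1.2)
  end.

Definition sMem := 1.
Definition sAux := 2.
Definition sN1 := 3.
Definition sN2 := 4.
Definition sT1 := 5.
Definition sT2 := 6.
Definition sB := 7.
Definition sV d := 8 + d.*2.
Definition sC d := 9 + d.*2.

Definition rep s tmp c :=
  Seq (Loop s true Skip (Seq (Push tmp true) c)) (Loop tmp true Skip (Push s true)).
Definition adv := Pop sMem (Push sAux false) (Push sAux false) (Push sAux true).
Definition atom_code a := match a with
  | AN2 => rep sN1 sT1 (rep sN2 sT2 adv)
  | AVN x => rep (sV x) sT1 (rep sN1 sT2 adv)
  | AN => rep sN1 sT1 adv
  | AV x => rep (sV x) sT1 adv
  | A1 => adv
  end.
Definition seek l := foldr (fun a c => Seq (atom_code a) c) Skip l.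
Definition restore := Loop sAux true (Push sMem false) (Push sMem true).
Definition push2 b := Seq (Push sMem b) (Push sB b).
Fixpoint compile d t := match t with
  | Get a => Seq (seek a)
      (Seq (Pop sMem (push2 false) (push2 false) (push2 true)) restore)
  | Cst b => Push sB b
  | Nand t1 t2 => Seq (compile d t1) (Seq (compile d t2)
      (Pop sB Skip (Pop sB Skip (Push sB true) (Push sB true))
                   (Pop sB Skip (Push sB true) (Push sB false))))
  | Ex t1 => Seq (Push sB false) (Seq (rep sN1 sT1 (Push (sC d) true))
      (Seq (Loop (sC d) true Skip
             (Seq (compile d.+1 t1)
               (Seq (Pop sB Skip Skip (Pop sB Skip (Push sB true) (Push sB true)))
                    (Push (sV d) true))))
           (Loop (sV d) true Skip Skip)))
  | Put a t1 => Seq (compile d t1) (Seq (seek a) (Seq (Pop sMem Skip Skip Skip)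
      (Seq (Pop sB Skip (push2 false) (push2 true)) restore)))
  end.

(** * Correctness of compiled terms *)

Lemma upd_eq A (st : nat -> A) s l : upd st s l s = l.
Proof. by rewrite /upd eqxx. Qed.
Lemma upd_neq A (st : nat -> A) s l j : j != s -> upd st s l j = st j.
Proof. by rewrite /upd => /negbTE->. Qed.

Lemma run_pushE s b (st : store) l : st s = l -> run (Push s b) st 1 (upd st s (b :: l)).
Proof. by move=> <-; exact: run_push. Qed.

Definition agree (X : seq nat) (st st' : store) := forall j, j \notin X -> st' j = st j.

(** The set [X] contains the stacks that [c] may change, and the invariant depends on these alone,
    so moving entries from [s] to [tmp] cannot disturb it. *)
Lemma loop_up s tmp c k q X (Inv : nat -> store -> Prop) (st0 : store) :
  s != tmp -> s \notin X -> tmp \notin X ->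
  (forall i st1 st2, (forall j, j \in X -> st2 j = st1 j) -> Inv i st1 -> Inv i st2) ->
  (forall i st1, i < k -> agree [:: s, tmp & X] st0 st1 -> Inv i st1 ->
     exists t st2, [/\ run c st1 t st2, t <= q, agree X st1 st2 & Inv i.+1 st2]) ->
  forall m i st l, m + i = k -> agree [:: s, tmp & X] st0 st -> Inv i st ->
  st s = nseq m true -> st tmp = l ->
  exists t st', [/\ run (Loop s true Skip (Seq (Push tmp true) c)) st t st',
    t <= m * (q + 3) + 1, agree [:: s, tmp & X] st0 st', Inv k st' &
    st' s = [::] /\ st' tmp = nseq m true ++ l].
Proof.
move=> nst sX tX Iext hstep; elim=> [|m IH] i st l hk ha hI hs ht.
  rewrite add0n in hk; rewrite -hk; exists 1, st; split => //; exact: run_loopN.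
pose st1 := upd (upd st s (nseq m true)) tmp (true :: l).
have agr j : j \notin [:: s, tmp & X] -> st1 j = st j.
  by rewrite !inE => /norP[h1 /norP[h2 h3]]; rewrite /st1 !upd_neq.
have [||| t1 [st2 [r1 q1 a2 I2]]] := hstep i st1; first by lia.
- by move=> j hj; rewrite agr // ha.
- apply: Iext hI => j hj; have js : j != s by apply: contraNneq sX => <-.
  have jt : j != tmp by apply: contraNneq tX => <-.
  by rewrite /st1 !upd_neq.
have [||||| t2 [st3 [r2 q2 a3 I3 [e1 e2]]]] := IH i.+1 st2 (true :: l).
- by rewrite addnS -addSn.
- move=> j hj; rewrite a2; first by rewrite agr // ha.
  by move: hj; rewrite !inE => /norP[_ /norP[_]].
- exact: I2.
- by rewrite a2 // /st1 upd_neq // upd_eq.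
- by rewrite a2 // /st1 upd_eq.
exists ((1 + t1) + t2 + 2), st3; split => //.
- apply: run_loopT r2; first by rewrite hs.
  apply: run_seq; first exact: run_push.
  by rewrite upd_neq 1?eq_sym // ht.
- by rewrite mulSn; lia.
- by split => //; rewrite e2; elim: (m) => //= m' ->.
Qed.

Lemma loop_down s tmp m st : s != tmp -> st tmp = nseq m true ->
  exists t st', [/\ run (Loop tmp true Skip (Push s true)) st t st', t <= m * 3 + 1,
    agree [:: s; tmp] st st' & st' tmp = [::] /\ st' s = nseq m true ++ st s].
Proof.
move=> nst; elim: m st => [|m IH] st ht.
  by exists 1, st; split => //; apply: run_loopN.
have [|t [st2 [r q a [e1 e2]]]] := IH (upd (upd st tmp (nseq m true)) s (true :: st s)).
  by rewrite upd_neq 1?eq_sym // upd_eq.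
exists (1 + t + 2), st2; split => //.
- apply: run_loopT r; first by rewrite ht.
  by apply: run_pushE; rewrite upd_neq.
- by rewrite mulSn; lia.
- move=> j hj; rewrite a // ; move: hj; rewrite !inE => /norP[h1 h2].
  by rewrite !upd_neq.
- by rewrite e2 upd_eq; split => //; elim: (m) => //= m' ->.
Qed.

Lemma run_rep s tmp c k q X (Inv : nat -> store -> Prop) (st : store) :
  s != tmp -> s \notin X -> tmp \notin X ->
  (forall i st1 st2, (forall j, j \in X -> st2 j = st1 j) -> Inv i st1 -> Inv i st2) ->
  (forall i st1, i < k -> agree [:: s, tmp & X] st st1 -> Inv i st1 ->
     exists t st2, [/\ run c st1 t st2, t <= q, agree X st1 st2 & Inv i.+1 st2]) ->
  st s = nseq k true -> st tmp = [::] -> Inv 0 st ->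
  exists t st', [/\ run (rep s tmp c) st t st', t <= k * (q + 6) + 2, agree X st st'
    & Inv k st'].
Proof.
move=> nst sX tX Iext hstep hs ht hI.
have [t1 [st1 [r1 q1 a1 I1 [e1 e2]]]] := @loop_up s tmp c k q X Inv st nst sX tX
  Iext hstep k 0 st [::] (addn0 k) (fun _ _ => erefl) hI hs ht.
have e3 : st1 tmp = nseq k true by rewrite e2 cats0.
have [t2 [st2 [r2 q2 a2 [e4 e5]]]] := loop_down nst e3.
exists (t1 + t2), st2; split.
- exact: run_seq r1 r2.
- by rewrite !mulnDr in q1 q2 *; lia.
- move=> j hj; case: (j =P s) => [->|/eqP js]; first by rewrite e5 e1 cats0 hs.
  case: (j =P tmp) => [->|/eqP jt]; first by rewrite e4 ht.
  by rewrite a2 ?a1 // !inE ?negb_or ?js ?jt.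
- apply: Iext I1 => j hj; rewrite a2 // !inE negb_or.
  by apply/andP; split; [apply: contraNneq sX => <-|apply: contraNneq tX => <-].
Qed.

Definition memrep (m : memory) (st : store) :=
  forall i, nth false (rev (st sAux) ++ st sMem) i = m i.

Lemma adv_spec m st : memrep m st -> exists t st', [/\ run adv st t st', t <= 3,
  agree [:: sMem; sAux] st st', memrep m st' & size (st' sAux) = size (st sAux) + 1].
Proof.
move=> hm; have agr l b st1 : agree [:: sMem; sAux] st (upd (upd st sMem l) sAux (b :: st1)).
  by move=> j; rewrite !inE => /norP[h1 h2]; rewrite !upd_neq.
case E : (st sMem) => [|b l].
  exists 3, (upd st sAux (false :: st sAux)); split => //.
  - exact: run_popN E (run_push _ _ _).
  - by move=> j; rewrite !inE => /norP[h1 h2]; rewrite upd_neq.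
  - move=> i; rewrite upd_eq upd_neq // E -hm E !cats0 rev_cons nth_rcons.
    by case: ltngtP => // h; rewrite nth_default ?h // ltnW.
  - by rewrite upd_eq addn1.
have hm' : memrep m (upd (upd st sMem l) sAux (b :: st sAux)).
  by move=> i; rewrite upd_eq upd_neq // upd_eq -hm E rev_cons cat_rcons.
have r1 b' : run (Push sAux b') (upd st sMem l) 1 (upd (upd st sMem l) sAux (b' :: st sAux)).
  by apply: run_pushE; rewrite upd_neq.
by exists (if b then 2 else 3), (upd (upd st sMem l) sAux (b :: st sAux)); split => //;
  [case: b E hm' => E hm'; [exact: run_popT E (r1 _)|exact: run_popF E (r1 _)]
  | case: (b) | rewrite upd_eq addn1].
Qed.

Lemma rep_moves s tmp c k q w m st : s != tmp -> s \notin [:: sMem; sAux] ->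
  tmp \notin [:: sMem; sAux] -> st s = nseq k true -> st tmp = [::] -> memrep m st ->
  (forall st1, agree [:: s; tmp; sMem; sAux] st st1 -> memrep m st1 ->
    exists t st2, [/\ run c st1 t st2, t <= q, agree [:: sMem; sAux] st1 st2,
      memrep m st2 & size (st2 sAux) = size (st1 sAux) + w]) ->
  exists t st', [/\ run (rep s tmp c) st t st', t <= k * (q + 6) + 2,
    agree [:: sMem; sAux] st st', memrep m st'
    & size (st' sAux) = size (st sAux) + k * w].
Proof.
move=> nst sX tX hs ht hm hc.
have [||| t [st' [r1 q1 a1 [i1 i2]]]] := @run_rep s tmp c k q [:: sMem; sAux]
  (fun i st1 => memrep m st1 /\ size (st1 sAux) = size (st sAux) + i * w) st
  nst sX tX _ _ hs ht.
- move=> i st1 st2 h [h1 h2]; rewrite /memrep !h ?inE ?eqxx ?orbT //.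
- move=> i st1 _ ha [h1 h2]; have [t [st2 [r1 q1 a1 m1 e1]]] := hc st1 ha h1.
  by exists t, st2; split => //; split => //; rewrite e1 h2 mulSn; lia.
- by rewrite mul0n addn0.
by exists t, st'.
Qed.

Definition base n env (st : store) :=
  [/\ st sN1 = nseq n true, st sN2 = nseq n true, st sT1 = [::], st sT2 = [::]
    & forall d, st (sV d) = nseq (nth 0 env d) true].

Lemma base_agree n env st st' : agree [:: sMem; sAux; sB] st st' ->
  base n env st -> base n env st'.
Proof.
move=> h [h1 h2 h3 h4 h5]; split; first [by rewrite h | by move=> d; rewrite h].
Qed.

Lemma atom_spec n env m a st : all (fun v => v <= n) env -> base n env st -> memrep m st ->
  exists t st', [/\ run (atom_code a) st t st', t <= 9 * n.+1 ^ 2,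
    agree [:: sMem; sAux] st st', memrep m st'
    & size (st' sAux) = size (st sAux) + atom_value n env a].
Proof.
move=> henv [h1 h2 h3 h4 h5] hm.
have hx x : nth 0 env x <= n.
  case: (ltnP x (size env)) => hx; last by rewrite nth_default.
  by move/all_nthP: henv => /(_ 0 x hx).
have vV x : (sV x != sT1) /\ (sV x \notin [:: sMem; sAux]) by rewrite !inE /sV /sMem /sAux /sT1; lia.
have inner st1 s : s = sN1 \/ s = sN2 -> st1 s = nseq n true -> st1 sT2 = [::] ->  memrep m st1 ->
   exists t st2, [/\ run (rep s sT2 adv) st1 t st2, t <= n * (3 + 6) + 2,
    agree [:: sMem; sAux] st1 st2, memrep m st2
    & size (st2 sAux) = size (st1 sAux) + n * 1].
  move=> hs e1 e2 hm1; apply: rep_moves => //; try by case: hs => ->.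
  by move=> *; apply: adv_spec.
have fin B B' : B <= B' ->
   (exists t st', [/\ run (atom_code a) st t st', t <= B,
    agree [:: sMem; sAux] st st', memrep m st'
    & size (st' sAux) = size (st sAux) + atom_value n env a]) ->
   exists t st', [/\ run (atom_code a) st t st', t <= B',
    agree [:: sMem; sAux] st st', memrep m st'
    & size (st' sAux) = size (st sAux) + atom_value n env a].
  by move=> hB [t [st' [a1 a2 a3 a4 a5]]]; exists t, st'; split => //; exact: leq_trans hB.
have bnd k : k <= n -> k * ((n * (3 + 6) + 2) + 6) + 2 <= 9 * n.+1 ^ 2.
  by move=> hk; rewrite expnS expn1; nia.
have bnd1 k : k <= n -> k * (3 + 6) + 2 <= 9 * n.+1 ^ 2.
  by move=> hk; rewrite expnS expn1; nia.
case: a fin => [|x||x|] fin.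
- apply: (fin _ _ (bnd n (leqnn n))); apply: rep_moves => //.
  move=> st1 ag hm1; have := inner st1 sN2; rewrite muln1; apply => //; first by right.
    by rewrite ag.
  by rewrite ag.
- have [v1 v2] := vV x.
  apply: (fin _ _ (bnd _ (hx x))); apply: rep_moves => //.
  move=> st1 ag hm1; have := inner st1 sN1; rewrite muln1; apply => //; first by left.
    by rewrite ag // !inE /sN1 /sV /sT1 /sMem /sAux; lia.
  by rewrite ag // !inE /sN1 /sV /sT1 /sMem /sAux /sT2; lia.
- apply: (fin _ _ (bnd1 n (leqnn n))).
  rewrite -[atom_value _ _ _]muln1; apply: rep_moves => //; by move=> *; apply: adv_spec.
- have [v1 v2] := vV x; apply: (fin _ _ (bnd1 _ (hx x))).
  rewrite -[atom_value _ _ _]muln1; apply: rep_moves => //; by move=> *; apply: adv_spec.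
- by apply: (fin 3 _ _ (adv_spec hm)); rewrite expnS expn1; nia.
Qed.

Lemma seek_spec n env m l st : all (fun v => v <= n) env -> base n env st -> memrep m st ->
  exists t st', [/\ run (seek l) st t st', t <= size l * (9 * n.+1 ^ 2),
    agree [:: sMem; sAux] st st', memrep m st'
    & size (st' sAux) = size (st sAux) + address n env l].
Proof.
move=> henv; elim: l st => [|a l IH] st hb hm.
  by exists 0, st; split => //; [exact: run_skip | rewrite addn0].
have [t1 [st1 [r1 q1 a1 m1 e1]]] := atom_spec a henv hb hm.
have hb1 : base n env st1.
  apply: base_agree hb => j hj; apply: a1; move: hj; rewrite !inE; lia.
have [t2 [st2 [r2 q2 a2 m2 e2]]] := IH st1 hb1 m1.
exists (t1 + t2), st2; split => //.
- exact: run_seq r1 r2.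
- by rewrite /= mulSn leq_add.
- by move=> j hj; rewrite a2 ?a1.
- by rewrite e2 e1 /address /= addnA.
Qed.

Lemma move_spec s s' st : s != s' -> exists k st',
  [/\ run (Loop s true (Push s' false) (Push s' true)) st k st',
  k <= size (st s) * 3 + 1, agree [:: s; s'] st st', st' s = [::] &
  st' s' = rev (st s) ++ st s'].
Proof.
move=> nss; have nss' : s' != s by rewrite eq_sym.
move E : (st s) => l; elim: l st E => [|b l IH] st E.
  by exists 1, st; split => //; exact: run_loopN.
pose st1 := upd (upd st s l) s' (b :: st s').
have [|k [st2 [r q a e1 e2]]] := IH st1.
  by rewrite /st1 upd_neq // upd_eq.
have r1 b' : run (Push s' b') (upd st s l) 1 (upd (upd st s l) s' (b' :: st s')).
  by apply: run_pushE; rewrite upd_neq.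
exists (1 + k + 2), st2; split => //.
- move: r; rewrite /st1; clear -E r1; case: b E => E r;
    [exact (run_loopT E (r1 true) r) | exact (run_loopF E (r1 false) r)].
- by rewrite /= mulSn; lia.
- by move=> j hj; rewrite a // /st1; move: hj; rewrite !inE => /norP[h1 h2]; rewrite !upd_neq.
- by rewrite e2 /st1 upd_eq rev_cons cat_rcons.
Qed.

Lemma restore_spec m st : memrep m st -> exists t st', [/\ run restore st t st',
  t <= size (st sAux) * 3 + 1, agree [:: sMem; sAux] st st',
  st' sAux = [::] & forall i, nth false (st' sMem) i = m i].
Proof.
move=> hm; have [k [st' [r q a e1 e2]]] := @move_spec sAux sMem st isT.
exists k, st'; split => // [j hj|i]; last by rewrite e2 hm.
by apply: a; move: hj; rewrite !inE orbC.
Qed.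

(** Only the counters of levels not yet opened are empty; those of enclosing loops are in use, and
    [counters] states that they are preserved. *)
Definition full n env (m : memory) B (st : store) :=
  [/\ base n env st, st sAux = [::], forall i, nth false (st sMem) i = m i,
      st sB = B & forall d, size env <= d -> st (sC d) = [::]].

Fixpoint cost n t := match t with
  | Get a => size a * (12 * n.+1 ^ 2) + 12
  | Cst _ => 1
  | Nand t1 t2 => cost n t1 + cost n t2 + 8
  | Ex t1 => n * (cost n t1 + 24) + 12
  | Put a t1 => cost n t1 + size a * (12 * n.+1 ^ 2) + 24
  end.

Lemma address_le n env l : all (fun v => v <= n) env -> address n env l <= size l * n.+1 ^ 2.
Proof.
move=> henv; have hx x : nth 0 env x <= n.
  case: (ltnP x (size env)) => hx; last by rewrite nth_default.
  by move/all_nthP: henv => /(_ 0 x hx).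
elim: l => //= a l IH; rewrite /address /= mulSn leq_add //.
by case: a => [|x||x|] /=; rewrite ?expnS ?expn1; try have := hx x; nia.
Qed.

Lemma loop_clear s m st : st s = nseq m true -> exists t st',
  [/\ run (Loop s true Skip Skip) st t st', t <= m * 2 + 1, agree [:: s] st st'
    & st' s = [::]].
Proof.
elim: m st => [|m IH] st hs; first by exists 1, st; split => //; apply: run_loopN.
have [|t [st' [r q a e]]] := IH (upd st s (nseq m true)); first by rewrite upd_eq.
exists (0 + t + 2), st'; split => //.
- by apply: run_loopT r; [rewrite hs | exact: run_skip].
- by rewrite mulSn; lia.
- by move=> j hj; rewrite a // upd_neq //; move: hj; rewrite inE.
Qed.

Lemma read_spec m B st : memrep m st -> st sB = B ->
  exists t st', [/\ run (Pop sMem (push2 false) (push2 false) (push2 true)) st t st',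
    t <= 4, agree [:: sMem; sB] st st', memrep m st' & st' sB = m (size (st sAux)) :: B].
Proof.
move=> hm hB.
have p2 b st1 : st1 sB = B -> run (push2 b) st1 2 (upd (upd st1 sMem (b :: st1 sMem)) sB (b :: B)).
  move=> h; apply: (run_seq (t1 := 1) (t2 := 1)); first exact: run_push.
  by apply: run_pushE; rewrite upd_neq.
have hn l : m (size (st sAux)) = nth false (rev (st sAux) ++ l) (size (st sAux)) ->
  m (size (st sAux)) = nth false l 0 by rewrite nth_cat size_rev ltnn subnn.
case E : (st sMem) => [|b l].
  have mb : m (size (st sAux)) = false by rewrite (hn [::]) // -hm E.
  eexists _, _; split; first exact: run_popN E (p2 _ _ hB).
  - by [].
  - by move=> j; rewrite !inE => /norP[h1 h2]; rewrite !upd_neq.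
  - move=> i; rewrite !(upd_eq, upd_neq) // E -hm E cats0 nth_cat.
    case: ltnP => // h; rewrite [RHS]nth_default //.
    by case: (i - _) => [|[|]].
  - by rewrite upd_eq mb.
have mb : m (size (st sAux)) = b by rewrite (hn (b :: l)) // -hm E.
have hB1 : upd st sMem l sB = B by rewrite upd_neq.
pose st' := upd (upd (upd st sMem l) sMem (b :: l)) sB (b :: B).
have r := p2 b _ hB1; rewrite upd_eq in r.
exists (if b then 3 else 4), st'; split.
- case: b E mb @st' r => E _ /= r; [exact (run_popT _ _ E r) | exact (run_popF _ _ E r)].
- by case: (b).
- by move=> j; rewrite !inE => /norP[h1 h2]; rewrite /st' !upd_neq.
- by move=> i; rewrite /st' !(upd_eq, upd_neq) // -hm E.
- by rewrite /st' upd_eq mb.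
Qed.

Lemma write_spec m b B st : memrep m st -> st sB = b :: B ->
  exists t st', [/\ run (Seq (Pop sMem Skip Skip Skip)
      (Pop sB Skip (push2 false) (push2 true))) st t st',
    t <= 6, agree [:: sMem; sB] st st', memrep (upd m (size (st sAux)) b) st'
    & st' sB = b :: B].
Proof.
move=> hm hB.
have [t1 [st1 [r1 q1 a1 e1]]] : exists t1 st1, [/\ run (Pop sMem Skip Skip Skip) st t1 st1,
    t1 <= 2, agree [:: sMem] st st1 & st1 sMem = behead (st sMem)].
  case E : (st sMem) => [|c l].
    by exists 2, st; split => //; exact: run_popN E (run_skip _).
  exists (if c then 1 else 2), (upd st sMem l); split.
  - by case: c E => E; [exact: run_popT E (run_skip _) | exact: run_popF E (run_skip _)].
  - by case: c {E}.
  - by move=> j; rewrite inE => h; rewrite upd_neq.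
  - by rewrite upd_eq.
have hB1 : st1 sB = b :: B by rewrite a1.
pose st2 := upd (upd (upd st1 sB B) sMem (b :: st1 sMem)) sB (b :: B).
have r2 : run (push2 b) (upd st1 sB B) 2 st2.
  apply: (run_seq (t1 := 1) (t2 := 1)); first by apply: run_pushE; rewrite upd_neq.
  by apply: run_pushE; rewrite upd_neq // upd_eq.
exists (t1 + (if b then 3 else 4)), st2; split.
- apply: run_seq r1 _; case: b hB hB1 @st2 r2 => _ hB1 /= r2;
   [exact (run_popT _ _ hB1 r2) | exact (run_popF _ _ hB1 r2)].
- by case: (b); lia.
- by move=> j; rewrite !inE => /norP[h1 h2]; rewrite /st2 !upd_neq // a1 // inE.
- have E1 : st2 sAux = st sAux by rewrite /st2 !upd_neq ?a1.
  have E2 : st2 sMem = b :: behead (st sMem) by rewrite /st2 upd_neq // upd_eq e1.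
  move=> i; rewrite E1 E2 /upd nth_cat size_rev.
  case: (ltngtP i (size (st sAux))) => h.
  + by rewrite -hm nth_cat size_rev h.
  + rewrite -hm nth_cat size_rev ltnNge ltnW //=.
    have -> : i - size (st sAux) = (i - size (st sAux)).-1.+1 by lia.
    by rewrite /= nth_behead.
  + by rewrite h subnn.
- by rewrite /st2 upd_eq.
Qed.

Lemma full_agree n env m B st st' m' B' : full n env m B st ->
  agree [:: sMem; sAux; sB] st st' -> st' sAux = [::] ->
  (forall i, nth false (st' sMem) i = m' i) -> st' sB = B' -> full n env m' B' st'.
Proof.
case=> h1 h2 h3 h4 h5 a e1 e2 e3; split => //; first exact: base_agree a h1.
by move=> d hd; rewrite a // h5.
Qed.

Lemma memrep_full m st : st sAux = [::] -> (forall i, nth false (st sMem) i = m i) ->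
  memrep m st.
Proof. by move=> e h i; rewrite e /= h. Qed.

Definition counters (st st' : store) := forall d, st' (sC d) = st (sC d).

Lemma full_ext n env m B st st' env' : full n env m B st ->
  (forall j, j < 8 -> st' j = st j) ->
  (forall d, st' (sV d) = nseq (nth 0 env' d) true) ->
  (forall d, size env' <= d -> st' (sC d) = [::]) -> full n env' m B st'.
Proof.
case=> [[h1 h2 h3 h4 h5] h6 h7 h8 h9] e1 e2 e3.
split => //; rewrite ?e1 //; first by split; rewrite ?e1.
Qed.

Definition ex_body d t1 := Seq (compile d.+1 t1)
  (Seq (Pop sB Skip Skip (Pop sB Skip (Push sB true) (Push sB true))) (Push (sV d) true)).

Definition ex_step n env t (r : memory * bool) v :=
  let r1 := sem n (rcons env v) r.1 t in (r1.1, r.2 || r1.2).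

Lemma or_code b c B st : st sB = c :: b :: B -> exists k st', [/\
  run (Pop sB Skip Skip (Pop sB Skip (Push sB true) (Push sB true))) st k st', k <= 5,
  agree [:: sB] st st' & st' sB = (b || c) :: B].
Proof.
move=> h; case: c h => h.
  exists (if b then 3 else 4), (upd (upd (upd st sB (b :: B)) sB B) sB (true :: B)); split.
  - have hB : upd st sB (b :: B) sB = b :: B by rewrite upd_eq.
    have hp : run (Push sB true) (upd (upd st sB (b :: B)) sB B) 1
      (upd (upd (upd st sB (b :: B)) sB B) sB (true :: B)) by apply: run_pushE; rewrite upd_eq.
    by case: b h hB hp => h hB hp; [exact (run_popT _ _ h (run_popT _ _ hB hp))
       | exact (run_popT _ _ h (run_popF _ _ hB hp))].
  - by case: (b).
  - by move=> j; rewrite inE => hj; rewrite !upd_neq.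
  - by rewrite upd_eq orbT.
exists 2, (upd st sB (b :: B)); split => //.
- exact (run_popF _ _ h (run_skip _)).
- by move=> j; rewrite inE => hj; rewrite upd_neq.
- by rewrite upd_eq orbF.
Qed.

Section Body.
Variables (n : nat) (env : seq nat) (t1 : term).
Hypothesis henv : all (fun v => v <= n) env.
Hypothesis IH : forall env m B st, full n env m B st -> all (fun v => v <= n) env ->
  exists k st', [/\ run (compile (size env) t1) st k st', k <= cost n t1,
    full n env (sem n env m t1).1 ((sem n env m t1).2 :: B) st' & counters st st'].
Let d := size env.

(** The lengths of [sV d] and [sC d] always add up to [n]. At the end [sV d] has length [n], hence
    the environment [rcons env n]; the stack is cleared afterwards. *)
Lemma ex_loop k j m b B st : k + j = n -> full n (rcons env j) m (b :: B) st ->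
  st (sC d) = nseq k true ->
  exists T st', [/\ run (Loop (sC d) true Skip (ex_body d t1)) st T st',
    T <= k * (cost n t1 + 8) + 1,
    full n (rcons env n) (foldl (ex_step n env t1) (m, b) (iota j k)).1
       ((foldl (ex_step n env t1) (m, b) (iota j k)).2 :: B) st',
    st' (sC d) = [::] & forall d', d' != d -> st' (sC d') = st (sC d')].
Proof.
elim: k j m b st => [|k IHk] j m b st hk hf hc.
  rewrite add0n in hk; subst j; exists 1, st; split => //; exact: run_loopN.
pose st1 := upd st (sC d) (nseq k true).
have f1 : full n (rcons env j) m (b :: B) st1.
  have [[? ? ? ? h5] ? ? ? h9] := hf.
  apply: (full_ext hf) => [i hi|d'|d' hd].
  - by rewrite /st1 upd_neq // /sC; lia.
  - by rewrite /st1 upd_neq ?h5 // /sC /sV; lia.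
  - by rewrite /st1 upd_neq ?h9 // /sC; move: hd; rewrite size_rcons /d; lia.
have hj : all (fun v => v <= n) (rcons env j).
  by rewrite all_rcons henv andbT; lia.
have [k1 [st2 [r1 q1 f2 c2]]] := IH f1 hj; rewrite size_rcons -/d in r1.
set s1 := sem n (rcons env j) m t1 in f2.
have [[? ? ? ? g5] ? ? g8 g9] := f2.
have [k2 [st3 [r2 q2 a3 e3]]] := or_code g8.
pose st4 := upd st3 (sV d) (true :: st3 (sV d)).
have r4 : run (Push (sV d) true) st3 1 st4 by exact: run_push.
have f4 : full n (rcons env j.+1) s1.1 ((b || s1.2) :: B) st4.
  have f3 : full n (rcons env j) s1.1 ((b || s1.2) :: B) st3.
    have [? h6 h7 ? ?] := f2; apply: (full_agree f2) => //.
    - by move=> i hi; apply: a3; move: hi; rewrite !inE => /norP[_ /norP[_]].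
    - by rewrite a3.
    - by move=> i; rewrite a3.
  have [[? ? ? ? h5] ? ? ? h9] := f3.
  apply: (full_ext f3) => [i hi|d'|d' hd].
  - by rewrite /st4 upd_neq // /sV; lia.
  - rewrite /st4 /upd; case: eqP => [h|h].
      have -> : d' = d by move: h; rewrite /sV; lia.
      by rewrite h5 !nth_rcons ltnn eqxx.
    rewrite h5 !nth_rcons; case: ltngtP => // h'; by rewrite h' in h.
  - by rewrite /st4 upd_neq ?h9 // ?size_rcons -1?(size_rcons env j.+1) // /sC /sV; lia.
have c4 d' : st4 (sC d') = st1 (sC d').
  rewrite /st4 upd_neq; last by rewrite /sC /sV; lia.
  by rewrite a3 ?c2 // inE /sC /sB; lia.
have [|||T [st' [r5 q5 f5 e5 c5]]] := IHk j.+1 s1.1 (b || s1.2) st4.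
- by lia.
- exact: f4.
- by rewrite c4 /st1 upd_eq.
exists ((k1 + (k2 + 1)) + T + 2), st'; split => //.
- apply: run_loopT r5; first by rewrite hc.
  exact: run_seq r1 (run_seq r2 r4).
- by rewrite mulSn; lia.
- by move=> d' hd; rewrite c5 // c4 /st1 upd_neq // /sC; lia.
Qed.

Lemma ex_spec m B st : full n env m B st ->
  exists k st', [/\ run (compile d (Ex t1)) st k st', k <= cost n (Ex t1),
    full n env (sem n env m (Ex t1)).1 ((sem n env m (Ex t1)).2 :: B) st' & counters st st'].
Proof.
move=> hf; have [[h1 h2 h3 h4 h5] h6 h7 h8 h9] := hf.
pose st1 := upd st sB (false :: B).
have r1 : run (Push sB false) st 1 st1 by apply: run_pushE.
have vd : st (sV d) = [::] by rewrite h5 nth_default.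
have nd : (sN1 \notin [:: sC d]) /\ (sT1 \notin [:: sC d]) by rewrite !inE /sC /sN1 /sT1; lia.
have [||||| k2 [st2 [r2 q2 a2 e2]]] := @run_rep sN1 sT1 (Push (sC d) true) n 1 [:: sC d]
  (fun i st => st (sC d) = nseq i true) st1 isT nd.1 nd.2.
- by move=> i s s' hs <-; apply: hs; rewrite inE.
- move=> i s _ _ hs; exists 1, (upd s (sC d) (true :: s (sC d))); split => //.
  + exact: run_push.
  + by move=> j; rewrite inE => hj; rewrite upd_neq.
  + by rewrite upd_eq hs.
- by rewrite /st1 upd_neq.
- by rewrite /st1 upd_neq.
- by rewrite /st1 upd_neq ?h9 // /sC /sB; lia.
have hd j : j != sB -> j != sC d -> st2 j = st j.
  by move=> j1 j2; rewrite a2 ?inE // /st1 upd_neq.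
(* An empty value stack represents the value 0, so nothing has to be done to open the quantifier. *)
have f2 : full n (rcons env 0) m (false :: B) st2.
  have f1 : full n env m (false :: B) st1.
    apply: (full_agree hf); last by rewrite /st1 upd_eq.
    - by move=> j; rewrite !inE => /norP[_ /norP[_ h]]; rewrite /st1 upd_neq.
    - by rewrite /st1 upd_neq.
    - by move=> i; rewrite /st1 upd_neq.
  apply: (full_ext f1) => [i hi|d'|d' hd'].
  - by rewrite a2 // inE /sC; lia.
  - rewrite hd ?h5 /sV /sC /sB; try lia.
    rewrite nth_rcons; case: (ltnP d' (size env)) => // h.
    by rewrite nth_default //; case: eqP.
  - rewrite hd ?h9 //; move: hd'; rewrite size_rcons /sC /sB /d; lia.
have [T [st3 [r3 q3 f3 e3 c3]]] := ex_loop (addn0 n) f2 e2.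
have [[g1 g2 g3 g4 g5] g6 g7 g8 g9] := f3.
have v3 : st3 (sV d) = nseq n true by rewrite g5 nth_rcons ltnn eqxx.
have [k4 [st4 [r4 q4 a4 e4]]] := loop_clear v3.
exists (1 + (k2 + (T + k4))), st4; split.
- exact: run_seq r1 (run_seq r2 (run_seq r3 r4)).
- by rewrite [cost _ _]/=; move: q2 q3 q4; rewrite !mulnDr; lia.
- apply: (full_ext f3) => [i hi|d'|d' hd'].
  + by rewrite a4 // inE /sV; lia.
  + case: (d' =P d) => [->|/eqP dd]; first by rewrite e4 nth_default.
    rewrite a4 ?inE ?g5 ?nth_rcons; last by rewrite /sV; lia.
    by case: ltngtP => // h; [rewrite nth_default // ltnW | rewrite h eqxx in dd].
  + rewrite a4 ?inE; last by rewrite /sC /sV; lia.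
    case: (d' =P d) => [->//|/eqP dd]; apply: g9; rewrite size_rcons; move: dd hd'; rewrite /d; lia.
- move=> d'; rewrite a4 ?inE; last by rewrite /sC /sV; lia.
  case: (d' =P d) => [->|/eqP dd]; first by rewrite e3 h9.
  by rewrite c3 // hd // /sC /sB; lia.
Qed.
End Body.

Lemma compile_spec n t env m B st : full n env m B st -> all (fun v => v <= n) env ->
  exists k st', [/\ run (compile (size env) t) st k st', k <= cost n t,
    full n env (sem n env m t).1 ((sem n env m t).2 :: B) st' & counters st st'].
Proof.
elim: t env m B st => [a|b|t1 IH1 t2 IH2|t1 IH1|a t1 IH1] env m B st hf henv.
- have [h1 h2 h3 h4 h5] := hf.
  have [k1 [st1 [r1 q1 a1 m1 e1]]] := seek_spec a henv h1 (memrep_full h2 h3).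
  have hB1 : st1 sB = B by rewrite a1.
  have [k2 [st2 [r2 q2 a2 m2 e2]]] := read_spec m1 hB1.
  have [k3 [st3 [r3 q3 a3 e3 m3]]] := restore_spec m2.
  exists (k1 + (k2 + k3)), st3.
  have ag : agree [:: sMem; sAux; sB] st st3.
    move=> j; rewrite !inE => /norP[j1 /norP[j2 j3]].
    by rewrite a3 ?a2 ?a1 // !inE ?(negbTE j1) ?(negbTE j2) ?(negbTE j3).
  split; first exact: run_seq r1 (run_seq r2 r3).
  - move: q3; rewrite a2 // e1 h2 add0n => q3.
    have := address_le a henv; rewrite /=; move: q1 q2 q3.
    move: (address _ _ _) (n.+1 ^ 2) (size a) => A N s; nia.
  - apply: full_agree hf ag e3 m3 _.
    by rewrite a3 // e2 e1 h2.
  - by move=> d; rewrite ag.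
- have [h1 h2 h3 h4 h5] := hf.
  exists 1, (upd st sB (b :: B)); split => //; first exact: run_pushE.
- have [k1 [st1 [r1 q1 f1 c1]]] := IH1 _ _ _ _ hf henv.
  have [k2 [st2 [r2 q2 f2 c2]]] := IH2 _ _ _ _ f1 henv.
  rewrite /=; move: f2; set s1 := sem n env m t1; set s2 := sem n env s1.1 t2 => f2.
  have [h1 h2 h3 h4 h5] := f2.
  pose st3 := upd (upd (upd st2 sB (s1.2 :: B)) sB B) sB (~~ (s1.2 && s2.2) :: B).
  have pe st' b : st' sB = B -> run (Push sB b) st' 1 (upd st' sB (b :: B)) by apply: run_pushE.
  have [k3 [r3 q3]] : exists k3, run (Pop sB Skip (Pop sB Skip (Push sB true) (Push sB true))
                   (Pop sB Skip (Push sB true) (Push sB false))) st2 k3 st3 /\ k3 <= 8.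
    have hp b1 b2 b3 : run (Push sB b3) (upd (upd st2 sB (b1 :: b2)) sB B) 1
       (upd (upd (upd st2 sB (b1 :: b2)) sB B) sB (b3 :: B)) by apply: pe; rewrite upd_eq.
    have hu b1 : upd st2 sB (b1 :: B) sB = b1 :: B by rewrite upd_eq.
    rewrite /st3; case: s2.2 h4 => h4; case: s1.2 h4 => h4; eexists; split;
    [ exact (run_popT _ _ h4 (run_popT _ _ (hu _) (hp _ _ _))) | by []
    | exact (run_popT _ _ h4 (run_popF _ _ (hu _) (hp _ _ _))) | by []
    | exact (run_popF _ _ h4 (run_popT _ _ (hu _) (hp _ _ _))) | by []
    | exact (run_popF _ _ h4 (run_popF _ _ (hu _) (hp _ _ _))) | by [] ].
  exists (k1 + (k2 + k3)), st3.
  have ag : agree [:: sB] st2 st3 by move=> j; rewrite inE => h; rewrite /st3 !upd_neq.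
  split; first exact: run_seq r1 (run_seq r2 r3).
  + by rewrite /=; lia.
  + apply: (full_agree f2); last by rewrite /st3 upd_eq.
    * by move=> j; rewrite !inE => /norP[_ /norP[_ h]]; rewrite /st3 !upd_neq.
    * by rewrite /st3 !upd_neq.
    * by move=> i; rewrite /st3 !upd_neq.
  + by move=> d; rewrite ag // c2 c1.
- exact: ex_spec henv IH1 _ _ _ hf.
- have [k1 [st1 [r1 q1 f1 c1]]] := IH1 _ _ _ _ hf henv.
  rewrite /=; move: f1; set s1 := sem n env m t1 => f1; have [h1 h2 h3 h4 h5] := f1.
  have [k2 [st2 [r2 q2 a2 m2 e2]]] := seek_spec a henv h1 (memrep_full h2 h3).
  have hB2 : st2 sB = s1.2 :: B by rewrite a2.
  have [k3 [st3 [r3 q3 a3 m3 e3]]] := write_spec m2 hB2.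
  have [k4 [st4 [r4 q4 a4 e4 m4]]] := restore_spec m3.
  have ag : agree [:: sMem; sAux; sB] st1 st4.
    move=> j; rewrite !inE => /norP[j1 /norP[j2 j3]].
    by rewrite a4 ?a3 ?a2 // !inE ?(negbTE j1) ?(negbTE j2) ?(negbTE j3).
  inversion r3 as [| |? ? ? st5 ? k5 k6 r5 r6 E1 E2| | | | | | |]; subst.
  exists (k1 + (k2 + (k5 + (k6 + k4)))), st4; split.
  + exact: run_seq r1 (run_seq r2 (run_seq r5 (run_seq r6 r4))).
  + move: q4; rewrite a3 // e2 h2 add0n => q4.
    have := address_le a henv; rewrite /=; move: q1 q2 q3 q4.
    move: (address _ _ _) (n.+1 ^ 2) (size a) => A N s; nia.
  + apply: full_agree f1 ag e4 _ _; last by rewrite a4 // e3.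
    by move=> i; rewrite m4 e2 h2 add0n.
  + by move=> d; rewrite ag // c1.
Qed.

(** * Polynomial bounds *)

Definition poly_bounded (f : nat -> nat) := exists A D, forall n, f n <= A * n.+1 ^ D.

Lemma poly_const k : poly_bounded (fun=> k).
Proof. by exists k, 0 => n; rewrite expn0 muln1. Qed.

Lemma poly_add f g : poly_bounded f -> poly_bounded g -> poly_bounded (fun n => f n + g n).
Proof.
case=> A [D hf] [A' [D' hg]]; exists (A + A'), (D + D') => n; rewrite mulnDl leq_add //.
  by apply: leq_trans (hf n) _; rewrite leq_mul2l leq_pexp2l ?orbT // leq_addr.
by apply: leq_trans (hg n) _; rewrite leq_mul2l leq_pexp2l ?orbT // leq_addl.
Qed.

Lemma poly_mul f g : poly_bounded f -> poly_bounded g -> poly_bounded (fun n => f n * g n).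
Proof.
case=> A [D hf] [A' [D' hg]]; exists (A * A'), (D + D') => n.
by rewrite expnD mulnACA leq_mul.
Qed.

Lemma poly_succ : poly_bounded succn.
Proof. by exists 1, 1 => n; rewrite mul1n expn1. Qed.

Lemma poly_le f g : (forall n, f n <= g n) -> poly_bounded g -> poly_bounded f.
Proof. by move=> h [A [D hg]]; exists A, D => n; exact: leq_trans (h n) (hg n). Qed.

Lemma poly_id : poly_bounded id.
Proof. exact: poly_le poly_succ. Qed.

Lemma poly_cost t : poly_bounded (cost^~ t).
Proof.
have sq k : poly_bounded (fun n => k * (12 * n.+1 ^ 2)).
  by exists (k * 12), 2 => n; rewrite mulnA.
elim: t => [a|b|t1 h1 t2 h2|t1 h1|a t1 h1] /=.
- exact: poly_add (sq _) (poly_const _).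
- exact: poly_const.
- exact: poly_add (poly_add h1 h2) (poly_const _).
- exact: poly_add (poly_mul poly_id (poly_add h1 (poly_const _))) (poly_const _).
- exact: poly_add (poly_add h1 (sq _)) (poly_const _).
Qed.

Lemma stacks_below_le K K' c : K <= K' -> stacks_below K c -> stacks_below K' c.
Proof.
move=> hK; elim: c => //= [s b|c1 h1 c2 h2|s cn h1 cf h2 ct h3|s b cf h1 ct h2].
- by move=> h; exact: leq_trans hK.
- by case/andP=> /h1-> /h2->.
- by case/and4P=> /leq_trans -> // /h1-> /h2-> /h3->.
- by case/and3P=> /leq_trans -> // /h1-> /h2->.
Qed.

Lemma stacks_below_ex c : exists K, stacks_below K c.
Proof.
elim: c => /= [|s b|c1 [K1 h1] c2 [K2 h2]|s cn [K1 h1] cf [K2 h2] ct [K3 h3]|s b cf [K1 h1] ct [K2 h2]].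
- by exists 0.
- by exists s.+1.
- exists (K1 + K2); rewrite !(stacks_below_le _ h1, stacks_below_le _ h2) ?leq_addr ?leq_addl //.
- exists (s.+1 + K1 + K2 + K3); rewrite (stacks_below_le _ h1) ?(stacks_below_le _ h2) ?(stacks_below_le _ h3) //; lia.
- exists (s.+1 + K1 + K2); rewrite (stacks_below_le _ h1) ?(stacks_below_le _ h2) //; lia.
Qed.

Lemma exec_le M t t' (c c' : config M) : exec t c = Some c' -> t <= t' -> exec t' c = Some c'.
Proof.
elim: t t' c => [|t IH] [|t'] c //=; case: (step c) => // c1.
exact: IH.
Qed.

Definition parse := Loop sMem false Skip (Seq (Push sN1 true) (Push sN2 true)).

Lemma parse_spec k r st : st sMem = nseq k true ++ false :: r -> exists t st',
  [/\ run parse st t st', t <= k * 4 + 2, agree [:: sMem; sN1; sN2] st st', st' sMem = r &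
   st' sN1 = nseq k true ++ st sN1 /\ st' sN2 = nseq k true ++ st sN2].
Proof.
elim: k st => [|k IH] st E.
  exists (0 + 2), (upd st sMem r); split => //.
  - exact: run_loopX E (run_skip _).
  - by move=> j; rewrite !inE => /norP[h _]; rewrite upd_neq.
pose st0 := upd st sMem (nseq k true ++ false :: r).
pose st1 := upd (upd st0 sN1 (true :: st sN1)) sN2 (true :: st sN2).
have [|t [st2 [r2 q a e1 [e2 e3]]]] := IH st1.
  by rewrite /st1 upd_neq // upd_neq // upd_eq.
exists ((1 + 1) + t + 2), st2; split => //.
- apply: run_loopT r2; first by rewrite E.
  rewrite -/st0; apply: (@run_seq _ _ st0 (upd st0 sN1 (true :: st sN1)) st1 1 1).
    by apply: run_pushE; rewrite /st0 upd_neq.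
  by apply: run_pushE; rewrite /st0 !upd_neq.
- by rewrite mulSn; lia.
- move=> j hj; rewrite a // /st1; move: hj; rewrite !inE => /norP[h1 /norP[h2 h3]].
  by rewrite /st0 !upd_neq.
have cc l : nseq k true ++ true :: l = nseq k.+1 true ++ l by elim: (k) => //= k' ->.
by rewrite e2 e3 -!cc /st1 upd_eq upd_neq // upd_eq.
Qed.

(** The encoding without its unary prefix and separator, which [parse] consumes. *)
Definition input_memory n (e : rel 'I_n) (L : 'I_n -> {set 'I_3}) : memory :=
  nth false ([seq e i j | i <- enum 'I_n, j <- enum 'I_n]
  ++ [seq k \in L u | u <- enum 'I_n, k <- enum 'I_3]).

Definition program t := Seq (Loop 0 true (Push sMem false) (Push sMem true))
  (Seq parse (compile 0 t)).

Lemma program_spec t n (e : rel 'I_n) L : exists k st l,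
  [/\ run (program t) (input_store (encode e L)) k st,
      k <= size (encode e L) * 3 + n * 4 + 3 + cost n t
    & st sB = (sem n [::] (input_memory e L) t).2 :: l].
Proof.
have [k1 [st1 [r1 q1 a1 e1 e2]]] :=
  @move_spec 0 sMem (input_store (encode e L)) isT.
rewrite /= revK cats0 in e2.
have [k2 [st2 [r2 q2 a2 e3 [e4 e5]]]] := parse_spec e2.
have h j : j \notin [:: 0; sMem; sN1; sN2] -> st2 j = [::].
  rewrite !inE => /norP[j0 /norP[j1 /norP[j2 j3]]].
  rewrite a2 ?inE ?negb_or ?j1 ?j2 // a1 ?inE ?negb_or ?j0 //.
  by rewrite /input_store (negbTE j0).
have f : full n [::] (input_memory e L) [::] st2.
  split; rewrite ?(h sAux) ?(h sB) //.
  - split; [by rewrite e4 a1 // cats0|by rewrite e5 a1 // cats0|by rewrite h|by rewrite h|].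
    by move=> d; rewrite nth_nil h.
  - by move=> i; rewrite e3.
  - by move=> d _; rewrite h.
have [k3 [st3 [r3 q3 f3 _]]] := compile_spec t f isT.
exists (k1 + (k2 + k3)), st3, [::]; split; last by case: f3.
  exact: run_seq r1 (run_seq r2 r3).
by move: q1; rewrite /input_store /= size_rev; lia.
Qed.

Lemma size_encode n (e : rel 'I_n) L : size (encode e L) = n.+1 + (n * n + n * 3).
Proof. by rewrite /encode !size_cat !size_allpairs size_nseq !size_enum_ord /=; lia. Qed.

Lemma term_machine t : exists (M : TM) (a d : nat), forall n (e : rel 'I_n) L,
  exists2 cf, exec (a * (size (encode e L)).+1 ^ d) (@init M (encode e L)) = Some cf &
    @tm_acc M (cf_state cf) = (sem n [::] (input_memory e L) t).2.
Proof.
have [K hK] := stacks_below_ex (program t).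
have hB : sB < K + sB.+1 by lia.
have hK1 : stacks_below (K + sB.+1) (program t) by apply: stacks_below_le hK; lia.
have [M hM] := machine_correct hB hK1.
pose s n := n.+1 + (n * n + n * 3).
pose T n := s n * 3 + n * 4 + 3 + cost n t.
have ps : poly_bounded s by apply: poly_add poly_succ (poly_add (poly_mul poly_id poly_id)
  (poly_mul poly_id (poly_const 3))).
have pT : poly_bounded T.
  apply: poly_add (poly_cost t); apply: poly_add (poly_const 3).
  apply: poly_add (poly_mul poly_id (poly_const 4)).
  exact: poly_mul ps (poly_const 3).
have [A [D hA]] : poly_bounded (fun n => 1 + (T n + 1) * (2 * (s n + (T n + 1)) + 4)).
  have pT1 := poly_add pT (poly_const 1).
  apply: poly_add (poly_const 1) (poly_mul pT1 (poly_add (poly_mul (poly_const 2) _) (poly_const 4))).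
  exact: poly_add ps pT1.
exists M, A, D => n e L.
have [k [st [l [r q hb]]]] := program_spec t e L.
have [cf h1 h2] := hM _ _ _ _ _ r hb; exists cf => //.
apply: exec_le h1 _.
have hk : k.+1 <= T n + 1 by rewrite addn1 ltnS; rewrite size_encode in q.
apply: leq_trans (leq_trans (hA n) _); last first.
  rewrite leq_mul2l size_encode; apply/orP; right; case: (D) => // D'; rewrite leq_exp2r //; lia.
by rewrite leq_add2l leq_mul // leq_add2r leq_mul2l size_encode /= leq_add2l.
Qed.

(** * The constraint network as a formula *)

(** A formula waits for its depth: [fEx] uses the current depth as the name of the bound variable,
    so binders can be written as functions. *)
Definition form := nat -> term.
Definition fC b : form := fun _ => Cst b.
Definition fGet l : form := fun _ => Get l.
Definition fNand (f g : form) : form := fun d => Nand (f d) (g d).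
Definition fNot f := fNand f (fC true).
Definition fAnd f g := fNot (fNand f g).
Definition fOr f g := fNand (fNot f) (fNot g).
Definition fImp f g := fNand f (fNot g).
Definition fIff f g := fAnd (fImp f g) (fImp g f).
Definition fEx (F : nat -> form) : form := fun d => Ex (F d d.+1).
Definition fAll F := fNot (fEx (fun x => fNot (F x))).
Definition fHas (A : Type) (F : A -> form) (s : seq A) := foldr (fun x f => fOr (F x) f) (fC false) s.
Definition fAlls (A : Type) (F : A -> form) (s : seq A) := foldr (fun x f => fAnd (F x) f) (fC true) s.
Definition fExC (F : 'I_3 -> form) := fHas F (enum 'I_3).
Definition fAllC (F : 'I_3 -> form) := fAlls F (enum 'I_3).
Definition fPut l (f : form) : form := fun d => Put l (f d).

(** * Values of formulas under a memory invariant *)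

Section Keeps.
Variable n : nat.
Implicit Types (J : memory -> Prop) (env : seq nat) (f g : form).

(** The invariant [J] is [mem_ok] where only the input and the identity matrix are read; where the
    changing table is read, it is instantiated by [exactly m]. *)
Definition keeps J env f b := forall m, J m ->
  J (sem n env m (f (size env))).1 /\ (sem n env m (f (size env))).2 = b.

Lemma keeps_C J env b : keeps J env (fC b) b.
Proof. by move=> m hm. Qed.

Lemma keeps_Nand J env f g b c : keeps J env f b -> keeps J env g c ->
  keeps J env (fNand f g) (~~ (b && c)).
Proof. by move=> hf hg m hm; rewrite /fNand /=; have [h1 ->] := hf m hm; have [h2 ->] := hg _ h1. Qed.

Lemma keeps_Not J env f b : keeps J env f b -> keeps J env (fNot f) (~~ b).
Proof. by move=> hf; have := keeps_Nand hf (@keeps_C J env true); rewrite andbT. Qed.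

Lemma keeps_And J env f g b c : keeps J env f b -> keeps J env g c ->
  keeps J env (fAnd f g) (b && c).
Proof. by move=> hf hg; have := keeps_Not (keeps_Nand hf hg); rewrite negbK. Qed.

Lemma keeps_Or J env f g b c : keeps J env f b -> keeps J env g c ->
  keeps J env (fOr f g) (b || c).
Proof.
by move=> hf hg; have := keeps_Nand (keeps_Not hf) (keeps_Not hg); rewrite -negb_or negbK.
Qed.

Lemma keeps_Imp J env f g b c : keeps J env f b -> keeps J env g c ->
  keeps J env (fImp f g) (b ==> c).
Proof. by move=> hf hg; have := keeps_Nand hf (keeps_Not hg); rewrite negb_and negbK implybE. Qed.

Lemma keeps_Iff J env f g b c : keeps J env f b -> keeps J env g c ->
  keeps J env (fIff f g) (b == c).
Proof.
move=> hf hg; have := keeps_And (keeps_Imp hf hg) (keeps_Imp hg hf).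
by case: b {hf} => /=; case: c {hg}.
Qed.

Lemma sem_ex_ind (Inv : nat -> memory -> bool -> Prop) env m (t : term) :
  Inv 0 m false ->
  (forall v (m' : memory) b, v < n -> Inv v m' b ->
     Inv v.+1 (sem n (rcons env v) m' t).1 (b || (sem n (rcons env v) m' t).2)) ->
  Inv n (sem n env m (Ex t)).1 (sem n env m (Ex t)).2.
Proof.
move=> h0 hs /=.
suff H k j (m' : memory) b : j + k = n -> Inv j m' b ->
   Inv n (foldl (fun r v => let r1 := sem n (rcons env v) r.1 t in
               (r1.1, r.2 || r1.2)) (m', b) (iota j k)).1
         (foldl (fun r v => let r1 := sem n (rcons env v) r.1 t in
               (r1.1, r.2 || r1.2)) (m', b) (iota j k)).2 by exact: H.
elim: k j m' b => [|k IH] j m' b; first by rewrite addn0 => ->.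
move=> hj hI; apply: IH; first by rewrite -hj; lia.
by apply: hs => //; lia.
Qed.

Lemma keeps_Ex J env (F : nat -> form) (P : pred 'I_n) :
  (forall v : 'I_n, keeps J (rcons env v) (F (size env)) (P v)) ->
  keeps J env (fEx F) [exists v, P v].
Proof.
move=> h m hm.
have [||h1 h2] := @sem_ex_ind (fun k m b => J m /\ b = [exists v : 'I_n, (v < k) && P v])
  env m (F (size env) (size env).+1).
- by split => //; apply/esym/existsP => -[v].
- move=> v m' b hv [hJ hb]; have := h (Ordinal hv) m' hJ; rewrite size_rcons /= => -[k1 k2].
  split => //; rewrite k2 hb; apply/orP/existsP => [[/existsP[w /andP[w1 w2]]|hP]|[w /andP[w1 w2]]].
  + by exists w; rewrite w2 andbT; apply: leq_trans w1 _.
  + by exists (Ordinal hv); rewrite ltnS leqnn.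
  + move: w1; rewrite ltnS leq_eqVlt => /orP[/eqP E|w1].
      by right; have <- : w = Ordinal hv by apply: val_inj.
    by left; apply/existsP; exists w; rewrite w1.
split; first exact: h1.
by rewrite h2; apply: eq_existsb => v; rewrite ltn_ord.
Qed.

Lemma keeps_All J env (F : nat -> form) (P : pred 'I_n) :
  (forall v : 'I_n, keeps J (rcons env v) (F (size env)) (P v)) ->
  keeps J env (fAll F) [forall v, P v].
Proof.
move=> h; rewrite -[X in keeps _ _ _ X]negbK negb_forall; apply: keeps_Not.
by apply: keeps_Ex => v; apply: keeps_Not.
Qed.

Lemma keeps_ExC J env F P : (forall k, keeps J env (F k) (P k)) ->
  keeps J env (fExC F) [exists k, P k].
Proof.
move=> h; have -> : [exists k, P k] = has P (enum 'I_3).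
  apply/existsP/hasP => [[k hk]|[k _ hk]]; exists k => //; exact: mem_enum.
rewrite /fExC; elim: (enum _) => [|k s IH] /=; first exact: keeps_C.
exact: keeps_Or.
Qed.

Lemma keeps_AllC J env F P : (forall k, keeps J env (F k) (P k)) ->
  keeps J env (fAllC F) [forall k, P k].
Proof.
move=> h; have -> : [forall k, P k] = all P (enum 'I_3).
  by apply/forallP/allP => [h' k _|h' k]; apply: h'; exact: mem_enum.
rewrite /fAllC; elim: (enum _) => [|k s IH] /=; first exact: keeps_C.
exact: keeps_And.
Qed.

Definition looks env x (v : 'I_n) := x < size env /\ nth 0 env x = v.

Lemma looks_last env (v : 'I_n) : looks (rcons env v) (size env) v.
Proof. by rewrite /looks size_rcons ltnS leqnn nth_rcons ltnn eqxx. Qed.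

Lemma looks_rcons env x (v : 'I_n) w : looks env x v -> looks (rcons env w) x v.
Proof. by case=> h1 h2; rewrite /looks size_rcons nth_rcons h1 ltnS ltnW. Qed.

Fixpoint looks_seq env (l : seq (nat * 'I_3)) (G : seq ('I_n * 'I_3)) := match l, G with
  | [::], [::] => True
  | p :: l', q :: G' => [/\ looks env p.1 q.1, p.2 = q.2 & looks_seq env l' G']
  | _, _ => False end.

Lemma looks_seq_rcons env w l G : looks_seq env l G -> looks_seq (rcons env w) l G.
Proof.
elim: l G => [|p l IH] [|q G] //= [h1 h2 h3]; split; [exact: looks_rcons|by []|exact: IH].
Qed.

Lemma looks_seq_cat env l1 l2 G1 G2 : looks_seq env l1 G1 -> looks_seq env l2 G2 ->
  looks_seq env (l1 ++ l2) (G1 ++ G2).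
Proof. by move=> + h2; elim: l1 G1 => [|p l IH] [|q G] //= [? ? /IH ?]. Qed.

Lemma keeps_Has J env F P l G : looks_seq env l G ->
  (forall p q, looks env p.1 q.1 -> p.2 = q.2 -> keeps J env (F p) (P q)) ->
  keeps J env (fHas F l) (has P G).
Proof.
move=> + h; elim: l G => [|p l IH] [|q G] //=.
by case=> h1 h2 h3; apply: keeps_Or (h _ _ h1 h2) (IH _ h3).
Qed.

Lemma keeps_Alls J env F P l G : looks_seq env l G ->
  (forall p q, looks env p.1 q.1 -> p.2 = q.2 -> keeps J env (F p) (P q)) ->
  keeps J env (fAlls F l) (all P G).
Proof.
move=> + h; elim: l G => [|p l IH] [|q G] //=.
by case=> h1 h2 h3; apply: keeps_And (h _ _ h1 h2) (IH _ h3).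
Qed.
End Keeps.

Definition aE x y := [:: AVN x; AV y].
Definition aL x k := AN2 :: AV x :: AV x :: AV x :: nseq k A1.
Definition aD x y := [:: AN2; AN; AN; AN; AVN x; AV y].
(** The two colours select one of nine blocks of [n * n] cells and thus enter as a number of [AN2]
    atoms. Two more [AN2] and three [AN] skip edges, lists and identity matrix. *)
Definition aR (x : nat) (i : 'I_3) y (j : 'I_3) :=
  nseq (2 + (i * 3 + j)) AN2 ++ [:: AN; AN; AN; AVN x; AV y].

Section Translation.
Local Notation "f &^ g" := (fAnd f g) (at level 60, right associativity).
Local Notation "f =>^ g" := (fImp f g) (at level 65, right associativity).
Variables (l1 l2 : seq (nat * 'I_3)) (flag : bool) (r : nat).
Definition fE x y := fGet (aE x y).
Definition fL x (k : 'I_3) := fGet (aL x k).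
Definition fEq x y := fGet (aD x y).
Definition fdom x := fHas (fun s => fOr (fEq x s.1) (fE x s.1)) l1.
Definition finI x := fC (~~ flag) &^ fNot (fdom x).
Definition fallowed x i := fL x i &^
  fAlls (fun s => (fEq x s.1 =>^ fC (i == s.2)) &^ (fE x s.1 =>^ fC (i != s.2))) (l1 ++ l2).
Definition fadjX u x := fdom x &^ fE x u.
Definition fcertain u k :=
  fEx (fun y => fEx (fun z => fEx (fun t => fadjX u y &^ fadjX u z &^ fadjX u t &^
    fAllC (fun a => fAllC (fun b => fAllC (fun c =>
      fallowed y a &^ fallowed z b &^ fallowed t c &^ (fE y z =>^ fC (a != b)) &^
        (fE y t =>^ fC (a != c)) &^ (fE z t =>^ fC (b != c)) &^ fC (~~ rainbow a b c) =>^
      fC [|| k == a, k == b | k == c])))))).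
Definition funcertain u := fAllC (fun k => fNot (fcertain u k)).
Definition fsame x y := fAllC (fun k => fIff (fallowed x k) (fallowed y k)).
Definition fthree_kinds u :=
  fEx (fun x => fEx (fun y => fEx (fun z => fadjX u x &^ fadjX u y &^ fadjX u z &^
    fNot (fsame x y) &^ fNot (fsame x z) &^ fNot (fsame y z)))).
Definition fI_cliques :=
  fAll (fun u => fAll (fun v => fAll (fun w =>
    finI u &^ finI v &^ finI w &^ fE u v &^ fE v w &^ fNot (fEq u w) =>^ fE u w))).
Definition fI_K4free :=
  fAll (fun u => fAll (fun v => fAll (fun w => fAll (fun x =>
    fNot (finI u &^ finI v &^ finI w &^ finI x &^ fE u v &^ fE u w &^ fE u x &^ fE v w &^
      fE v x &^ fE w x))))).
Definition fI_kinds := fAll (fun u => finI u &^ funcertain u =>^ fNot (fthree_kinds u)).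
Definition fcrossing x y :=
  fEx (fun u => fEx (fun v => finI u &^ finI v &^ fE u v &^ fE x u &^ fNot (fE x v) &^
    fE y v &^ fNot (fE y u))).
Definition ffree_colour u x i y j a :=
  fL u a &^ (fE x u =>^ fC (a != i)) &^ (fE y u =>^ fC (a != j)).
Definition fadj_or_eq u v := fOr (fEq u v) (fE u v).
Definition ftriples_ok x i y j :=
  fAll (fun u => fAll (fun v => fAll (fun w =>
    finI u &^ finI v &^ finI w &^ fadj_or_eq u v &^ fadj_or_eq u w &^ fadj_or_eq v w =>^
    fExC (fun a => fExC (fun b => fExC (fun c =>
      ffree_colour u x i y j a &^ ffree_colour v x i y j b &^ ffree_colour w x i y j c &^
      fIff (fEq u v) (fC (a == b)) &^ fIff (fEq u w) (fC (a == c)) &^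
      fIff (fEq v w) (fC (b == c)))))))).
Definition fnae x i y j :=
  fAll (fun u => finI u &^ fE x u &^ fE y u =>^
    fAllC (fun k => fcertain u k =>^ fC (~~ rainbow i j k)) &^
    (funcertain u &^ fsame x y &^ fEx (fun z => fadjX u z &^ fNot (fsame x z)) =>^ fC (i == j))).
Definition fclosed_ok := fC flag =>^
  fdom r &^ fAll (fun x => fAll (fun y => fdom x &^ fE x y =>^ fdom y)).
Definition fvalues x i := fOr (fdom x &^ fallowed x i) (fNot (fdom x) &^ fC (i == inord 0)).
Definition fconstraint x i y j :=
  fvalues x i &^ fvalues y j &^ (fEq x y =>^ fC (i == j)) &^ fclosed_ok &^
  fI_cliques &^ fI_K4free &^ fI_kinds &^
  (fdom x &^ fdom y =>^ (fE x y =>^ fC (i != j)) &^ (fcrossing x y =>^ fC (i != j)) &^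
    ftriples_ok x i y j &^ fnae x i y j).
End Translation.

(** * Memory layout and correctness of the translation *)

Section Memory.
Variables (n : nat) (e : rel 'I_n) (L : 'I_n -> {set 'I_3}).

Definition cE (u v : 'I_n) := u * n + v.
Definition cL (u : 'I_n) (k : 'I_3) := n * n + (u * 3 + k).
Definition cD (u v : 'I_n) := n * n + n * 3 + (u * n + v).
Definition cR (c : 'I_n * 'I_3 * 'I_n * 'I_3) :=
  n * n + n * 3 + n * n + ((c.1.1.2 * 3 + c.2) * (n * n) + (c.1.1.1 * n + c.1.2)).

(* cE and cL address the input as it is encoded. The cells cD hold the identity
   matrix, so that terms can compare vertices by reading the memory. *)
Definition mem_ok (m : memory) := [/\ forall u v, m (cE u v) = e u v,
  forall u k, m (cL u k) = (k \in L u) & forall u v, m (cD u v) = (u == v)].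

Lemma keeps_get (J : memory -> Prop) env l b : (forall m, J m -> m (address n env l) = b) ->
  keeps n J env (fGet l) b.
Proof. by move=> h m hm; split => //=; apply: h. Qed.

Lemma address_E env x y u v : looks env x u -> looks env y v ->
  address n env (aE x y) = cE u v.
Proof. by case=> _ h1 [_ h2]; rewrite /address /= h1 h2 addn0. Qed.

Lemma address_D env x y u v : looks env x u -> looks env y v ->
  address n env (aD x y) = cD u v.
Proof. by case=> _ h1 [_ h2]; rewrite /address /= h1 h2 addn0 /cD; lia. Qed.

Lemma address_nseq env k a : sumn (map (atom_value n env) (nseq k a)) = k * atom_value n env a.
Proof. by elim: k => //= k ->. Qed.

Lemma address_L env x u (k : 'I_3) : looks env x u -> address n env (aL x k) = cL u k.
Proof. by case=> _ h1; rewrite /address /= address_nseq /= h1 /cL; lia. Qed.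

Lemma address_R env x y u v i j : looks env x u -> looks env y v ->
  address n env (aR x i y j) = cR (u, i, v, j).
Proof.
case=> _ h1 [_ h2]; rewrite /address map_cat sumn_cat address_nseq /= h1 h2 /cR /=; lia.
Qed.

Section Formulas.
Variable J : memory -> Prop.
Hypothesis hJ : forall m, J m -> mem_ok m.
Variables (G1 G2 : seq ('I_n * 'I_3)) (flag : bool) (l1 l2 : seq (nat * 'I_3)).
Notation kp := (keeps n J).

Lemma keeps_E env x y (u v : 'I_n) : looks env x u -> looks env y v -> kp env (fE x y) (e u v).
Proof.
by move=> hx hy; apply: keeps_get => m /hJ[h _ _]; rewrite (address_E hx hy) h.
Qed.
Lemma keeps_L env x k (u : 'I_n) : looks env x u -> kp env (fL x k) (k \in L u).
Proof. by move=> hx; apply: keeps_get => m /hJ[_ h _]; rewrite (address_L k hx) h. Qed.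
Lemma keeps_Eq env x y (u v : 'I_n) : looks env x u -> looks env y v -> kp env (fEq x y) (u == v).
Proof.
by move=> hx hy; apply: keeps_get => m /hJ[_ _ h]; rewrite (address_D hx hy) h.
Qed.

Ltac lk := lazymatch goal with
  | |- looks_seq (rcons _ _) _ _ => apply: looks_seq_rcons; lk
  | |- looks_seq _ _ _ => assumption
  | |- looks (rcons ?E _) (size ?E) _ => exact: looks_last
  | |- looks (rcons _ _) _ _ => first [assumption | apply: looks_rcons; lk]
  | |- looks _ _ _ => assumption end.

Ltac kstep := cbv beta; lazymatch goal with |- keeps _ _ _ ?f _ => lazymatch f with
  | fE _ _ => apply: keeps_E; lk
  | fEq _ _ => apply: keeps_Eq; lk
  | fL _ _ => apply: keeps_L; lk
  | fC _ => apply: keeps_C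
  | fEx _ => apply: keeps_Ex => ?
  | fAll _ => apply: keeps_All => ?
  | fExC _ => apply: keeps_ExC => ?
  | fAllC _ => apply: keeps_AllC => ?
  | fAnd _ _ => apply: keeps_And
  | fOr _ _ => apply: keeps_Or
  | fImp _ _ => apply: keeps_Imp
  | fIff _ _ => apply: keeps_Iff
  | fNot _ => apply: keeps_Not
  end end.

Lemma keeps_dom env x u : looks_seq env l1 G1 -> looks env x u ->
  kp env (fdom l1 x) (dom e G1 u).
Proof. by move=> h hx; apply: keeps_Has h _ => p q h1 h2; repeat kstep. Qed.

Lemma keeps_inI env x u : looks_seq env l1 G1 -> looks env x u ->
  kp env (finI l1 flag x) (inI e flag G1 u).
Proof. by move=> h hx; apply: keeps_And; [kstep | apply: keeps_Not; apply: keeps_dom]. Qed.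

Lemma keeps_allowed env x u i : looks_seq env l1 G1 -> looks_seq env l2 G2 -> looks env x u ->
  kp env (fallowed l1 l2 x i) (allowed e L G1 G2 u i).
Proof.
move=> h h' hx; apply: keeps_And; first by kstep.
by apply: keeps_Alls (looks_seq_cat h h') _ => p q h1 h2; rewrite h2; repeat kstep.
Qed.

Ltac kstep2 := lazymatch goal with |- keeps _ _ _ ?f _ => lazymatch f with
  | fdom _ _ => apply: keeps_dom; lk
  | finI _ _ _ => apply: keeps_inI; lk
  | fallowed _ _ _ _ => apply: keeps_allowed; lk
  | fadjX _ _ _ => rewrite /fadjX /adjX
  | fsame _ _ _ _ => rewrite /fsame /same_allowed
  | _ => kstep end end.

Lemma keeps_certain env x u k : looks_seq env l1 G1 -> looks_seq env l2 G2 -> looks env x u ->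
  kp env (fcertain l1 l2 x k) (certain e L G1 G2 u k).
Proof. by move=> *; rewrite /fcertain; repeat kstep2. Qed.

Lemma keeps_uncertain env x u : looks_seq env l1 G1 -> looks_seq env l2 G2 -> looks env x u ->
  kp env (funcertain l1 l2 x) (uncertain e L G1 G2 u).
Proof. by move=> *; apply: keeps_AllC => k; apply: keeps_Not; apply: keeps_certain. Qed.

Lemma keeps_values env x u i : looks_seq env l1 G1 -> looks_seq env l2 G2 -> looks env x u ->
  kp env (fvalues l1 l2 x i) (values e L G1 G2 u i).
Proof.
move=> *; rewrite /values.
have E b c d : (if b then c else d) = (b && c) || (~~ b && d) by case: b c d => -[] [].
by rewrite E /fvalues; repeat kstep2.
Qed.

Ltac kstep3 := lazymatch goal with |- keeps _ _ _ ?f _ => lazymatch f with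
  | fcertain _ _ _ _ => apply: keeps_certain; lk
  | funcertain _ _ _ => apply: keeps_uncertain; lk
  | fvalues _ _ _ _ => apply: keeps_values; lk
  | fthree_kinds _ _ _ => rewrite /fthree_kinds
  | fcrossing _ _ _ _ => rewrite /fcrossing
  | fclosed_ok _ _ _ => rewrite /fclosed_ok
  | fI_cliques _ _ => rewrite /fI_cliques
  | fI_K4free _ _ => rewrite /fI_K4free
  | fI_kinds _ _ _ => rewrite /fI_kinds
  | fnae _ _ _ _ _ _ _ => rewrite /fnae
  | ftriples_ok _ _ _ _ _ _ => rewrite /ftriples_ok
  | ffree_colour _ _ _ _ _ _ => rewrite /ffree_colour
  | fadj_or_eq _ _ => rewrite /fadj_or_eq
  | _ => kstep2 end end.

Lemma keeps_constraint env r x y vr u v i j : looks_seq env l1 G1 -> looks_seq env l2 G2 ->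
  looks env r vr -> looks env x u -> looks env y v ->
  kp env (fconstraint l1 l2 flag r x i y j) (constraint e L flag vr G1 G2 u i v j).
Proof. by move=> *; rewrite /fconstraint; repeat kstep3. Qed.
End Formulas.
End Memory.

(** * Running path consistency *)

Lemma pair_code_inj b x y x' y' : y < b -> y' < b -> x * b + y = x' * b + y' ->
  x = x' /\ y = y'.
Proof.
move=> h h' E; have := congr1 (fun k => (k %/ b, k %% b)) E.
have b0 : 0 < b by apply: leq_ltn_trans h.
by rewrite /= !divnMDl // !modnMDl !divn_small // !modn_small // !addn0 => -[].
Qed.

(** Runs [f] for its effect and returns [g]; the disjunction with true discards the value of [f]. *)
Definition fThen f g := fAnd (fOr f (fC true)) g.
Definition fSeqs (A : Type) (F : A -> form) (s : seq A) :=
  foldr (fun x f => fNand (F x) f) (fC true) s.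
Definition fPass (P : nat -> 'I_3 -> nat -> 'I_3 -> form) :=
  fSeqs (fun i => fSeqs (fun j => fEx (fun x => fEx (fun y =>
    fPut (aR x i y j) (P x i y j)))) (enum 'I_3)) (enum 'I_3).
Definition fR x i y j := fGet (aR x i y j).
Definition fRevise x i y j := fAnd (fR x i y j) (fAnd (fR y j x i)
  (fAll (fun z => fExC (fun k => fAnd (fR x i z k) (fR y j z k))))).
(* There are 9 * n ^ 2 cells and a sweep that changes something clears one. *)
Definition fSweeps := fEx (fun _ => fEx (fun _ => fSeqs (fun _ => fPass fRevise) (iota 0 10))).
Definition fBody flag r l1 l2 := fThen (fPass (fconstraint l1 l2 flag r))
  (fThen fSweeps (fExC (fun i => fR r i r i))).

(** * Sweeps as monotone operations on the table *)

Section Cells.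
Variables (n : nat) (e : rel 'I_n) (L : 'I_n -> {set 'I_3}).
Notation cell := ('I_n * 'I_3 * 'I_n * 'I_3)%type.
Notation mem_ok := (mem_ok e L).

Definition stored (m : memory) := [set c : cell | m (cR c)].

Lemma pair_lt (u v : 'I_n) : u * n + v < n * n.
Proof. by have := ltn_ord u; have := ltn_ord v; nia. Qed.

Lemma cR_inj : injective (@cR n).
Proof.
move=> [[[u i] v] j] [[[u' i'] v'] j']; rewrite /cR /= => /addnI h.
have [h1 h2] := pair_code_inj (pair_lt u v) (pair_lt u' v') h.
have [a1 a2] := pair_code_inj (ltn_ord j) (ltn_ord j') h1.
have [b1 b2] := pair_code_inj (ltn_ord v) (ltn_ord v') h2.
by congr (_, _, _, _); apply: val_inj.
Qed.

Lemma cR_low (c : cell) k : k < n * n + n * 3 + n * n -> k != cR c.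
Proof. by move=> h; apply/negP => /eqP E; move: h; rewrite E /cR ltnNge leq_addr. Qed.

Lemma cD_inj (u v u' v' : 'I_n) : cD u v = cD u' v' -> u = u' /\ v = v'.
Proof.
by rewrite /cD => /addnI/(pair_code_inj (ltn_ord v) (ltn_ord v')) [h1 h2]; split; apply: val_inj.
Qed.

Lemma mem_ok_upd m (c : cell) b : mem_ok m -> mem_ok (upd m (cR c) b).
Proof.
case=> h1 h2 h3; split=> u v; rewrite upd_neq //; apply: cR_low.
- by rewrite /cE; have := pair_lt u v; lia.
- by rewrite /cL; have := ltn_ord u; have := ltn_ord v; lia.
- by rewrite /cD; have := pair_lt u v; lia.
Qed.

Lemma stored_upd m (c : cell) b : stored (upd m (cR c) b) = if b then c |: stored m else stored m :\ c.
Proof.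
apply/setP => c'; rewrite inE; case: (c' =P c) => [->|/eqP hc].
  by rewrite upd_eq; case: b; rewrite !inE eqxx.
by rewrite upd_neq ?(inj_eq cR_inj) //; case: b; rewrite !inE (negbTE hc).
Qed.

Section Compose.
Variables (A : Type) (idx : A) (op : Monoid.law idx) (Q : A -> memory -> memory -> Prop).
Hypothesis Q0 : forall m, Q idx m m.
Hypothesis Qop : forall a b m m1 m2, Q a m m1 -> Q b m1 m2 -> Q (op a b) m m2.

(** The index of [Q] lives in a monoid, so that one induction over loops serves both uses: unions of
    the cells treated in a pass, and sums of the numbers of sweeps. *)
Definition effect a env (f : form) := forall m, mem_ok m ->
  mem_ok (sem n env m (f (size env))).1 /\ Q a m (sem n env m (f (size env))).1.

Lemma effect_Nand a b env f g : effect a env f -> effect b env g ->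
  effect (op a b) env (fNand f g).
Proof.
by move=> hf hg m hm; have [h1 q1] := hf m hm; have [h2 q2] := hg _ h1; split => //; exact: Qop q1 q2.
Qed.

Lemma effect_Seqs (I : Type) (F : I -> form) a env s : (forall i, effect (a i) env (F i)) ->
  effect (\big[op/idx]_(i <- s) a i) env (fSeqs F s).
Proof.
move=> h; elim: s => [|i s IH]; first by rewrite big_nil => m hm; split => //; exact: Q0.
by rewrite big_cons; apply: effect_Nand.
Qed.

Lemma effect_Ex (a : 'I_n -> A) (env : seq nat) (F : nat -> form) :
  (forall v : 'I_n, effect (a v) (rcons env v) (F (size env))) ->
  effect (\big[op/idx]_(v <- enum 'I_n) a v) env (fEx F).
Proof.
move=> h m hm.
have [||] := @sem_ex_ind n (fun k m' _ => mem_ok m' /\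
  Q (\big[op/idx]_(v <- take k (enum 'I_n)) a v) m m') env m (F (size env) (size env).+1).
- by rewrite take0 big_nil.
- move=> v m' b hv [h1 h2]; have := h (Ordinal hv) m' h1; rewrite size_rcons /= => -[k1 k2].
  split => //; rewrite (take_nth (Ordinal hv)) ?size_enum_ord //.
  by rewrite -cats1 big_cat big_seq1 (nth_ord_enum _ (Ordinal hv)); exact: Qop h2 k2.
by rewrite take_oversize ?size_enum_ord.
Qed.
End Compose.

Lemma effect_weaken A (Q : A -> memory -> memory -> Prop) a a' env f :
  a = a' -> effect Q a env f -> effect Q a' env f.
Proof. by move->. Qed.

Lemma effect_Pass (Q : {set cell} -> memory -> memory -> Prop) P env :
  (forall m, Q set0 m m) ->
  (forall a b m m1 m2, Q a m m1 -> Q b m1 m2 -> Q (a :|: b) m m2) ->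
  (forall u i v j, effect Q [set (u, i, v, j)] (rcons (rcons env (nat_of_ord u)) (nat_of_ord v))
     (fPut (aR (size env) i (size env).+1 j) (P (size env) i (size env).+1 j))) ->
  effect Q setT env (fPass P).
Proof.
move=> Q0 Qop h.
have : effect Q (\bigcup_(i <- enum 'I_3) \bigcup_(j <- enum 'I_3) \bigcup_(u <- enum 'I_n)
  \bigcup_(v <- enum 'I_n)    [set (u, i, v, j)]) env (fPass P).
  apply: (effect_Seqs Q0 Qop) => i; apply: (effect_Seqs Q0 Qop) => j.
  apply: (effect_Ex Q0 Qop) => u; apply: (effect_Ex Q0 Qop) => v.
  by rewrite size_rcons; exact: h.
apply: effect_weaken; apply/setP => -[[[u i] v] j]; rewrite inE.
rewrite big_enum; apply/bigcupP; exists i => //; rewrite big_enum; apply/bigcupP; exists j => //.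
by rewrite big_enum; apply/bigcupP; exists u => //; rewrite big_enum; apply/bigcupP; exists v; rewrite ?inE.
Qed.

Definition exactly (m : memory) := fun m' : memory => m' = m.

Lemma sem_put m env x y u v i j f b : mem_ok m -> looks env x u -> looks env y v ->
  keeps n (exactly m) env f b ->
  let m' := (sem n env m (fPut (aR x i y j) f (size env))).1 in
  mem_ok m' /\ stored m' = if b then (u, i, v, j) |: stored m else stored m :\ (u, i, v, j).
Proof.
move=> hm hx hy hf; have [h1 h2] := hf m erefl.
rewrite /= (address_R i j hx hy) h1 h2 stored_upd; split => //; exact: mem_ok_upd.
Qed.

Definition writes (F : pred cell) (V : {set cell}) m m' := forall c,
  (c \in stored m') = if c \in V then F c else c \in stored m.

Lemma init_effect env l1 l2 flag r vr G1 G2 : looks_seq env l1 G1 -> looks_seq env l2 G2 ->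
  looks env r vr -> effect (writes (fun c : cell =>
     constraint e L flag vr G1 G2 c.1.1.1 c.1.1.2 c.1.2 c.2)) setT env (fPass (fconstraint l1 l2 flag r)).
Proof.
move=> h1 h2 hr; apply: effect_Pass => [m c|a b m m1 m2 H1 H2 c|u i v j m hm].
- by rewrite in_set0.
- by rewrite H2 H1 in_setU; case: (c \in a) => //=; case: (c \in b).
set env' := rcons _ _.
have hx : looks env' (size env) u by apply: looks_rcons; apply: looks_last.
have hy : looks env' (size env).+1 v by rewrite -(size_rcons env u); apply: looks_last.
have hk : keeps n (exactly m) env' (fconstraint l1 l2 flag r (size env) i (size env).+1 j)
   (constraint e L flag vr G1 G2 u i v j).
  by apply: keeps_constraint => // [m' ->//|||]; [do 2!apply: looks_seq_rcons
    | do 2!apply: looks_seq_rcons | do 2!apply: looks_rcons].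
have [k1 k2] := sem_put i j hm hx hy hk; split => // c; rewrite k2 inE.
by case: eqP => [->|/eqP hc] /=; case: (constraint _ _ _ _ _ _ _ _ _ _);
  rewrite !inE ?eqxx // (negbTE hc).
Qed.

Definition consistent (A : {set cell}) (c : cell) := let: (x, i, y, j) := c in
  ((y, j, x, i) \in A) && [forall z, [exists k, ((x, i, z, k) \in A) && ((y, j, z, k) \in A)]].
Definition closed (A : {set cell}) := forall c, c \in A -> consistent A c.

Lemma consistent_sub (A B : {set cell}) c : A \subset B -> consistent A c -> consistent B c.
Proof.
case: c => [[[x i] y] j] /subsetP h /andP[h0 /forallP h1]; rewrite /consistent (h _ h0) /=.
apply/forallP => z.
by have /existsP[k /andP[/h a /h b]] := h1 z; apply/existsP; exists k; rewrite a b.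
Qed.

(** The second half keeps solutions alive: the cells of a solution form a closed set, and no
    revision removes a cell of a closed subset of the table. *)
Definition shrinks m m' := stored m' \subset stored m /\
  forall G, closed G -> G \subset stored m -> G \subset stored m'.
(** Cells are revised in place, so consistency is claimed only for a pass that changes nothing: then
    all tests refer to the same table. *)
Definition revised (V : {set cell}) m m' := shrinks m m' /\
  (stored m' = stored m -> forall c, c \in V -> c \in stored m -> consistent (stored m) c).
Definition reduced k m m' := shrinks m m' /\
  (closed (stored m') \/ #|stored m'| + k <= #|stored m|).

Lemma shrinks_refl m : shrinks m m.
Proof. by split. Qed.
Lemma shrinks_trans m1 m2 m3 : shrinks m1 m2 -> shrinks m2 m3 -> shrinks m1 m3.
Proof.
case=> h1 h2 [h3 h4]; split; first exact: subset_trans h3 h1.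
by move=> G hG /(h2 _ hG)/(h4 _ hG).
Qed.

Lemma revise_effect env : effect revised setT env (fPass fRevise).
Proof.
apply: effect_Pass => [m|a b m m1 m2 [H1 K1] [H2 K2]|u i v j m hm].
- by split; [exact: shrinks_refl | move=> _ c; rewrite inE].
- split; first exact: shrinks_trans H1 H2.
  move=> E; have E1 : stored m1 = stored m.
    by apply/eqP; rewrite eqEsubset (proj1 H1) -E (proj1 H2).
  move=> c; rewrite inE => /orP[hc|hc]; first exact: K1.
  by rewrite -E1; apply: K2 => //; rewrite E1.
set env' := rcons _ _.
have hx : looks env' (size env) u by apply: looks_rcons; apply: looks_last.
have hy : looks env' (size env).+1 v by rewrite -(size_rcons env u); apply: looks_last.
have kR env1 x y (a : 'I_n) i1 (b : 'I_n) i2 : looks env1 x a -> looks env1 y b ->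
   keeps n (exactly m) env1 (fR x i1 y i2) ((a, i1, b, i2) \in stored m).
  by move=> h1 h2; apply: keeps_get => m' ->; rewrite (address_R _ _ h1 h2) inE.
have hk : keeps n (exactly m) env' (fRevise (size env) i (size env).+1 j)
   (((u, i, v, j) \in stored m) && consistent (stored m) (u, i, v, j)).
  apply: keeps_And; first exact: kR.
  apply: keeps_And; first exact: kR.
  apply: keeps_All => z; apply: keeps_ExC => k.
  have hz := looks_last env' z; have hx' := looks_rcons z hx; have hy' := looks_rcons z hy.
  by apply: keeps_And; apply: kR.
have [k1 k2] := sem_put i j hm hx hy hk; split => //; move: k2; set m' := (sem _ _ _ _).1.
set c := (u, i, v, j) => k2; split.
  split; first by rewrite k2; case: ifP => [/andP[h _]|_]; rewrite ?subD1set // subUset sub1set h subxx.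
  move=> G hG hGm; rewrite k2; case: ifP => h; first exact: subset_trans hGm (subsetUr _ _).
  rewrite subsetD1 hGm /=; apply: contraFN h => hc.
  by rewrite (subsetP hGm) // (consistent_sub hGm) // hG.
move=> E c'; rewrite in_set1 => /eqP-> hc; apply/negPn/negP => hn; move: hc.
by rewrite -E k2 (negbTE hn) andbF in_setD1 eqxx.
Qed.

Lemma sweep_effect env : effect reduced 1 env (fPass fRevise).
Proof.
move=> m hm; have [h1 [h2 h3]] := revise_effect env hm; split => //; split => //.
set m' := (sem _ _ _ _).1 in h1 h2 h3 *.
case: (stored m' =P stored m) => E; [left => c hc|right].
  by rewrite E in hc *; apply: h3 => //; rewrite inE.
by rewrite addn1; apply: proper_card; rewrite properEneq (proj1 h2) andbT; apply/eqP.
Qed.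

Lemma sweeps_effect env : effect reduced (10 * (n * n)) env fSweeps.
Proof.
have Q0 m : reduced 0 m m by split; [exact: shrinks_refl | right; rewrite addn0].
have Qop a b m m1 m2 : reduced a m m1 -> reduced b m1 m2 -> reduced (a + b) m m2.
  move=> [h1 h2] [h3 h4]; split; first exact: shrinks_trans h1 h3.
  case: h4 => [h4|h4]; first by left.
  case: h2 => [h2|h2]; last by right; lia.
  left; suff -> : stored m2 = stored m1 by [].
  by apply/eqP; rewrite eqEsubset (proj1 h3) (proj2 h3).
have : effect reduced (\sum_(x <- enum 'I_n) \sum_(y <- enum 'I_n) \sum_(k <- iota 0 10) 1) env fSweeps.
  apply: (effect_Ex Q0 Qop) => u; apply: (effect_Ex Q0 Qop) => v.
  by apply: (effect_Seqs Q0 Qop) => k; exact: sweep_effect.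
apply: effect_weaken; rewrite !big_enum sum1_size size_iota !sum_nat_const !card_ord; lia.
Qed.

Definition solvable flag r G1 G2 := [exists g : {ffun 'I_n -> 'I_3},
  [forall x, [forall y, constraint e L flag r G1 G2 x (g x) y (g y)]]].

Lemma body_keeps env flag r vr l1 l2 G1 G2 : looks_seq env l1 G1 -> looks_seq env l2 G2 ->
  looks env r vr -> keeps n mem_ok env (fBody flag r l1 l2) (solvable flag vr G1 G2).
Proof.
move=> hl1 hl2 hr m hm.
have thenE f g m0 : sem n env m0 (fThen f g (size env)) =
    sem n env (sem n env m0 (f (size env))).1 (g (size env)).
  by rewrite /fThen /= /fNand /= !andbF /= !andbT negbK -surjective_pairing.
rewrite !thenE.
have [hm1 w1] := init_effect flag hl1 hl2 hr hm.
set m1 := (sem n env m _).1 in hm1 w1 *.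
have [hm2 [[s1 s2] s3]] := sweeps_effect env hm1.
set m2 := (sem n env m1 _).1 in hm2 s1 s2 s3 *.
have kp : keeps n (exactly m2) env (fExC (fun i => fR r i r i))
    [exists i, (vr, i, vr, i) \in stored m2].
  by apply: keeps_ExC => i; apply: keeps_get => m' ->; rewrite (address_R _ _ hr hr) inE.
have [-> ->] := kp m2 erefl; split => //.
have C1 c : (c \in stored m1) = constraint e L flag vr G1 G2 c.1.1.1 c.1.1.2 c.1.2 c.2.
  by rewrite w1 inE.
have cl : closed (stored m2).
  (* There are [9 * n ^ 2] cells, too few for [10 * n ^ 2] sweeps that each clear one; the
     inequality is strict because [vr] gives [n > 0]. *)
  case: s3 => // h; have := max_card (mem (stored m1)).
  rewrite !card_prod !card_ord => h'; have := ltn_ord vr.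
  by move: h' h; move: #|_| #|_| => p q; nia.
apply/existsP/existsP => [[i hi]|[g /forallP hg]].
  have [||||g hg] := @path_consistent_solution _ (fun x i y j => (x, i, y, j) \in stored m2) _ _ _ _ vr i hi.
  - move=> x a b /(subsetP s1); rewrite C1 /= => /and4P[_ _ h _].
    by move: h; rewrite eqxx => /eqP.
  - by move=> x a y b /cl /andP[].
  - by move=> x a y b z /cl /andP[_ /forallP/(_ z)/existsP].
  - move=> z; case: (boolP (dom e G1 z)) => hz.
      have [k hk] := dom_two L G2 hz; exists k; apply: contra hk => /(subsetP s1).
      by rewrite C1 /= => /and3P[]; rewrite /values hz.
    (* The dummy value of an undominated vertex is 0, so 1 is excluded. *)
    exists (inord 1); apply/negP => /(subsetP s1); rewrite C1 /= => /and3P[].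
    by rewrite /values (negbTE hz) => /eqP/(congr1 val); rewrite /= !inordK.
  exists (finfun g); apply/forallP => x; apply/forallP => y; rewrite !ffunE.
  by have := subsetP s1 _ (hg x y); rewrite C1.
exists (g vr); pose G := [set c : cell | (c.1.1.2 == g c.1.1.1) && (c.2 == g c.1.2)].
have GP x y : (x, g x, y, g y) \in G by rewrite inE /= !eqxx.
have cG : closed G.
  move=> [[[x i] y] j]; rewrite inE /= => /andP[/eqP-> /eqP->]; rewrite GP /=.
  by apply/forallP => z; apply/existsP; exists (g z); rewrite !GP.
apply: (subsetP (s2 _ cG _)) (GP _ _); apply/subsetP => -[[[x i] y] j].
by rewrite inE /= => /andP[/eqP-> /eqP->]; rewrite C1 /=; exact: (forallP (hg x)).
Qed.
End Cells.

(** * The algorithm *)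

Fixpoint fGuess k (acc : seq (nat * 'I_3)) (F : seq (nat * 'I_3) -> form) : form :=
  match k with
  | 0 => F acc
  | k'.+1 => fEx (fun x => fExC (fun i => fGuess k' ((x, i) :: acc) F))
  end.

Fixpoint guess (T : finType) k (G : seq (T * 'I_3)) (B : seq (T * 'I_3) -> bool) : bool :=
  match k with
  | 0 => B G
  | k'.+1 => [exists x, [exists i, guess k' ((x, i) :: G) B]]
  end.

Lemma guessP (T : finType) k (B : seq (T * 'I_3) -> bool) :
  reflect (exists2 G, size G = k & B G) (guess k [::] B).
Proof.
suff H G0 : guess k G0 B <-> exists2 G, size G = k & B (G ++ G0).
  apply: (iffP idP) => [/H[G h]|[G h hB]]; first by rewrite cats0; exists G.
  by apply/H; exists G; rewrite ?cats0.
elim: k G0 => [|k IH] G0 /=.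
  by split=> [h|[[|//] _ h]]; first exists [::].
split=> [/existsP[x /existsP[i /IH[G h hB]]]|[G]].
  by exists (rcons G (x, i)); rewrite ?size_rcons ?h ?cat_rcons.
elim/last_ind: G => [//|G [x i] _]; rewrite size_rcons cat_rcons => -[h] hB.
by apply/existsP; exists x; apply/existsP; exists i; apply/IH; exists G.
Qed.

Definition fAlgorithm k1 k2 :=
  let run_with flag r := fGuess k1 [::] (fun l1 => fGuess k2 [::] (fun l2 => fBody flag r l1 l2)) in
  fThen (fEx (fun x => fPut (aD x x) (fC true)))
    (fAll (fun r => fOr (run_with true r) (run_with false r))).

Section Algorithm.
Variables (n : nat) (e : rel 'I_n) (L : 'I_n -> {set 'I_3}).

Definition accepted k1 k2 flag r :=
  guess k1 [::] (fun G1 => guess k2 [::] (fun G2 => solvable e L flag r G1 G2)).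

(** The predicate [K] carries what later formulas know about the environment, such as the places of
    [r] and of the vertices guessed before. *)
Lemma keeps_guess J (K : seq nat -> Prop) F (B : seq ('I_n * 'I_3) -> bool) k env acc G :
  (forall env w, K env -> K (rcons env w)) ->
  (forall env acc G, K env -> looks_seq env acc G -> keeps n J env (F acc) (B G)) ->
  K env -> looks_seq env acc G -> keeps n J env (fGuess k acc F) (guess k G B).
Proof.
move=> hK hF; elim: k env acc G => [|k IH] env acc G h1 h2 /=; first exact: hF.
apply: keeps_Ex => x; apply: keeps_ExC => i; apply: IH; first exact: hK.
by split => //; [exact: looks_last | exact: looks_seq_rcons].
Qed.

Lemma nth_allpairs (A B C : Type) (a0 : A) (b0 : B) (c0 : C) (f : A -> B -> C) s t i j :
  i < size s -> j < size t ->
  nth c0 [seq f a b | a <- s, b <- t] (i * size t + j) = f (nth a0 s i) (nth b0 t j).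
Proof.
elim: s i => [//|a s IH] [|i] hi hj; rewrite allpairs_cons nth_cat size_map.
  by rewrite mul0n add0n hj (nth_map b0).
by rewrite mulSn -addnA ltnNge leq_addr /= addKn IH.
Qed.

Lemma input_edge u v : input_memory e L (cE u v) = e u v.
Proof.
rewrite /input_memory nth_cat size_allpairs !size_enum_ord /cE.
have -> : u * n + v < n * n by have := ltn_ord u; have := ltn_ord v; nia.
have := @nth_allpairs _ _ _ u u false e (enum 'I_n) (enum 'I_n) u v.
by rewrite size_enum_ord !nth_ord_enum => ->.
Qed.

Lemma input_list u k : input_memory e L (cL u k) = (k \in L u).
Proof.
rewrite /input_memory nth_cat size_allpairs !size_enum_ord /cL ltnNge leq_addr /= addKn.
have := @nth_allpairs _ _ _ u k false (fun u k => k \in L u) (enum 'I_n) (enum 'I_3) u k.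
by rewrite !size_enum_ord !nth_ord_enum => ->.
Qed.

Lemma input_blank (u v : 'I_n) : input_memory e L (cD u v) = false.
Proof.
rewrite /input_memory nth_default // size_cat !size_allpairs !size_enum_ord /cD; lia.
Qed.

Lemma algorithm_value k1 k2 : (sem n [::] (input_memory e L) (fAlgorithm k1 k2 0)).2 =
  [forall r, accepted k1 k2 true r || accepted k1 k2 false r].
Proof.
have thenE f g m0 : sem n [::] m0 (fThen f g 0) = sem n [::] (sem n [::] m0 (f 0)).1 (g 0).
  by rewrite /fThen /= /fNand /= !andbF /= !andbT negbK -surjective_pairing.
rewrite /fAlgorithm thenE.
set m1 := (sem n [::] (input_memory e L) _).1.
(* The cells [cD] lie beyond the input and read as false, so writing the diagonal completes the
   identity matrix. *)
have hm1 : mem_ok e L m1.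
  suff H : [/\ forall u v, m1 (cE u v) = e u v,
    forall u k, m1 (cL u k) = (k \in L u) &
    forall u v : 'I_n, m1 (cD u v) = (u == v) && (u < n)].
    by case: H => h1 h2 h3; split => // u v; rewrite h3 ltn_ord andbT.
  have [||] := @sem_ex_ind n (fun k m _ => [/\ forall u v, m (cE u v) = e u v,
    forall u i, m (cL u i) = (i \in L u) &
    forall u v : 'I_n, m (cD u v) = (u == v) && (u < k)])
    [::] (input_memory e L) (fPut (aD 0 0) (fC true) 1); last by [].
    split=> u v; [exact: input_edge|exact: input_list|].
    by rewrite input_blank andbF.
  move=> v m' b hv [h1 h2 h3]; pose w := Ordinal hv.
  have E : address n (rcons [::] v) (aD 0 0) = cD w w.
    by apply: address_D; exact: (@looks_last n [::] w).
  have [p1 p2] : (forall u u' : 'I_n, cE u u' != cD w w) /\ (forall (u : 'I_n) k, cL u k != cD w w).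
    split=> u u'; apply/negP => /eqP; rewrite /cE /cL /cD.
      by have := pair_lt u u'; lia.
    by have := ltn_ord u; have := ltn_ord u'; lia.
  rewrite [sem _ _ _ _]/= E; split=> [u u'|u i|u u'] /=.
  - by rewrite upd_neq.
  - by rewrite upd_neq.
  rewrite /upd; case: (cD u u' =P cD w w) => [/cD_inj[-> ->]|hn]; first by rewrite eqxx ltnS leqnn.
  rewrite h3; case: (u =P u') => //= uu; rewrite ltnS [RHS]leq_eqVlt.
  suff /negbTE-> : nat_of_ord u != v by [].
  by apply/negP => /eqP uv; case: hn; rewrite -uu; have -> : u = w by apply: val_inj.
have [] := @keeps_All n (mem_ok e L) [::] (fun r => fOr
   (fGuess k1 [::] (fun l1 => fGuess k2 [::] (fun l2 => fBody true r l1 l2)))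
   (fGuess k1 [::] (fun l1 => fGuess k2 [::] (fun l2 => fBody false r l1 l2))))
  (fun r => accepted k1 k2 true r || accepted k1 k2 false r) _ m1 hm1; last by [].
move=> r.
have H flag : keeps n (mem_ok e L) (rcons [::] (nat_of_ord r))
  (fGuess k1 [::] (fun l1 => fGuess k2 [::] (fun l2 => fBody flag 0 l1 l2)))
  (accepted k1 k2 flag r).
  apply: (@keeps_guess _ (fun env => looks env 0 r)) => //.
  - by move=> *; exact: looks_rcons.
  - move=> env l1 G1 h1 h2.
    apply: (@keeps_guess _ (fun env => looks env 0 r /\ looks_seq env l1 G1)) => //.
    + by move=> env' w [? ?]; split; [exact: looks_rcons|exact: looks_seq_rcons].
    + by move=> env' l2 G2 [h3 h4] h5; exact: body_keeps.
exact: keeps_Or (H true) (H false).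
Qed.
End Algorithm.

(** * Combining the components *)

Section Decision.
Variables (n : nat) (e : rel 'I_n) (L : 'I_n -> {set 'I_3}).
Hypotheses (esym : symmetric e) (eirr : irreflexive e).

(** Every vertex of the component is dominated or in [I]: if [flag] is unset by definition,
    otherwise because the dominated set contains [r] and is closed under adjacency. *)
Lemma accepted_sound k2 flag r : accepted e L size1 k2 flag r ->
  exists c : 'I_n -> 'I_3, (forall u, connect e r u -> c u \in L u) /\
    (forall u v, connect e r u -> e u v -> c u != c v).
Proof.
case/guessP=> G1 s1 /guessP[G2 s2 /existsP[g /forallP hg]].
have {}hg x y : constraint e L flag r G1 G2 x (g x) y (g y) by have /forallP := hg x.
have G1n : G1 != [::] by case: (G1) s1.
have [c [h1 h2]] := good_sound esym eirr G1n hg.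
suff W u : connect e r u -> dom e G1 u || inI e flag G1 u.
  exists c; split=> [u /W/h1//|u v hu huv]; apply: h2 => //; first exact: W.
  by apply: W; apply: connect_trans hu (connect1 huv).
have [/implyP hc _ _ _] := globals hg; rewrite /inI; case: (flag) hc => [hc|_ _]; last by rewrite orbN.
have /andP[hr /forallP hcl] := hc isT; rewrite orbF => /connectP[p hp ->].
elim: p r hr hp {hc hg h1 h2} => //= x p IH r0 hr /andP[hx hp]; apply: IH hp.
by have /forallP/(_ x)/implyP -> := hcl r0; rewrite ?hr.
Qed.

Lemma accepted_complete c r : noP2P5 e \/ noP3P4 e ->
  (forall u, c u \in L u) -> (forall u v, e u v -> c u != c v) ->
  accepted e L size1 size2 true r || accepted e L size1 size2 false r.
Proof.
move=> H hL hc; have [flag [S1 [S2 [s1 s2 hS]]]] := complete_guess esym eirr hc hL r H.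
suff : accepted e L size1 size2 flag r by case: (flag) => ->; rewrite ?orbT.
apply/guessP; exists (coloured c S1); first by rewrite size_map.
apply/guessP; exists (coloured c S2); first by rewrite size_map.
apply/existsP; exists [ffun x => partial e c S1 x].
by apply/forallP => x; apply/forallP => y; rewrite !ffunE.
Qed.

Lemma decision : noP2P5 e \/ noP3P4 e ->
  [forall r, accepted e L size1 size2 true r || accepted e L size1 size2 false r] <->
  list3_colourable e L.
Proof.
move=> H; split=> [/forallP h|[c [h1 h2]]]; last first.
  by apply/forallP => r; exact: accepted_complete H h1 h2.
have hr r : exists c : 'I_n -> 'I_3, (forall u, connect e r u -> c u \in L u) /\
    (forall u v, connect e r u -> e u v -> c u != c v).
  by case/orP: (h r) => /accepted_sound.
have [c hc] := @fin_all_exists _ (fun=> 'I_n -> 'I_3) _ hr.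
have cs : connect_sym e by apply: sym_connect_sym.
have cr u : connect e (root e u) u by rewrite cs connect_root.
(* Adjacent vertices have the same root, so colourings chosen for different components never meet on
   an edge. *)
exists (fun u => c (root e u) u); split=> [u|u v huv]; first exact: (hc _).1.
by have /(rootP cs) <- := connect1 huv; exact: (hc _).2.
Qed.
End Decision.

Lemma poly_time_of_patterns (C : forall n, rel 'I_n -> Prop) :
  (forall n (e : rel 'I_n), symmetric e -> irreflexive e -> C n e -> noP2P5 e \/ noP3P4 e) ->
  poly_time_list3col_on C.
Proof.
move=> hC; have [M [a [d hM]]] := term_machine (fAlgorithm size1 size2 0).
exists M, a, d => n e L [esym eirr] hn x.
have [cf h1 h2] := hM n e L; exists cf; split; first exact: h1.
by rewrite h2 algorithm_value; apply: decision => //; exact: hC.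
Qed.

Theorem theorem2 :
  poly_time_list3col_on (fun n (e : rel 'I_n) => H_free P2P5 e) /\
  poly_time_list3col_on (fun n (e : rel 'I_n) => H_free P3P4 e).
Proof.
split; apply: poly_time_of_patterns => n e esym eirr h.
- by left; apply: noP2P5_free.
- by right; apply: noP3P4_free.
Qed.
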